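(* Let $n\ge 0$ be an integer, $\lambda\in\mathbb{C}$, and write $\mathcal{A}_\lambda=\mathcal{A}_\lambda(0)$. 1. $\mathcal{A}_\Lambda(n)\simeq\mathcal{M}_{2^n}(\mathfrak{S}_2\ltimes\mathcal{U})$ and $\mathcal{A}_\lambda(n)\simeq\mathcal{A}_\Lambda(n)/(\Lambda-\lambda)\mathcal{A}_\Lambda(n)$. 2. Let $C$ be the Casimir element of $\mathcal{U}$ and $\mathcal{B}_c=\mathcal{U}/(C-c)\mathcal{U}$ for $c\in\mathbb{C}$. Then $\mathcal{A}_\lambda\simeq\mathcal{B}_{\lambda^2-\frac1{16}}$ if $\lambda\ne0$, and $\mathcal{A}_0\simeq\mathcal{C}(1,2)$. 3. If $\lambda^2\ne\left(h+\frac14\right)^2$ for all $h$ with $2h\in\mathbb{N}$, then $\mathcal{A}_\lambda(n)$ is a simple algebra. If $\lambda^2=\left(h+\frac14\right)^2$ with $2h\in\mathbb{N}$, then $\mathcal{A}_\lambda(n)$ is a primitive algebra with a unique non-zero proper two-sided ideal, and this ideal is the kernel of an irreducible representation $\pi_h$ of $\mathcal{A}_\lambda(n)$ of dimension $2^n(4h+1)$. 4. $\mathcal{A}_\Lambda(n)$ is an FCR algebra. Any finite-dimensional representation of $\mathcal{A}_\lambda(n)$ is completely reducible, and it is isotypical of type $\pi_h$ (a direct sum of copies of $\pi_h$) if $\lambda^2=\left(h+\frac14\right)^2$ with $2h\in\mathbb{N}$.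
   Context: All algebras are unital associative over $\mathbb{C}$; $\mathbb{N}=\{0,1,2,\dots\}$; isomorphisms are of algebras; $[a,b]_{\mathcal L}=ab-ba$; $\mathcal{M}_r(A)$ is the algebra of $r\times r$ matrices over $A$. For $\lambda\in\mathbb{C}$, $\mathcal{A}_\lambda(n)$ is the algebra with generators $\omega_1,\dots,\omega_{2n+1},E_+,E_-$ and relations $[E_+,E_-]_{\mathcal L}=-\frac14+i^n\lambda\,\omega_1\cdots\omega_{2n+1}$, $\omega_j\omega_k+\omega_k\omega_j=2\delta_{jk}$, $E_\pm\omega_j=-\omega_jE_\pm$ ($1\le j,k\le 2n+1$). $\mathcal{A}_\Lambda(n)$ is the algebra with generators $\omega_1,\dots,\omega_{2n+1},E_+,E_-,\Lambda$, with $\Lambda$ central and the same relations with $\lambda$ replaced by $\Lambda$. $\mathcal{C}(1,2)$ is the algebra with generators $\omega,p,q$ and relations $\omega^2=1$, $pq-qp=1$, $\omega p=-p\omega$, $\omega q=-q\omega$. $\mathcal{U}=\mathcal{U}(\mathfrak{osp}(1,2))$ is the enveloping algebra of the Lie superalgebra $\mathfrak{osp}(1,2)$ with even basis $Y,F,G$, odd basis $E_+,E_-$ and super-brackets $[Y,E_\pm]=\pm\frac12E_\pm$, $[Y,F]=F$, $[Y,G]=-G$, $[F,G]=2Y$, $[F,E_+]=[G,E_-]=0$, $[F,E_-]=-E_+$, $[G,E_+]=-E_-$, $[E_+,E_+]=F$, $[E_-,E_-]=-G$, $[E_+,E_-]=Y$. Put $\theta=\frac14+(E_+E_--E_-E_+)\in\mathcal{U}$;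 the Casimir element is $C=\theta^2-\frac1{16}$, and the center of $\mathcal{U}$ is $\mathbb{C}[C]$. For a $\mathbb{Z}_2$-graded algebra $A$ (here $\mathcal{U}$ with its natural gradation), $\mathfrak{S}_2\ltimes A$ is the smash product: the algebra generated by $A$ and an element $P$ with $P^2=1$ and $Pa=(-1)^{\deg a}aP$ for homogeneous $a\in A$ (with underlying space $A\otimes\mathbb{C}[\mathfrak{S}_2]$). An algebra $A$ is FCR if every finite-dimensional representation of $A$ is completely reducible and the intersection of the kernels of all finite-dimensional representations of $A$ is $\{0\}$. *)

(* Defs.v *)
From HB Require Import structures.
From mathcomp Require Import all_boot all_order all_algebra.
From mathcomp Require Import boolp classical_sets.
From mathcomp Require Import monalg.

Set Implicit Arguments.
Unset Strict Implicit.
Unset Printing Implicit Defensive.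

Import GRing.Theory.
Local Open Scope quotient_scope.
Local Open Scope classical_set_scope.
Local Open Scope ring_scope.

(* A unital associative algebra over a commutative ring [K] is a ring with a
   ring morphism from [K] into its center; [k%:S * x] is the scalar multiple
   of [x] by [k]. The library's [algType] is not used because it requires
   1 != 0: the algebras below are built as quotients, whose nontriviality is
   not known a priori. *)
HB.mixin Record PzRing_isPzAlgebra (K : comNzRingType) A of GRing.PzRing A := {
  scal : K -> A;
  scal_is_zmod_morphism : zmod_morphism scal;
  scal_is_monoid_morphism : monoid_morphism scal;
  scalC : forall (k : K) (x : A), scal k * x = x * scal k
}.

#[short(type="pzAlgType")]
HB.structure Definition PzAlgebra (K : comNzRingType) :=
  {A of GRing.PzRing A & PzRing_isPzAlgebra K A}.

Notation "k %:S" := (scal k) (at level 1, format "k %:S") : ring_scope.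

HB.instance Definition _ (K : comNzRingType) (A : pzAlgType K) :=
  GRing.isZmodMorphism.Build K A scal scal_is_zmod_morphism.
HB.instance Definition _ (K : comNzRingType) (A : pzAlgType K) :=
  GRing.isMonoidMorphism.Build K A scal scal_is_monoid_morphism.

Definition alg_iso (K : comNzRingType) (A B : pzAlgType K) : Prop :=
  exists f : {rmorphism A -> B},
    (forall k : K, f k%:S = k%:S) /\ bijective f.

Section MatrixAlgebra.
Context (K : comNzRingType) (A : pzAlgType K) (r : nat).

Definition mx_scal (k : K) : 'M[A]_r := (k%:S)%:M.

Fact mx_scal_zmod : zmod_morphism mx_scal.
Proof. by move=> k l; rewrite /mx_scal !raddfB. Qed.

Fact mx_scal_monoid : monoid_morphism mx_scal.
Proof.
by split=> [|k l]; rewrite /mx_scal ?rmorph1 // !rmorphM.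
Qed.

Fact mx_scalC k (M : 'M[A]_r) : mx_scal k * M = M * mx_scal k.
Proof.
apply/matrixP=> i j.
have -> : mx_scal k * M = mx_scal k *m M by [].
rewrite mul_scalar_mx mxE scalC mxE.
rewrite (bigD1 j) //= big1 ?addr0 => [|l /negPf nlj]; rewrite !mxE ?eqxx //.
by rewrite nlj mulr0.
Qed.

HB.instance Definition _ := PzRing_isPzAlgebra.Build K 'M[A]_r
  mx_scal_zmod mx_scal_monoid mx_scalC.

End MatrixAlgebra.

Section AlgebraQuotient.
Context (K : comNzRingType) (A : pzAlgType K) (S : set A).

Inductive ideal_gen : A -> Prop :=
| ideal_gen_in a : S a -> ideal_gen a
| ideal_gen0 : ideal_gen 0
| ideal_genD a b : ideal_gen a -> ideal_gen b -> ideal_gen (a + b)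
| ideal_genM x a y : ideal_gen a -> ideal_gen (x * a * y).

Lemma ideal_genMl x a : ideal_gen a -> ideal_gen (x * a).
Proof. by move/(ideal_genM x 1); rewrite mulr1. Qed.

Lemma ideal_genMr a y : ideal_gen a -> ideal_gen (a * y).
Proof. by move/(ideal_genM 1 y); rewrite mul1r. Qed.

Lemma ideal_genN a : ideal_gen a -> ideal_gen (- a).
Proof. by move/(ideal_genMl (-1)); rewrite mulN1r. Qed.

Definition algquot_rel (x y : A) : bool := `[< ideal_gen (x - y) >].

Fact algquot_rel_equiv : equiv_class_of algquot_rel.
Proof.
split=> [x|x y|y x z].
- by apply/asboolP; rewrite subrr; apply: ideal_gen0.
- by apply/asboolP/asboolP => /ideal_genN; rewrite opprB.
- move=> /asboolP h1 /asboolP h2; apply/asboolP.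
  by have := ideal_genD h1 h2; rewrite addrA subrK.
Qed.

Canonical algquot_equiv := EquivRelPack algquot_rel_equiv.
Canonical algquot_encModRel := defaultEncModRel algquot_rel.

(* Quotient by the two-sided ideal generated by [S] (which is [S] itself when
   [S] is a two-sided ideal). *)
Definition algquot := {eq_quot algquot_rel}.

HB.instance Definition _ := EqQuotient.on algquot.
HB.instance Definition _ := Choice.on algquot.

Definition aq_pi (x : A) : algquot := \pi_algquot x.

Lemma aq_piP x y : aq_pi x = aq_pi y <-> ideal_gen (x - y).
Proof. by split=> [/eqmodP/asboolP|h]; [|apply/eqmodP/asboolP]. Qed.

Lemma aq_reprK : cancel (@repr A algquot) aq_pi.
Proof. exact: reprK. Qed.

Definition aq_add (u v : algquot) : algquot := aq_pi (repr u + repr v).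
Definition aq_opp (u : algquot) : algquot := aq_pi (- repr u).
Definition aq_mul (u v : algquot) : algquot := aq_pi (repr u * repr v).

Lemma aq_repr_pi x : ideal_gen (repr (aq_pi x) - x).
Proof. by apply/aq_piP; rewrite aq_reprK. Qed.

Lemma aq_addE x y : aq_add (aq_pi x) (aq_pi y) = aq_pi (x + y).
Proof.
apply/aq_piP; rewrite opprD addrACA.
by apply: ideal_genD; apply: aq_repr_pi.
Qed.

Lemma aq_oppE x : aq_opp (aq_pi x) = aq_pi (- x).
Proof. by apply/aq_piP; rewrite -opprD; apply/ideal_genN/aq_repr_pi. Qed.

Lemma aq_mulE x y : aq_mul (aq_pi x) (aq_pi y) = aq_pi (x * y).
Proof.
apply/aq_piP; set x' := repr _; set y' := repr _.
have -> : x' * y' - x * y = (x' - x) * y' + x * (y' - y).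
  by rewrite mulrBl mulrBr addrA subrK.
by apply: ideal_genD; [apply/ideal_genMr/aq_repr_pi|apply/ideal_genMl/aq_repr_pi].
Qed.

Let aqE := (aq_addE, aq_oppE, aq_mulE).

Lemma aq_ind (P : algquot -> Prop) : (forall x, P (aq_pi x)) -> forall u, P u.
Proof. by move=> h u; rewrite -(aq_reprK u). Qed.

Fact aq_addA : associative aq_add.
Proof. by do 3!elim/aq_ind=> ?; rewrite !aqE addrA. Qed.
Fact aq_addC : commutative aq_add.
Proof. by do 2!elim/aq_ind=> ?; rewrite !aqE addrC. Qed.
Fact aq_add0 : left_id (aq_pi 0) aq_add.
Proof. by elim/aq_ind=> ?; rewrite !aqE add0r. Qed.
Fact aq_addN : left_inverse (aq_pi 0) aq_opp aq_add.
Proof. by elim/aq_ind=> ?; rewrite !aqE addNr. Qed.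

HB.instance Definition _ :=
  GRing.isZmodule.Build algquot aq_addA aq_addC aq_add0 aq_addN.

Fact aq_mulA : associative aq_mul.
Proof. by do 3!elim/aq_ind=> ?; rewrite !aqE mulrA. Qed.
Fact aq_mul1l : left_id (aq_pi 1) aq_mul.
Proof. by elim/aq_ind=> ?; rewrite !aqE mul1r. Qed.
Fact aq_mul1r : right_id (aq_pi 1) aq_mul.
Proof. by elim/aq_ind=> ?; rewrite !aqE mulr1. Qed.
Fact aq_mulDl : left_distributive aq_mul +%R.
Proof.
by do 3!elim/aq_ind=> ?; rewrite -![_ + _]/(aq_add _ _) !aqE mulrDl.
Qed.
Fact aq_mulDr : right_distributive aq_mul +%R.
Proof.
by do 3!elim/aq_ind=> ?; rewrite -![_ + _]/(aq_add _ _) !aqE mulrDr.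
Qed.

HB.instance Definition _ := GRing.Zmodule_isPzRing.Build algquot
  aq_mulA aq_mul1l aq_mul1r aq_mulDl aq_mulDr.

Definition aq_scal (k : K) : algquot := aq_pi k%:S.

Fact aq_scal_zmod : zmod_morphism aq_scal.
Proof.
move=> k l; rewrite /aq_scal rmorphB -aq_addE -aq_oppE.
by rewrite -![_ - _]/(aq_add _ (aq_opp _)) !aqE.
Qed.

Fact aq_scal_monoid : monoid_morphism aq_scal.
Proof.
by split=> [|k l]; rewrite /aq_scal ?rmorph1 // rmorphM -aq_mulE.
Qed.

Fact aq_scalC k u : aq_scal k * u = u * aq_scal k.
Proof.
by elim/aq_ind: u => u; rewrite -![_ * _]/(aq_mul _ _) !aqE scalC.
Qed.

HB.instance Definition _ := PzRing_isPzAlgebra.Build K algquot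
  aq_scal_zmod aq_scal_monoid aq_scalC.

End AlgebraQuotient.

Section MonoidAlgebra.
Context (K : comNzRingType) (M : monomType).

Definition malg_scal (k : K) : {malg K[M]} := malgC k.

Fact malg_scal_zmod : zmod_morphism malg_scal.
Proof. by move=> k l; rewrite /malg_scal raddfB. Qed.

Fact malg_scal_monoid : monoid_morphism malg_scal.
Proof. by split=> [|k l]; rewrite /malg_scal ?rmorphM. Qed.

Fact malg_scalC k x : malg_scal k * x = x * malg_scal k.
Proof.
rewrite /malg_scal (monalgE x) mulr_sumr mulr_suml; apply: eq_bigr => m _.
by rewrite !malgM_def fgmulUU mul1m fgmulUU mulm1 mulrC.
Qed.

HB.instance Definition _ := PzRing_isPzAlgebra.Build K (malg M K)
  malg_scal_zmod malg_scal_monoid malg_scalC.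
HB.instance Definition _ := PzAlgebra.on {malg K[M]}.

End MonoidAlgebra.

Section Presentation.
Context (K : comNzRingType) (X : choiceType).

(* Free associative algebra on [X]: the monoid algebra of words in [X]. *)
Definition free_alg : pzAlgType K := {malg K[{fmonom X}]}.

Definition fgen (x : X) : free_alg := mkmalgU (fmu x) 1.

(* [rel l r] is read as the defining relation [l = r]. *)
Definition presented (rel : free_alg -> free_alg -> Prop) : pzAlgType K :=
  algquot [set d : free_alg | exists l r, rel l r /\ d = l - r].

Definition pgen (rel : free_alg -> free_alg -> Prop) (x : X) : presented rel :=
  aq_pi _ (fgen x).

End Presentation.

Section Smash.
Context (K : comNzRingType) (A : pzAlgType K) (gr : bool -> set A).

(* Generators: [Some a] for [a] in [A], and [None] for P. *)
Local Notation i a := (fgen K (Some a)).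
Local Notation P := (fgen K None).

(* Here [gr d] is the homogeneous component of degree [d] of [A]. The first
   three constructors impose that a |-> i a is a morphism of algebras. *)
Inductive smash_rel : free_alg K (option A) -> free_alg K (option A) -> Prop :=
| smash_add a b : smash_rel (i (a + b)) (i a + i b)
| smash_mul a b : smash_rel (i (a * b)) (i a * i b)
| smash_scal (k : K) : smash_rel (i k%:S) k%:S
| smash_PP : smash_rel (P * P) 1
| smash_P d a : gr d a -> smash_rel (P * i a) ((-1) ^+ d * (i a * P)).

Definition smash_alg : pzAlgType K := presented smash_rel.

End Smash.

Section Ideals.
Context (K : comNzRingType) (A : pzAlgType K).

Definition two_sided_ideal (I : set A) : Prop :=
  [/\ I 0, forall x y, I x -> I y -> I (x + y),
      forall a x, I x -> I (a * x) & forall a x, I x -> I (x * a)].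

Definition nonzero_proper_ideal (I : set A) : Prop :=
  [/\ two_sided_ideal I, I <> [set 0] & I <> setT].

Definition simple_alg : Prop :=
  (1 : A) <> 0 /\
  forall I : set A, two_sided_ideal I -> I = [set 0] \/ I = setT.

End Ideals.

Section Representations.
Context (K : comNzRingType) (A : pzAlgType K).

Record rep (V : lmodType K) := Rep {
  rep_act :> A -> V -> V;
  rep_actDl : forall a b v, rep_act (a + b) v = rep_act a v + rep_act b v;
  rep_actDr : forall a u v, rep_act a (u + v) = rep_act a u + rep_act a v;
  rep_actM : forall a b v, rep_act (a * b) v = rep_act a (rep_act b v);
  rep_actS : forall (k : K) v, rep_act k%:S v = k *: v
}.

Definition rep_ker (V : lmodType K) (rho : rep V) : set A :=
  [set a | forall v, rho a v = 0].

Definition subrep (V : lmodType K) (rho : rep V) (W : set V) : Prop :=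
  [/\ W 0, forall u v, W u -> W v -> W (u + v),
      forall (k : K) v, W v -> W (k *: v) & forall a v, W v -> W (rho a v)].

Definition irreducible_subrep (V : lmodType K) (rho : rep V) (W : set V) :
    Prop :=
  [/\ subrep rho W, W <> [set 0] &
      forall U, subrep rho U -> U `<=` W -> U = [set 0] \/ U = W].

Definition irreducible (V : lmodType K) (rho : rep V) : Prop :=
  irreducible_subrep rho setT.

Definition primitive_alg : Prop :=
  exists (V : lmodType K) (rho : rep V), irreducible rho /\ rep_ker rho = [set 0].

Definition isotypical (V0 : lmodType K) (pi : rep V0)
    (V : lmodType K) (rho : rep V) : Prop :=
  exists (m : nat) (f : {linear {ffun 'I_m -> V0} -> V}),
    bijective f /\
    forall a (u : {ffun 'I_m -> V0}), f [ffun j => pi a (u j)] = rho a (f u).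

End Representations.

Section FiniteDimRepresentations.
Context (K : fieldType) (A : pzAlgType K).

Definition completely_reducible (V : vectType K) (rho : rep A V) : Prop :=
  exists (m : nat) (W : 'I_m -> {vspace V}),
    [/\ forall j, irreducible_subrep rho [set v | v \in W j],
        directv (\sum_(j < m) W j)%VS & (\sum_(j < m) W j)%VS = fullv].

Definition FCR : Prop :=
  (forall (V : vectType K) (rho : rep A V), completely_reducible rho) /\
  (forall a : A, (forall (V : vectType K) (rho : rep A V), rep_ker rho a) ->
     a = 0).

End FiniteDimRepresentations.

Inductive A_gen (n : nat) : Type :=
| A_omega of 'I_(n.*2.+1) | A_Ep | A_Em.
HB.instance Definition _ (n : nat) := gen_eqMixin (A_gen n).
HB.instance Definition _ (n : nat) := gen_choiceMixin (A_gen n).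

Inductive AL_gen (n : nat) : Type :=
| AL_omega of 'I_(n.*2.+1) | AL_Ep | AL_Em | AL_Lambda.
HB.instance Definition _ (n : nat) := gen_eqMixin (AL_gen n).
HB.instance Definition _ (n : nat) := gen_choiceMixin (AL_gen n).

Inductive C12_gen : Type := C12_omega | C12_p | C12_q.
HB.instance Definition _ := gen_eqMixin C12_gen.
HB.instance Definition _ := gen_choiceMixin C12_gen.

Inductive osp_basis : Type := osp_Y | osp_F | osp_G | osp_Ep | osp_Em.
HB.instance Definition _ := gen_eqMixin osp_basis.
HB.instance Definition _ := gen_choiceMixin osp_basis.

Section Algebras.
Context (C : numClosedFieldType).

Section A_lambda.
Context (n : nat) (lam : C).
Local Notation w j := (fgen C (A_omega j)).
Local Notation Ep := (fgen C (A_Ep n)).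
Local Notation Em := (fgen C (A_Em n)).

Inductive A_rel : free_alg C (A_gen n) -> free_alg C (A_gen n) -> Prop :=
| A_rel_E :
    A_rel (Ep * Em - Em * Ep)
          ((- 4^-1 : C)%:S
             + ('i ^+ n * lam)%:S * \prod_(j < n.*2.+1) w j)
| A_rel_w j k : A_rel (w j * w k + w k * w j) ((2 * (j == k)%:R : C)%:S)
| A_rel_Ep j : A_rel (Ep * w j) (- (w j * Ep))
| A_rel_Em j : A_rel (Em * w j) (- (w j * Em)).

Definition A_lambda : pzAlgType C := presented A_rel.
End A_lambda.

Section A_Lambda.
Context (n : nat).
Local Notation w j := (fgen C (AL_omega j)).
Local Notation Ep := (fgen C (AL_Ep n)).
Local Notation Em := (fgen C (AL_Em n)).
Local Notation L := (fgen C (AL_Lambda n)).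

Inductive AL_rel : free_alg C (AL_gen n) -> free_alg C (AL_gen n) -> Prop :=
| AL_rel_E :
    AL_rel (Ep * Em - Em * Ep)
           ((- 4^-1 : C)%:S
              + ('i ^+ n)%:S * (L * \prod_(j < n.*2.+1) w j))
| AL_rel_w j k : AL_rel (w j * w k + w k * w j) ((2 * (j == k)%:R : C)%:S)
| AL_rel_Ep j : AL_rel (Ep * w j) (- (w j * Ep))
| AL_rel_Em j : AL_rel (Em * w j) (- (w j * Em))
| AL_rel_L x : AL_rel (L * fgen C x) (fgen C x * L).

Definition A_Lambda : pzAlgType C := presented AL_rel.

Definition Lambda : A_Lambda := pgen AL_rel (AL_Lambda n).
End A_Lambda.

Section C12.
Local Notation w := (fgen C C12_omega).
Local Notation p := (fgen C C12_p).
Local Notation q := (fgen C C12_q).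

Inductive C12_rel : free_alg C C12_gen -> free_alg C C12_gen -> Prop :=
| C12_rel_w : C12_rel (w * w) 1
| C12_rel_pq : C12_rel (p * q - q * p) 1
| C12_rel_wp : C12_rel (w * p) (- (p * w))
| C12_rel_wq : C12_rel (w * q) (- (q * w)).

Definition C12 : pzAlgType C := presented C12_rel.
End C12.

Section Osp12.
Local Notation T := (free_alg C osp_basis).
Local Notation g x := (fgen C x).

Definition osp_parity (x : osp_basis) : bool :=
  match x with osp_Ep | osp_Em => true | _ => false end.

(* Super-bracket of two basis elements, as an element of degree 1 of the
   free (tensor) algebra on the basis. *)
Definition osp_bracket (x y : osp_basis) : T :=
  match x, y with
  | osp_Y, osp_Ep => (2^-1 : C)%:S * g osp_Ep
  | osp_Y, osp_Em => - ((2^-1 : C)%:S * g osp_Em)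
  | osp_Y, osp_F => g osp_F
  | osp_Y, osp_G => - g osp_G
  | osp_F, osp_G => (2 : C)%:S * g osp_Y
  | osp_F, osp_Em => - g osp_Ep
  | osp_G, osp_Ep => - g osp_Em
  | osp_Ep, osp_Ep => g osp_F
  | osp_Em, osp_Em => - g osp_G
  | osp_Ep, osp_Em => g osp_Y
  (* super-antisymmetry *)
  | osp_Ep, osp_Y => - ((2^-1 : C)%:S * g osp_Ep)
  | osp_Em, osp_Y => (2^-1 : C)%:S * g osp_Em
  | osp_F, osp_Y => - g osp_F
  | osp_G, osp_Y => g osp_G
  | osp_G, osp_F => - ((2 : C)%:S * g osp_Y)
  | osp_Em, osp_F => g osp_Ep
  | osp_Ep, osp_G => g osp_Em
  | osp_Em, osp_Ep => g osp_Y
  | _, _ => 0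
  end.

Inductive U_rel : T -> T -> Prop :=
| U_rel_bracket x y :
    U_rel (g x * g y - (-1) ^+ (osp_parity x && osp_parity y) * (g y * g x))
          (osp_bracket x y).

Definition U_osp12 : pzAlgType C := presented U_rel.

Local Notation u x := (pgen U_rel x).

(* Natural gradation: the component of degree [d] is spanned by the words in
   the basis having an even ([false]) or odd ([true]) number of odd letters. *)
Inductive U_gr : bool -> set U_osp12 :=
| U_gr1 : U_gr false 1
| U_gr_gen x : U_gr (osp_parity x) (u x)
| U_grM d e a b : U_gr d a -> U_gr e b -> U_gr (d (+) e) (a * b)
| U_gr0 d : U_gr d 0
| U_grD d a b : U_gr d a -> U_gr d b -> U_gr d (a + b)
| U_grS d (k : C) a : U_gr d a -> U_gr d (k%:S * a).

Definition S2_smash_U : pzAlgType C := smash_alg U_gr.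

Definition U_theta : U_osp12 :=
  (4^-1 : C)%:S + (u osp_Ep * u osp_Em - u osp_Em * u osp_Ep).

Definition U_casimir : U_osp12 := U_theta ^+ 2 - (16^-1 : C)%:S.

Definition B_alg (c : C) : pzAlgType C :=
  algquot [set (U_casimir - c%:S) * x | x in [set: U_osp12]].
End Osp12.

End Algebras.

(* Main.v *)
Require Import Defs.
From HB Require Import structures.
From mathcomp Require Import all_boot all_order all_algebra finmap.
From mathcomp Require Import ring.
From mathcomp Require Import boolp classical_sets reals complex.
From mathcomp Require Import monalg.

Set Implicit Arguments.
Unset Strict Implicit.
Unset Printing Implicit Defensive.

Import Order.TTheory GRing.Theory Num.Theory.
Local Open Scope classical_set_scope.
Local Open Scope ring_scope.

(** Reduction to n = 0. In the algebra of level n+1, the elements X = omega_1 and Z = i omega_1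
    omega_2 satisfy X^2 = Z^2 = 1 and XZ = -ZX, so they generate a copy of the 2 x 2 matrices. The
    remaining generators, multiplied by Z, commute with this copy and satisfy the relations of level
    n. Hence level n+1 is M_2 of level n ([AO_double]), and level n is M_(2^n) of level 0
    ([AO_reduce]), for fixed lambda and for central Lambda alike.

    At level 0 the relation says that theta = 1/4 + [E_+, E_-] equals Lambda omega, so theta
    anticommutes with E_+ and E_-. This anticommutation presents U(osp(1,2)) on the generators E_+
    and E_-; thus omega corresponds to P and Lambda to theta P ([A_Lambda0_smash]). If lambda is
    nonzero, omega = theta / lambda, and omega^2 = 1 becomes C = lambda^2 - 1/16 ([casimir_iso]). If
    lambda = 0, then p = 2 E_- and q = 2 E_+ ([weyl_iso]).

    Ideals. Write x, y, w for E_+, E_-, omega and Y = xy + yx. The algebra is graded by the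
    eigenvalues of ad Y, its degree zero part being polynomials in Y times the spectral projections
    of w (and matrix units). So a nonzero ideal contains a nonzero polynomial in Y ([ideal_pev]); as
    x shifts Y, and a polynomial is coprime to some translate of itself, the ideal contains powers
    of x and of y ([ideal_nilpotent]). Call a representation bounded if some x^N and y^N act by
    zero: this covers every finite-dimensional representation and every quotient B/I with I nonzero.

    Bounded representations. Put a = Y + Lw and b = Y - Lw. The product x^N y^N is, up to a scalar,
    f(a) g(b) with f and g having simple positive roots. From this and its mirror image, a and b are
    diagonalizable, and on a joint eigenvector their eigenvalues have opposite signs ([sign_cond]).
    This sign rule prevents yx from vanishing on an eigenvector that x does not kill, so a vector
    killed by y generates an irreducible module ([lowest_irreducible]); such modules span, and
    complete reducibility follows. For L = lambda, a lowest vector exists only if lambda^2 = (h +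
    1/4)^2 with 2h a natural number, and its weights are then determined ([lowest_weights],
    [lowest_unique]); equal weights give equal annihilators ([lowest_ann]). Applied to B/I, this
    yields simplicity, or the uniqueness of the ideal ([ideal_total], [ideal_unique]).

    Existence. The module C[X], with x acting as multiplication by X, has for one choice of sign a
    quotient of dimension 4h + 1, giving pi_h; for the other sign it is irreducible and unbounded,
    hence faithful, giving primitivity. For A_Lambda(n), an element killed by all finite-dimensional
    representations would produce a nonzero polynomial in Lambda and Y vanishing at the weights of
    all truncated modules, which is impossible ([fd_separated]). *)

Lemma sum_by_key (I : Type) (J : eqType) (V : nmodType) (key : I -> J)
    (s : seq I) (F : I -> V) :
  \sum_(i <- s) F i
    = \sum_(j <- undup (map key s)) \sum_(i <- s | key i == j) F i.
Proof.
have: {subset map key s <= undup (map key s)} by move=> j; rewrite mem_undup.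
have: uniq (undup (map key s)) by apply: undup_uniq.
move: (undup _) => t ut.
elim: s => [|i s IH] /= st; first by rewrite big_nil big1 // => j _; rewrite big_nil.
rewrite big_cons IH => [|j js]; last by apply: st; rewrite inE js orbT.
rewrite [RHS](eq_bigr (fun j => (if key i == j then F i else 0)
  + \sum_(i <- s | key i == j) F i)) => [|j _]; last first.
  by rewrite big_cons; case: eqP => // _; rewrite add0r.
rewrite big_split /= -big_mkcond; congr (_ + _).
under eq_bigl do rewrite [_ == _]eq_sym.
by rewrite -[RHS](big_filter) (@filter_pred1_uniq _ t (key i)) ?big_seq1 ?st ?mem_head.
Qed.

(** * Reflexive decision of identities in noncommutative rings *)

Inductive ncexpr :=
| NCvar of nat | NC0 | NC1
| NCadd of ncexpr & ncexpr | NCopp of ncexpr | NCmul of ncexpr & ncexpr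
| NCmuln of ncexpr & nat.

Section NCRing.
Context (A : pzRingType) (env : seq A).

Fixpoint nceval e : A :=
  match e with
  | NCvar i => nth 0 env i
  | NC0 => 0
  | NC1 => 1
  | NCadd e f => nceval e + nceval f
  | NCopp e => - nceval e
  | NCmul e f => nceval e * nceval f
  | NCmuln e n => nceval e *+ n
  end.

Fixpoint ncnorm e : seq (int * seq nat) :=
  match e with
  | NCvar i => [:: (1, [:: i])]
  | NC0 => [::]
  | NC1 => [:: (1, [::])]
  | NCadd e f => ncnorm e ++ ncnorm f
  | NCopp e => [seq (- p.1, p.2) | p <- ncnorm e]
  | NCmul e f => [seq (p.1 * q.1, p.2 ++ q.2) | p <- ncnorm e, q <- ncnorm f]
  | NCmuln e n => [seq (p.1 *+ n, p.2) | p <- ncnorm e]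
  end.

Definition ncmon (s : seq nat) : A := \prod_(i <- s) nth 0 env i.
Definition nclin (l : seq (int * seq nat)) : A := \sum_(p <- l) ncmon p.2 *~ p.1.

Lemma nclin_norm e : nclin (ncnorm e) = nceval e.
Proof.
rewrite /nclin; elim: e => [i|||e1 IH1 e2 IH2|e IH|e1 IH1 e2 IH2|e IH n] /=.
- by rewrite big_seq1 /ncmon big_seq1 mulr1z.
- by rewrite big_nil.
- by rewrite big_seq1 /ncmon big_nil mulr1z.
- by rewrite big_cat /= IH1 IH2.
- by rewrite big_map /= -IH -sumrN; apply: eq_bigr => p _; rewrite mulrNz.
- rewrite big_allpairs_dep -IH1 -IH2 mulr_suml; apply: eq_bigr => p _.
  rewrite mulr_sumr; apply: eq_bigr => q _.
  by rewrite /ncmon big_cat /= mulrzAl mulrzAr -mulrzA mulrC.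
- rewrite big_map /= -IH -sumrMnl; apply: eq_bigr => p _.
  by rewrite -mulr_natr mulrzA natz pmulrn.
Qed.

Definition nccoef (w : seq nat) (l : seq (int * seq nat)) : int :=
  foldr (fun p c => if p.2 == w then p.1 + c else c) 0 l.

(** Monomials are never sorted: a list evaluates to zero as soon as the total coefficient of each
    word occurring in it vanishes. *)
Definition nczero (l : seq (int * seq nat)) : bool :=
  all (fun p => nccoef p.2 l == 0) l.

Lemma nclin_coef w l :
  \sum_(p <- l | p.2 == w) ncmon p.2 *~ p.1 = ncmon w *~ nccoef w l.
Proof.
elim: l => [|p l IH]; first by rewrite big_nil mulr0z.
by rewrite big_cons IH /=; case: eqP => [->|//]; rewrite mulrzDr.
Qed.

Lemma nczeroP l : nczero l -> nclin l = 0.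
Proof.
move=> /allP l0; rewrite /nclin (sum_by_key (fun p => p.2)).
rewrite big_seq big1 // => w; rewrite mem_undup => /mapP[p pl ->].
by rewrite nclin_coef (eqP (l0 p pl)) mulr0z.
Qed.

Lemma ncringP e f : nczero (ncnorm (NCadd e (NCopp f))) -> nceval e = nceval f.
Proof. by move/nczeroP; rewrite nclin_norm => /eqP; rewrite subr_eq0 => /eqP. Qed.

End NCRing.

Ltac nc_mem x l :=
  lazymatch l with
  | nil => constr:(false)
  | cons x _ => constr:(true)
  | cons _ ?l' => nc_mem x l'
  end.
Ltac nc_add x l :=
  let b := nc_mem x l in
  lazymatch b with true => l | false => constr:(cons x l) end.
Ltac nc_idx x l :=
  lazymatch l with
  | cons x _ => constr:(0%N)
  | cons _ ?l' => let n := nc_idx x l' in constr:(S n)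
  end.
Ltac nc_atoms t l :=
  lazymatch t with
  | 0%R => l
  | 1%R => l
  | (?a + ?b)%R => let l' := nc_atoms a l in nc_atoms b l'
  | (- ?a)%R => nc_atoms a l
  | (?a * ?b)%R => let l' := nc_atoms a l in nc_atoms b l'
  | (?a *+ ?n)%R => nc_atoms a l
  | _ => nc_add t l
  end.
Ltac nc_reify t l :=
  lazymatch t with
  | 0%R => constr:(NC0)
  | 1%R => constr:(NC1)
  | (?a + ?b)%R => let a' := nc_reify a l in let b' := nc_reify b l in
      constr:(NCadd a' b')
  | (- ?a)%R => let a' := nc_reify a l in constr:(NCopp a')
  | (?a * ?b)%R => let a' := nc_reify a l in let b' := nc_reify b l in
      constr:(NCmul a' b')
  | (?a *+ ?n)%R => let a' := nc_reify a l in constr:(NCmuln a' n)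
  | _ => let n := nc_idx t l in constr:(NCvar n)
  end.
Ltac ncring :=
  lazymatch goal with
  | |- @eq ?T ?a ?b =>
    let l := nc_atoms a (@nil T) in
    let l := nc_atoms b l in
    let a' := nc_reify a l in
    let b' := nc_reify b l in
    refine (@ncringP _ l a' b' _); vm_compute; reflexivity
  end.

(** * Universal properties of free algebras, quotients and presentations *)

Section FreeLift.
Context (K : comNzRingType) (X : choiceType) (A : pzAlgType K) (phi : X -> A).

Definition word_lift (m : {fmonom X}) : A := \prod_(x <- (m : seq X)) phi x.

Definition free_lift (g : free_alg K X) : A :=
  \sum_(m <- msupp (g : {malg K[{fmonom X}]})) (mcoeff m g)%:S * word_lift m.

(** Any finite set containing the support will do; two elements can thus be expanded over the same
    set of words. *)
Lemma free_liftEw (d : {fset {fmonom X}}) (g : {malg K[{fmonom X}]}) :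
  (msupp g `<=` d)%fset ->
  free_lift g = \sum_(m <- d) (mcoeff m g)%:S * word_lift m.
Proof.
move=> le; rewrite [LHS](big_fset_incl _ le) => //= x xd /mcoeff_outdom ->.
by rewrite raddf0 mul0r.
Qed.

Lemma free_liftU k m : free_lift (mkmalgU m k) = k%:S * word_lift m.
Proof. by rewrite (free_liftEw msuppU_le) big_seq_fset1 mcoeffUU. Qed.

Fact free_lift_zmod : zmod_morphism free_lift.
Proof.
move=> g1 g2.
set d := (msupp (g1 : {malg K[{fmonom X}]}) `|` msupp (g2 : {malg K[{fmonom X}]}))%fset.
rewrite (@free_liftEw d g1) ?fsubsetUl // (@free_liftEw d g2) ?fsubsetUr //.
rewrite (@free_liftEw d (g1 - g2)) ?msuppB_le // -sumrB.
by apply: eq_bigr => m _; rewrite mcoeffB raddfB mulrBl.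
Qed.

HB.instance Definition _ := GRing.isZmodMorphism.Build _ _ free_lift free_lift_zmod.

Lemma word_liftM m1 m2 : word_lift (mmul m1 m2) = word_lift m1 * word_lift m2.
Proof. by rewrite /word_lift fmM big_cat. Qed.

Fact free_lift_monoid : monoid_morphism free_lift.
Proof.
split=> [|g1 g2].
  transitivity (1%:S * word_lift mone); first exact: free_liftU.
  rewrite rmorph1 mul1r.
  by rewrite /word_lift fm1 big_nil.
rewrite {1}(monalgE g1) {1}(monalgE g2) mulr_suml raddf_sum [in RHS]mulr_suml.
apply: eq_bigr => m _; rewrite mulr_sumr raddf_sum mulr_sumr.
apply: eq_bigr => m' _.
rewrite malgM_def fgmulUU.
transitivity ((mcoeff m g1 * mcoeff m' g2)%:S * word_lift (mmul m m')).
  exact: free_liftU.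
rewrite word_liftM rmorphM.
transitivity ((mcoeff m g1)%:S * word_lift m * ((mcoeff m' g2)%:S * word_lift m')).
  by rewrite -!mulrA; congr (_ * _); rewrite !mulrA scalC.
by congr (_ * _); symmetry; apply: free_liftU.
Qed.

HB.instance Definition _ :=
  GRing.isMonoidMorphism.Build _ _ free_lift free_lift_monoid.

Lemma free_liftS k : free_lift k%:S = k%:S.
Proof.
transitivity (k%:S * word_lift mone); first exact: free_liftU.
by rewrite /word_lift fm1 big_nil mulr1.
Qed.

Lemma free_lift_gen x : free_lift (fgen K x) = phi x.
Proof. by rewrite free_liftU rmorph1 mul1r /word_lift fmU big_seq1. Qed.

Lemma free_liftD a b : free_lift (a + b) = free_lift a + free_lift b.
Proof. exact: rmorphD. Qed.
Lemma free_liftN a : free_lift (- a) = - free_lift a.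
Proof. exact: rmorphN. Qed.
Lemma free_liftM a b : free_lift (a * b) = free_lift a * free_lift b.
Proof. exact: rmorphM. Qed.
Lemma free_lift0 : free_lift 0 = 0.
Proof. exact: raddf0. Qed.
Lemma free_lift1 : free_lift 1 = 1.
Proof. exact: rmorph1. Qed.
Lemma free_lift_prod n (F : 'I_n -> free_alg K X) :
  free_lift (\prod_j F j) = \prod_j free_lift (F j).
Proof. exact: rmorph_prod. Qed.

End FreeLift.

(* Unification up to conversion is very expensive in quotients of free
   algebras, so images under morphisms are computed by syntactic recursion. *)
Ltac push_morph D N M Z O S G P t :=
  lazymatch t with
  | (?a + ?b)%R =>
    let p := push_morph D N M Z O S G P a in
    let q := push_morph D N M Z O S G P b in
    constr:(etrans (D a b) (f_equal2 +%R p q))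
  | (?a * ?b)%R =>
    let p := push_morph D N M Z O S G P a in
    let q := push_morph D N M Z O S G P b in
    constr:(etrans (M a b) (f_equal2 *%R p q))
  | (- ?a)%R =>
    let p := push_morph D N M Z O S G P a in
    constr:(etrans (N a) (f_equal -%R p))
  | 0%R => Z
  | 1%R => O
  | scal ?k => constr:(S k)
  | (\prod_(j < _) @?F j)%R => constr:(P _ F)
  | fgen _ ?x => constr:(G x)
  end.

Ltac free_lift_eval phi t :=
  push_morph (free_liftD phi) (free_liftN phi) (free_liftM phi)
    (free_lift0 phi) (free_lift1 phi) (free_liftS phi) (free_lift_gen phi)
    (@free_lift_prod _ _ _ phi) t.
Ltac free_lift_simp :=
  lazymatch goal with
  | |- free_lift ?phi ?a = free_lift _ ?b =>
    let p := free_lift_eval phi a in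
    let q := free_lift_eval phi b in
    refine (etrans p (etrans _ (esym q)))
  end.

Lemma free_ind (K : comNzRingType) (X : choiceType) (P : free_alg K X -> Prop) :
  (forall k, P k%:S) -> (forall x, P (fgen K x)) ->
  (forall a b, P a -> P b -> P (a + b)) ->
  (forall a b, P a -> P b -> P (a * b)) -> forall a, P a.
Proof.
move=> PS Pg PD PM a.
have P0 : P 0 by have := PS 0; rewrite rmorph0.
have P1 : P 1 by have := PS 1; rewrite rmorph1.
rewrite (monalgE a); apply: big_ind => // m _.
have -> : mkmalgU m (mcoeff m a) = (mcoeff m a)%:S * mkmalgU m 1 :> free_alg K X.
  by rewrite -[_%:S]/(malgC _) malgM_def fgmulUU mulr1 mul1m.
apply: (PM) => //; case: m => s; elim: s => [|x s IH].
  by rewrite -fmoneE.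
have -> : mkmalgU (FMonom (x :: s)) 1 = fgen K x * mkmalgU (FMonom s) 1 :> free_alg K X.
  rewrite /fgen malgM_def fgmulUU mulr1; congr (mkmalgU _ _).
  by rewrite -[RHS]/(fmmul _ _) fmmulE fmuE.
by apply: PM.
Qed.

Section Quotient.
Context (K : comNzRingType) (A : pzAlgType K) (S : set A).

Fact aq_pi_zmod : zmod_morphism (@aq_pi K A S).
Proof.
move=> x y; rewrite -aq_addE -aq_oppE.
by [].
Qed.
HB.instance Definition _ :=
  GRing.isZmodMorphism.Build A (algquot S) (@aq_pi K A S) aq_pi_zmod.

Fact aq_pi_monoid : monoid_morphism (@aq_pi K A S).
Proof. by split=> // x y; rewrite -aq_mulE. Qed.
HB.instance Definition _ :=
  GRing.isMonoidMorphism.Build A (algquot S) (@aq_pi K A S) aq_pi_monoid.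

Lemma aq_piS k : aq_pi S k%:S = k%:S.
Proof. by []. Qed.

Context (B : pzAlgType K) (f : {rmorphism A -> B}).
Hypothesis f0 : forall a, S a -> f a = 0.

Lemma ideal_gen_ker a : ideal_gen S a -> f a = 0.
Proof.
elim=> {a} [a /f0||a b _ fa _ fb|x a y _ fa] //; first exact: rmorph0.
  by rewrite rmorphD fa fb addr0.
by rewrite !rmorphM fa mulr0 mul0r.
Qed.

Definition aq_lift (u : algquot S) : B := f (repr u).

Lemma aq_lift_pi a : aq_lift (aq_pi S a) = f a.
Proof.
by apply/eqP; rewrite -subr_eq0 -rmorphB; apply/eqP/ideal_gen_ker/aq_repr_pi.
Qed.

Fact aq_lift_zmod : zmod_morphism aq_lift.
Proof.
by elim/aq_ind=> a; elim/aq_ind=> b; rewrite -rmorphB !aq_lift_pi rmorphB.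
Qed.
HB.instance Definition _ := GRing.isZmodMorphism.Build _ _ aq_lift aq_lift_zmod.

Fact aq_lift_monoid : monoid_morphism aq_lift.
Proof.
split=> [|]; first by rewrite aq_lift_pi rmorph1.
by elim/aq_ind=> a; elim/aq_ind=> b; rewrite -rmorphM !aq_lift_pi rmorphM.
Qed.
HB.instance Definition _ := GRing.isMonoidMorphism.Build _ _ aq_lift aq_lift_monoid.
Definition aq_lift_rmorph : {rmorphism algquot S -> B} := aq_lift.

End Quotient.

Definition alg_morph (K : comNzRingType) (A B : pzAlgType K) (f : A -> B) :=
  forall k : K, f k%:S = k%:S.

Lemma aq_univ (K : comNzRingType) (A : pzAlgType K) (S : set A)
    (B : pzAlgType K) (f : {rmorphism A -> B}) :
  alg_morph f -> (forall a, S a -> f a = 0) ->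
  exists g : {rmorphism algquot S -> B},
    alg_morph g /\ forall a, g (aq_pi S a) = f a.
Proof.
move=> fS f0; exists (aq_lift_rmorph f0); split=> [k|a]; last exact: aq_lift_pi.
by rewrite -aq_piS /= aq_lift_pi // fS.
Qed.

Section PresentedUniv.
Context (K : comNzRingType) (X : choiceType).
Context (rel : free_alg K X -> free_alg K X -> Prop).

Definition pres (a : free_alg K X) : presented rel := aq_pi _ a.

Lemma presD a b : pres (a + b) = pres a + pres b.
Proof. exact: (raddfD (@aq_pi K _ _)). Qed.
Lemma presN a : pres (- a) = - pres a.
Proof. exact: (raddfN (@aq_pi K _ _)). Qed.
Lemma presM a b : pres (a * b) = pres a * pres b.
Proof. exact: (rmorphM (@aq_pi K _ _)). Qed.
Lemma pres0 : pres 0 = 0.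
Proof. by []. Qed.
Lemma pres1 : pres 1 = 1.
Proof. by []. Qed.
Lemma pres_prod n (F : 'I_n -> free_alg K X) :
  pres (\prod_j F j) = \prod_j pres (F j).
Proof. exact: (rmorph_prod (@aq_pi K _ _)). Qed.
Lemma presS k : pres k%:S = k%:S.
Proof. by []. Qed.
Lemma pres_gen x : pres (fgen K x) = pgen rel x.
Proof. by []. Qed.

Lemma pgen_rel l r : rel l r -> pres l = pres r.
Proof. by move=> lr; apply/aq_piP/ideal_gen_in; exists l, r. Qed.

Lemma pgen_ind (P : presented rel -> Prop) :
  (forall k, P k%:S) -> (forall x, P (pgen rel x)) ->
  (forall a b, P a -> P b -> P (a + b)) ->
  (forall a b, P a -> P b -> P (a * b)) -> forall a, P a.
Proof.
move=> PS Pg PD PM; elim/aq_ind; apply: free_ind => // [a b Pa Pb|a b Pa Pb].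
  by rewrite rmorphD; apply: PD.
by rewrite rmorphM; apply: PM.
Qed.

Lemma pgen_univ (B : pzAlgType K) (phi : X -> B) :
  (forall l r, rel l r -> free_lift phi l = free_lift phi r) ->
  exists f : {rmorphism presented rel -> B},
    alg_morph f /\ forall x, f (pgen rel x) = phi x.
Proof.
move=> phi_rel.
have [|a [l [r [lr ->]]]|g [gS gE]] := @aq_univ _ _
    [set d | exists l r, rel l r /\ d = l - r] _ (free_lift phi).
- by move=> k; apply: free_liftS.
- by rewrite rmorphB /= (phi_rel _ _ lr) subrr.
by exists g; split=> // x; rewrite gE /= free_lift_gen.
Qed.

Lemma pgen_eq (B : pzAlgType K) (f g : {rmorphism presented rel -> B}) :
  alg_morph f -> alg_morph g ->
  (forall x, f (pgen rel x) = g (pgen rel x)) -> f =1 g.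
Proof.
move=> fS gS fg; elim/pgen_ind => [k||a b fa fb|a b fa fb] //.
- by rewrite fS gS.
- by rewrite !rmorphD fa fb.
- by rewrite !rmorphM fa fb.
Qed.

End PresentedUniv.

Ltac pres_eval rel t :=
  push_morph (@presD _ _ rel) (@presN _ _ rel) (@presM _ _ rel)
    (@pres0 _ _ rel) (@pres1 _ _ rel) (@presS _ _ rel) (@pres_gen _ _ rel) (@pres_prod _ _ rel) t.
Ltac pgen_rel_simp H :=
  let T := type of (pgen_rel H) in
  lazymatch T with
  | @pres _ _ ?rel ?a = pres _ ?b =>
    let p := pres_eval rel a in
    let q := pres_eval rel b in
    have := etrans (esym p) (etrans (pgen_rel H) q)
  end.

(** * Isomorphisms, endomorphism algebras, pullback of representations *)

Lemma alg_iso_of (K : comNzRingType) (A B : pzAlgType K)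
    (f : {rmorphism A -> B}) (g : {rmorphism B -> A}) :
  alg_morph f -> cancel f g -> cancel g f -> alg_iso A B.
Proof. by move=> fS fK gK; exists f; split=> //; exists g. Qed.

Lemma alg_iso_refl (K : comNzRingType) (A : pzAlgType K) : alg_iso A A.
Proof. by exists idfun; split=> //; exists id. Qed.

Lemma alg_iso_sym (K : comNzRingType) (A B : pzAlgType K) :
  alg_iso A B -> alg_iso B A.
Proof.
move=> [f [fS fb]]; case: (fb) => g fK gK.
have gz : zmod_morphism g by apply: can2_zmod_morphism fK gK.
have gm : monoid_morphism g by apply: can2_monoid_morphism fK gK.
pose zm := GRing.isZmodMorphism.Build _ _ g gz.
pose mm := GRing.isMonoidMorphism.Build _ _ g gm.
pose h : {rmorphism B -> A} := HB.pack g zm mm.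
by exists h; split=> [k|]; [rewrite /= -fS fK | exists f].
Qed.

Lemma alg_iso_trans (K : comNzRingType) (A B D : pzAlgType K) :
  alg_iso A B -> alg_iso B D -> alg_iso A D.
Proof.
move=> [f [fS fb]] [g [gS gb]]; exists (g \o f); split=> [k|].
  by rewrite /= fS gS.
exact: bij_comp.
Qed.

Section Endo.
Context (K : comNzRingType) (V : lmodType K).

(** Linear endomorphisms form an algebra for every [V], also zero or infinite-dimensional. A
    representation of a presented algebra is then a morphism into [endo], provided by the universal
    property. *)
Record endo := Endo { endo_fun :> V -> V; endo_lin : linear endo_fun }.

Lemma endoP (f g : endo) : endo_fun f =1 endo_fun g -> f = g.
Proof.
case: f g => f fl [g gl] /= /funext fg.
by case: _ / fg in gl *; congr Endo; apply: Prop_irrelevance.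
Qed.

HB.instance Definition _ := gen_eqMixin endo.
HB.instance Definition _ := gen_choiceMixin endo.

Lemma endoD (f : endo) u v : f (u + v) = f u + f v.
Proof. by have := endo_lin f 1 u v; rewrite !scale1r. Qed.
Lemma endo0 (f : endo) : f 0 = 0.
Proof. by apply: (@addrI _ (f 0)); rewrite -endoD !addr0. Qed.
Lemma endoZ (f : endo) k u : f (k *: u) = k *: f u.
Proof. by have := endo_lin f k u 0; rewrite endo0 !addr0. Qed.


Fact endo_add_lin (f g : endo) : linear (fun v => f v + g v).
Proof. by move=> k u v; rewrite !endoD !endoZ scalerDr addrACA. Qed.
Fact endo_opp_lin (f : endo) : linear (fun v => - f v).
Proof. by move=> k u v; rewrite !endoD !endoZ opprD scalerN. Qed.
Fact endo_scal_lin (c : K) : linear (fun v : V => c *: v).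
Proof. by move=> k u v; rewrite scalerDr !scalerA mulrC. Qed.
Fact endo_mul_lin (f g : endo) : linear (fun v => f (g v)).
Proof. by move=> k u v; rewrite !endoD !endoZ. Qed.

Definition endo_add f g := Endo (endo_add_lin f g).
Definition endo_opp f := Endo (endo_opp_lin f).
Definition endo_scal c := Endo (endo_scal_lin c).
Definition endo_mul f g := Endo (endo_mul_lin f g).

Fact endo_addA : associative endo_add.
Proof. by move=> f g h; apply: endoP => v; apply: addrA. Qed.
Fact endo_addC : commutative endo_add.
Proof. by move=> f g; apply: endoP => v; apply: addrC. Qed.
Fact endo_add0 : left_id (endo_scal 0) endo_add.
Proof. by move=> f; apply: endoP => v; rewrite /= scale0r add0r. Qed.
Fact endo_addN : left_inverse (endo_scal 0) endo_opp endo_add.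
Proof. by move=> f; apply: endoP => v; rewrite /= scale0r addNr. Qed.
HB.instance Definition _ :=
  GRing.isZmodule.Build endo endo_addA endo_addC endo_add0 endo_addN.

Fact endo_mulA : associative endo_mul.
Proof. by move=> f g h; apply: endoP. Qed.
Fact endo_mul1l : left_id (endo_scal 1) endo_mul.
Proof. by move=> f; apply: endoP => v; rewrite /= scale1r. Qed.
Fact endo_mul1r : right_id (endo_scal 1) endo_mul.
Proof. by move=> f; apply: endoP => v; rewrite /= scale1r. Qed.
Fact endo_mulDl : left_distributive endo_mul +%R.
Proof. by move=> f g h; apply: endoP. Qed.
Fact endo_mulDr : right_distributive endo_mul +%R.
Proof. by move=> f g h; apply: endoP => v; apply: endoD. Qed.
HB.instance Definition _ := GRing.Zmodule_isPzRing.Build endo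
  endo_mulA endo_mul1l endo_mul1r endo_mulDl endo_mulDr.

Fact endo_scal_zmod : zmod_morphism endo_scal.
Proof. by move=> k l; apply: endoP => v /=; rewrite scalerBl. Qed.
Fact endo_scal_monoid : monoid_morphism endo_scal.
Proof. by split=> // k l; apply: endoP => v /=; rewrite scalerA. Qed.
Fact endo_scalC k f : endo_scal k * f = f * endo_scal k.
Proof. by apply: endoP => v /=; rewrite endoZ. Qed.
HB.instance Definition _ := PzRing_isPzAlgebra.Build K endo
  endo_scal_zmod endo_scal_monoid endo_scalC.

Definition rep_of_morph (A : pzAlgType K) (f : {rmorphism A -> endo})
  (fS : alg_morph f) : rep A V.
Proof.
apply: (@Rep K A V (fun a v => f a v)) => [a b v|a u v|a b v|k v].
- by rewrite rmorphD.
- exact: endoD.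
- by rewrite rmorphM.
- by rewrite fS.
Defined.

End Endo.

Definition rep_pull (K : comNzRingType) (A B : pzAlgType K) (V : lmodType K)
  (f : {rmorphism A -> B}) (fS : alg_morph f) (rho : rep B V) : rep A V.
Proof.
apply: (@Rep K A V (fun a v => rho (f a) v)) => [a b v|a u v|a b v|k v].
- by rewrite rmorphD rep_actDl.
- exact: rep_actDr.
- by rewrite rmorphM rep_actM.
- by rewrite fS rep_actS.
Defined.

(** * The families A_lambda(n) and A_Lambda(n) under one universal property *)

Section CliffordData.
Context (C : numClosedFieldType).

(** The parameter is an element [L] of the target, so that the same relations serve for a scalar
    lambda and for the generator Lambda; [L_data] records which of the two is meant. *)
Definition A_data n (B : pzAlgType C) (L : B) (w : 'I_(n.*2.+1) -> B) (ep em : B) :=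
  [/\ ep * em - em * ep = (- 4^-1 : C)%:S + ('i ^+ n : C)%:S * (L * \prod_j w j),
      forall j k, w j * w k + w k * w j = (2 * (j == k)%:R : C)%:S,
      forall j, ep * w j = - (w j * ep) &
      forall j, em * w j = - (w j * em)].

Definition L_data n (o : option C) (B : pzAlgType C) (L : B)
    (w : 'I_(n.*2.+1) -> B) (ep em : B) :=
  [/\ forall j, L * w j = w j * L, L * ep = ep * L, L * em = em * L &
      if o is Some l then L = l%:S else True].

Lemma A_lambda_univ n (lam : C) (B : pzAlgType C) (w : 'I_(n.*2.+1) -> B) ep em :
  A_data lam%:S w ep em ->
  exists f : {rmorphism A_lambda n lam -> B}, alg_morph f /\
   [/\ forall j, f (pgen (A_rel (n:=n) lam) (A_omega j)) = w j,
       f (pgen (A_rel (n:=n) lam) (A_Ep n)) = ep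
     & f (pgen (A_rel (n:=n) lam) (A_Em n)) = em].
Proof.
move=> [dE dw dp dm].
pose phi (x : A_gen n) := match x with A_omega j => w j | A_Ep => ep | A_Em => em end.
have [|f [fS fg]] := @pgen_univ C (A_gen n) (A_rel (n:=n) lam) B phi.
  move=> l r [|j k|j|j]; free_lift_simp => //=.
  rewrite dE rmorphM mulrA; congr (_ + _ * _).
  by apply: eq_bigr => j _; rewrite free_lift_gen.
by exists f; split=> //; split; rewrite ?fg // => j; rewrite fg.
Qed.

Lemma A_lambda_data n (lam : C) :
  let g := pgen (A_rel (n:=n) lam) in
  A_data lam%:S (fun j => g (A_omega j)) (g (A_Ep n)) (g (A_Em n)).
Proof.
move=> g; split=> [|j k|j|j].
- pgen_rel_simp (A_rel_E n lam) => ->; rewrite rmorphM mulrA; reflexivity.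
- by pgen_rel_simp (A_rel_w lam j k).
- by pgen_rel_simp (A_rel_Ep lam j).
- by pgen_rel_simp (A_rel_Em lam j).
Qed.

Lemma A_Lambda_univ n (B : pzAlgType C) (L : B) (w : 'I_(n.*2.+1) -> B) ep em :
  A_data L w ep em -> L_data None L w ep em ->
  exists f : {rmorphism A_Lambda C n -> B}, alg_morph f /\
   [/\ forall j, f (pgen (@AL_rel C n) (AL_omega j)) = w j,
       f (pgen (@AL_rel C n) (AL_Ep n)) = ep,
       f (pgen (@AL_rel C n) (AL_Em n)) = em
     & f (Lambda C n) = L].
Proof.
move=> [dE dw dp dm] [Lw Lp Lm _].
pose phi (x : AL_gen n) :=
  match x with AL_omega j => w j | AL_Ep => ep | AL_Em => em | AL_Lambda => L end.
have [|f [fS fg]] := @pgen_univ C (AL_gen n) (@AL_rel C n) B phi.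
  move=> l r [|j k|j|j|x]; free_lift_simp => //=; last by case: x.
  rewrite dE; congr (_ + _ * (_ * _)).
  by apply: eq_bigr => j _; rewrite free_lift_gen.
by exists f; split=> //; split; rewrite ?fg // => j; rewrite fg.
Qed.

Lemma A_Lambda_data n :
  let g := pgen (@AL_rel C n) in
  A_data (Lambda C n) (fun j => g (AL_omega j)) (g (AL_Ep n)) (g (AL_Em n)).
Proof.
move=> g; split=> [|j k|j|j].
- by pgen_rel_simp (@AL_rel_E C n).
- by pgen_rel_simp (@AL_rel_w C n j k).
- by pgen_rel_simp (@AL_rel_Ep C n j).
- by pgen_rel_simp (@AL_rel_Em C n j).
Qed.

Lemma A_Lambda_gen_comm n (x : AL_gen n) :
  Lambda C n * pgen (@AL_rel C n) x = pgen (@AL_rel C n) x * Lambda C n.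
Proof. by pgen_rel_simp (@AL_rel_L C n x). Qed.

(* The option distinguishes A_lambda (n) from A_Lambda (n), so that the two
   families can be reduced to n = 0 simultaneously. *)
Definition AO (o : option C) n : pzAlgType C :=
  if o is Some lam then A_lambda n lam else A_Lambda C n.

Definition AO_w o n : 'I_(n.*2.+1) -> AO o n :=
  match o return 'I_(n.*2.+1) -> AO o n with
  | Some lam => fun j => pgen (A_rel (n:=n) lam) (A_omega j)
  | None => fun j => pgen (@AL_rel C n) (AL_omega j)
  end.
Definition AO_p o n : AO o n :=
  match o return AO o n with
  | Some lam => pgen (A_rel (n:=n) lam) (A_Ep n)
  | None => pgen (@AL_rel C n) (AL_Ep n)
  end.
Definition AO_m o n : AO o n :=
  match o return AO o n with
  | Some lam => pgen (A_rel (n:=n) lam) (A_Em n)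
  | None => pgen (@AL_rel C n) (AL_Em n)
  end.
Definition AO_L o n : AO o n :=
  match o return AO o n with
  | Some lam => lam%:S
  | None => Lambda C n
  end.

Lemma AO_data o n : A_data (AO_L o n) (@AO_w o n) (AO_p o n) (AO_m o n).
Proof. by case: o => [lam|]; [exact: A_lambda_data|exact: A_Lambda_data]. Qed.

Lemma AO_Ldata o n : L_data o (AO_L o n) (@AO_w o n) (AO_p o n) (AO_m o n).
Proof.
case: o => [lam|]; split=> [j|||].
- exact: (scalC lam (AO_w (Some lam) j)).
- exact: (scalC lam (AO_p (Some lam) n)).
- exact: (scalC lam (AO_m (Some lam) n)).
- exact: erefl.
- exact: (A_Lambda_gen_comm (AL_omega j)).
- exact: (A_Lambda_gen_comm (AL_Ep n)).
- exact: (A_Lambda_gen_comm (AL_Em n)).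
- exact: I.
Qed.

Lemma AO_univ o n (B : pzAlgType C) (L : B) (w : 'I_(n.*2.+1) -> B) ep em :
  A_data L w ep em -> L_data o L w ep em ->
  exists f : {rmorphism AO o n -> B}, alg_morph f /\
   [/\ forall j, f (AO_w o j) = w j, f (AO_p o n) = ep, f (AO_m o n) = em
     & f (AO_L o n) = L].
Proof.
case: o => [lam|] dA dL; last exact: (A_Lambda_univ dA dL).
case: dL => _ _ _ eL; rewrite eL in dA *.
have [f [fS [fw fp fm]]] := A_lambda_univ dA.
by exists f; split; [exact: fS|split; [exact: fw|exact: fp|exact: fm|exact: fS]].
Qed.

Lemma AO_ind o n (P : AO o n -> Prop) :
  (forall k, P k%:S) -> (forall j, P (AO_w o j)) -> P (AO_p o n) ->
  P (AO_m o n) -> P (AO_L o n) ->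
  (forall a b, P a -> P b -> P (a + b)) ->
  (forall a b, P a -> P b -> P (a * b)) -> forall a, P a.
Proof.
case: o P => [lam|] P PS Pw Pp Pm PL PD PM.
  by apply: (@pgen_ind C (A_gen n) (@A_rel C n lam) P PS _ PD PM) => -[j||];
    [exact: Pw|exact: Pp|exact: Pm].
by apply: (@pgen_ind C (AL_gen n) (@AL_rel C n) P PS _ PD PM) => -[j|||];
  [exact: Pw|exact: Pp|exact: Pm|exact: PL].
Qed.

Lemma AO_eq o n (B : pzAlgType C) (f g : {rmorphism AO o n -> B}) :
  alg_morph f -> alg_morph g -> (forall j, f (AO_w o j) = g (AO_w o j)) ->
  f (AO_p o n) = g (AO_p o n) -> f (AO_m o n) = g (AO_m o n) ->
  f (AO_L o n) = g (AO_L o n) -> f =1 g.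
Proof.
move=> fS gS fw fp fm fL a.
apply: (@AO_ind o n (fun a => f a = g a)) => [k|||||b c fb fc|b c fb fc] //.
- by rewrite fS gS.
- by rewrite !rmorphD fb fc.
- by rewrite !rmorphM fb fc.
Qed.

End CliffordData.

(** * Matrix algebras, tensors and matrix units *)

Section Kron.
Context (K : comNzRingType) (A : pzAlgType K) (r : nat).

(** The pure tensor of [s] and [a], with M_r(A) seen as the tensor product of M_r(K) and [A]. *)
Definition kron (s : 'M[K]_r) (a : A) : 'M[A]_r := \matrix_(i, j) ((s i j)%:S * a).

Lemma kronM s t a b : kron s a * kron t b = kron (s *m t) (a * b).
Proof.
rewrite -[LHS]/(kron s a *m kron t b).
apply/matrixP => i j; rewrite !mxE raddf_sum mulr_suml; apply: eq_bigr => k _.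
by rewrite !mxE /= rmorphM /= -!mulrA; congr (_ * _); rewrite mulrA -scalC !mulrA.
Qed.

Lemma kronDr s a b : kron s (a + b) = kron s a + kron s b.
Proof. by apply/matrixP => i j; rewrite !mxE mulrDr. Qed.

Lemma kronDl s t a : kron (s + t) a = kron s a + kron t a.
Proof. by apply/matrixP => i j; rewrite !mxE rmorphD mulrDl. Qed.

Lemma kronNr s a : kron s (- a) = - kron s a.
Proof. by apply/matrixP => i j; rewrite !mxE mulrN. Qed.

Lemma kronNl s a : kron (- s) a = - kron s a.
Proof. by apply/matrixP => i j; rewrite !mxE rmorphN mulNr. Qed.

Lemma kronZl k s a : kron (k *: s) a = k%:S * kron s a.
Proof.
by rewrite -[RHS]/((k%:S)%:M *m _) mul_scalar_mx; apply/matrixP => i j;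
  rewrite !mxE rmorphM mulrA.
Qed.

Lemma kron1S k : kron 1%:M k%:S = k%:S.
Proof.
rewrite -[RHS]/((k%:S)%:M); apply/matrixP => i j; rewrite !mxE.
by case: (i == j); rewrite ?rmorph1 ?mul1r // rmorph0 mul0r.
Qed.

Lemma kron11 : kron 1%:M 1 = 1.
Proof. by have := kron1S 1; rewrite !rmorph1. Qed.

Fact kron_zmod s : zmod_morphism (kron s).
Proof. by move=> a b; rewrite kronDr kronNr. Qed.
HB.instance Definition _ s := GRing.isZmodMorphism.Build _ _ (kron s) (kron_zmod s).

Fact kron1_monoid : monoid_morphism (kron 1%:M).
Proof. by split=> [|a b]; rewrite ?kron11 // kronM mul1mx. Qed.
HB.instance Definition _ :=
  GRing.isMonoidMorphism.Build _ _ (kron 1%:M) kron1_monoid.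

Lemma kron_sum_delta (M : 'M[A]_r) :
  M = \sum_i \sum_j kron (delta_mx i j) (M i j).
Proof.
rewrite {1}(matrix_sum_delta M); apply/matrixP => i j.
rewrite !summxE; apply: eq_bigr => k _; rewrite !summxE; apply: eq_bigr => l _.
rewrite !mxE; case: ((i == k) && (j == l)).
  by rewrite !mulr1n rmorph1 mulr1 mul1r.
by rewrite !mulr0n rmorph0 mulr0 mul0r.
Qed.

End Kron.

Definition matrix_units (B : pzRingType) r (E : 'I_r -> 'I_r -> B) :=
  (forall i j k l, E i j * E k l = if j == k then E i l else 0)
  /\ \sum_i E i i = 1.

Section MxLift.
Context (K : comNzRingType) (A B : pzAlgType K) (r : nat).
Context (E : 'I_r -> 'I_r -> B) (phi : {rmorphism A -> B}).
Hypothesis EU : matrix_units E.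
Hypothesis phiS : alg_morph phi.
Hypothesis Ephi : forall i j a, E i j * phi a = phi a * E i j.

(** Matrix units of [B] that commute with the image of [phi] amount to a morphism from M_r(A) to [B]
    extending [phi]; this is that morphism. *)
Definition mx_lift (M : 'M[A]_r) : B := \sum_i \sum_j E i j * phi (M i j).

Fact mx_lift_zmod : zmod_morphism mx_lift.
Proof.
move=> M N; rewrite /mx_lift -sumrB; apply: eq_bigr => i _.
by rewrite -sumrB; apply: eq_bigr => j _; rewrite !mxE rmorphB mulrBr.
Qed.
HB.instance Definition _ := GRing.isZmodMorphism.Build _ _ mx_lift mx_lift_zmod.

Lemma mx_lift_kron (s : 'M[K]_r) a :
  mx_lift (kron s a) = (\sum_i \sum_j (s i j)%:S * E i j) * phi a.
Proof.
rewrite mulr_suml; apply: eq_bigr => i _; rewrite mulr_suml.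
apply: eq_bigr => j _; rewrite !mxE rmorphM phiS mulrA; congr (_ * _).
by rewrite scalC.
Qed.

Lemma mx_lift_delta i j a : mx_lift (kron (delta_mx i j) a) = E i j * phi a.
Proof.
rewrite mx_lift_kron (bigD1 i) //= (bigD1 j) //= mxE !eqxx rmorph1 mul1r.
rewrite !big1 ?addr0 // => [k ki|k kj].
  by rewrite big1 // => l _; rewrite mxE (negPf ki) rmorph0 mul0r.
by rewrite mxE eqxx (negPf kj) rmorph0 mul0r.
Qed.

Lemma mx_lift_1phi a : mx_lift (kron 1%:M a) = phi a.
Proof.
rewrite mx_lift_kron -[RHS]mul1r -EU.2; congr (_ * _).
apply: eq_bigr => i _; rewrite (bigD1 i) //= mxE eqxx rmorph1 mul1r.
by rewrite big1 ?addr0 // => j ji; rewrite mxE eq_sym (negPf ji) rmorph0 mul0r.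
Qed.

Fact mx_lift_monoid : monoid_morphism mx_lift.
Proof.
split=> [|M N]; first by rewrite -kron11 mx_lift_1phi rmorph1.
rewrite [M in LHS]kron_sum_delta [N in LHS]kron_sum_delta.
rewrite [X in mx_lift X]mulr_suml raddf_sum /=.
rewrite [in RHS]/mx_lift mulr_suml; apply: eq_bigr => i _.
rewrite [X in mx_lift X]mulr_suml raddf_sum /= mulr_suml; apply: eq_bigr => j _.
rewrite [X in mx_lift X]mulr_sumr raddf_sum /= mulr_sumr; apply: eq_bigr => k _.
rewrite [X in mx_lift X]mulr_sumr raddf_sum /= mulr_sumr; apply: eq_bigr => l _.
rewrite kronM /= mulrA -(mulrA (E i j)) -Ephi mulrA EU.1.
case: eqP => [->|jk].
  by rewrite mul_delta_mx mx_lift_delta rmorphM mulrA.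
by rewrite mul_delta_mx_0 ?mul0r; [rewrite mx_lift_kron big1 ?mul0r // => i' _;
  rewrite big1 // => j' _; rewrite mxE rmorph0 mul0r|apply/eqP].
Qed.
HB.instance Definition _ := GRing.isMonoidMorphism.Build _ _ mx_lift mx_lift_monoid.

Lemma mx_liftS : alg_morph mx_lift.
Proof. by move=> k; rewrite -kron1S mx_lift_1phi phiS. Qed.

(** The other cancellation is automatic: [f] sends [E i j] and [phi a] to the elementary tensors of
    which every matrix is a sum of products. *)
Lemma mx_iso (f : {rmorphism B -> 'M[A]_r}) :
  alg_morph f -> (forall i j, f (E i j) = kron (delta_mx i j) 1) ->
  (forall a, f (phi a) = kron 1%:M a) -> cancel f mx_lift -> alg_iso B 'M[A]_r.
Proof.
move=> fS fE fphi fK; exists f; split=> //; exists mx_lift => // M.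
rewrite [RHS]kron_sum_delta raddf_sum /=; apply: eq_bigr => i _.
rewrite raddf_sum /=; apply: eq_bigr => j _.
by rewrite rmorphM fE fphi kronM mulmx1 mul1r.
Qed.

Definition mx_lift_rmorph : {rmorphism 'M[A]_r -> B} := mx_lift.

End MxLift.

Lemma matrix_units_delta (K : comNzRingType) (A : pzAlgType K) r :
  matrix_units (fun i j : 'I_r => kron (delta_mx i j) (1 : A)).
Proof.
split=> [i j k l|].
  rewrite kronM mul1r; case: eqP => [->|/eqP jk]; first by rewrite mul_delta_mx.
  rewrite mul_delta_mx_0 //; apply/matrixP => i' j'.
  by rewrite !mxE rmorph0 mul0r.
rewrite [RHS]kron_sum_delta; apply: eq_bigr => i _.
rewrite (bigD1 i) //= big1 ?addr0 => [|j ji]; rewrite !mxE ?eqxx //.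
by rewrite eq_sym (negPf ji) mulr0n raddf0.
Qed.

Lemma alg_iso_mx (K : comNzRingType) (A B : pzAlgType K) r :
  alg_iso A B -> alg_iso 'M[A]_r 'M[B]_r.
Proof.
move=> [f [fS [g fK gK]]].
have hz : zmod_morphism (map_mx f : 'M[A]_r -> 'M[B]_r).
  by move=> M N; rewrite map_mxB.
have hm : monoid_morphism (map_mx f : 'M[A]_r -> 'M[B]_r).
  split=> [|M N]; first by apply/matrixP => i j; rewrite !mxE raddfMn /= rmorph1.
  apply/matrixP => i j; rewrite !mxE raddf_sum; apply: eq_bigr => k _.
  by rewrite !mxE /= rmorphM.
pose zm := GRing.isZmodMorphism.Build _ _ _ hz.
pose mm := GRing.isMonoidMorphism.Build _ _ _ hm.
pose h : {rmorphism 'M[A]_r -> 'M[B]_r} := HB.pack (map_mx f : 'M[A]_r -> 'M[B]_r) zm mm.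
exists h; split=> [k|].
  by apply/matrixP => i j; rewrite !mxE raddfMn /= fS.
by exists (map_mx g) => M; apply/matrixP => i j; rewrite !mxE.
Qed.

Lemma alg_iso_mxmx (K : comNzRingType) (A : pzAlgType K) q r :
  alg_iso 'M['M[A]_r]_q 'M[A]_(q * r).
Proof.
pose u (i : 'I_(q * r)) : 'I_q * 'I_r := mxvec_indexP i.
have uK : cancel u (fun p => mxvec_index p.1 p.2).
  by move=> i; rewrite /u; case: (mxvec_indexP i).
have Ku i k : u (mxvec_index i k) = (i, k).
  have [v vK _] := curry_mxvec_bij q r.
  have := uK (mxvec_index i k); case: (u _) => i' k' /= e.
  by rewrite -[LHS]vK ?inE //= e -[RHS]vK ?inE.
pose f (M : 'M['M[A]_r]_q) : 'M[A]_(q * r) :=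
  \matrix_(i, j) M (u i).1 (u j).1 (u i).2 (u j).2.
pose g (M : 'M[A]_(q * r)) : 'M['M[A]_r]_q :=
  \matrix_(i, j) \matrix_(k, l) M (mxvec_index i k) (mxvec_index j l).
have hz : zmod_morphism f by move=> M N; apply/matrixP => i j; rewrite !mxE.
have fS k : f k%:S = k%:S.
  apply/matrixP => i j; rewrite !mxE -[i in RHS]uK -[j in RHS]uK.
  case: (u i) => i1 i2; case: (u j) => j1 j2 /=.
  have -> : (mxvec_index i1 i2 == mxvec_index j1 j2) = (i1 == j1) && (i2 == j2).
    by apply/eqP/andP => [/(congr1 u)|[/eqP-> /eqP->]] //; rewrite !Ku => -[-> ->].
  by case: (i1 == j1); rewrite ?mxE //=; case: (i2 == j2).
have hm : monoid_morphism f.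
  split=> [|M N]; first by have := fS 1; rewrite !rmorph1.
  apply/matrixP => i j; rewrite !mxE summxE.
  under eq_bigr do rewrite mxE.
  rewrite pair_bigA /= (reindex u) /=; last first.
    by exists (fun p => mxvec_index p.1 p.2) => p _ //; case: p => p1 p2; rewrite Ku.
  by apply: eq_bigr => k _; rewrite !mxE.
pose zm := GRing.isZmodMorphism.Build _ _ _ hz.
pose mm := GRing.isMonoidMorphism.Build _ _ _ hm.
pose h : {rmorphism 'M['M[A]_r]_q -> 'M[A]_(q * r)} := HB.pack f zm mm.
exists h; split=> //; exists g => M.
  by apply/matrixP => i j; apply/matrixP => k l; rewrite !mxE !Ku.
by apply/matrixP => i j; rewrite !mxE !uK.
Qed.

(** * Passing between levels n and n+1 by a pair of Pauli elements *)

Section Doubling.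
Context (C : numClosedFieldType) (B : pzAlgType C).
Implicit Types (a b : B).

Lemma scal_half a : (2^-1 : C)%:S * (a + a) = a.
Proof.
have -> : a + a = (2 : C)%:S * a by rewrite rmorph_nat mulr_natl mulr2n.
by rewrite mulrA -rmorphM mulVf ?pnatr_eq0 // rmorph1 mul1r.
Qed.

Lemma addrr_inj a b : a + a = b + b -> a = b.
Proof. by move=> e; rewrite -(scal_half a) e scal_half. Qed.

Lemma scal_two (d : bool) : (2 * d%:R : C)%:S = if d then 1 + 1 else 0 :> B.
Proof.
by case: d; rewrite ?mulr1 ?mulr0 ?rmorph0 // rmorph_nat.
Qed.

(** The number of factors is odd, so exactly one [Z] survives. *)
Lemma prod_mul_involution m (Z : B) (w : 'I_(m.*2.+1) -> B) :
  Z * Z = 1 -> (forall j, Z * w j = w j * Z) ->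
  \prod_j (Z * w j) = Z * \prod_j w j.
Proof.
move=> ZZ Zw.
have H k (v : 'I_k -> B) : (forall j, Z * v j = v j * Z) ->
    \prod_j (Z * v j) = Z ^+ k * \prod_j v j.
  elim: k v => [|k IH] v Zv; first by rewrite !big_ord0 mulr1.
  rewrite !big_ord_recl IH // exprS -!mulrA; congr (_ * _).
  by rewrite !mulrA; congr (_ * _); apply: commrX; apply/esym.
have Z1 : Z ^+ m.*2 = 1 by rewrite -mul2n exprM expr2 ZZ expr1n.
by rewrite H // exprS Z1 mulr1.
Qed.

(** The usual doubling of Clifford generators. When [X] and [Z] are the Pauli matrices sigma_x and
    sigma_z, the second generator is -sigma_y. *)
Definition w_up m (X Z : B) (w : 'I_m -> B) (j : 'I_m.+2) : B :=
  if unlift ord0 j is Some k then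
    if unlift ord0 k is Some l then Z * w l else - (('i : C)%:S * X * Z)
  else X.

Lemma w_up0 m X Z (w : 'I_m -> B) : w_up X Z w ord0 = X.
Proof. by rewrite /w_up unlift_none. Qed.
Lemma w_up1 m X Z (w : 'I_m -> B) :
  w_up X Z w (lift ord0 ord0) = - (('i : C)%:S * X * Z).
Proof. by rewrite /w_up liftK unlift_none. Qed.
Lemma w_upS m X Z (w : 'I_m -> B) j :
  w_up X Z w (lift ord0 (lift ord0 j)) = Z * w j.
Proof. by rewrite /w_up !liftK. Qed.

Lemma prod_w_up m X Z (w : 'I_m -> B) :
  \prod_(j < m.+2) w_up X Z w j = X * (- (('i : C)%:S * X * Z) * \prod_j (Z * w j)).
Proof.
rewrite big_ord_recl big_ord_recl w_up0 w_up1; congr (_ * (_ * _)).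
by apply: eq_bigr => j _; apply: w_upS.
Qed.

Lemma ord2P m (P : 'I_m.+2 -> Prop) : P ord0 -> P (lift ord0 ord0) ->
  (forall j, P (lift ord0 (lift ord0 j))) -> forall j, P j.
Proof.
move=> P0 P1 PS j; case: (unliftP ord0 j) => [k ->|-> //].
by case: (unliftP ord0 k) => [l ->|->].
Qed.

Lemma imag_sq : ('i : C)%:S * ('i : C)%:S = -1 :> B.
Proof. by rewrite -rmorphM -expr2 sqrCi rmorphN1. Qed.

(** The product of the new generators is X (-i X Z) Z^(2n+1) times the old product, that is, -i
    times the old product; this factor turns i^(n+1) into i^n and explains the power of i in the
    relation. *)
Lemma A_data_up n (X Z L : B) (w : 'I_(n.*2.+1) -> B) ep em :
  X * X = 1 -> Z * Z = 1 -> X * Z = - (Z * X) ->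
  (forall j, X * w j = w j * X) -> (forall j, Z * w j = w j * Z) ->
  X * ep = ep * X -> X * em = em * X -> Z * ep = ep * Z -> Z * em = em * Z ->
  L * X = X * L -> L * Z = Z * L ->
  A_data L w ep em -> @A_data C n.+1 B L (w_up X Z w) (Z * ep) (Z * em).
Proof.
move=> XX ZZ XZ Xw Zw Xp Xm Zp Zm LX LZ [dE dw dp dm].
have iX a : ('i : C)%:S * a = a * ('i : C)%:S by rewrite scalC.
have ww (x y : B) (k : bool) : x * y = (if k then 1 else - (y * x)) ->
    (k -> x = y) -> x * y + y * x = (2 * k%:R : C)%:S.
  rewrite scal_two; case: k => /= e1 e2; last by rewrite e1 addNr.
  by move: e1; rewrite (e2 isT) => ->.
have ZX : Z * X = - (X * Z) by rewrite XZ opprK.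
pose U := ('i : C)%:S * X * Z.
have UX : U * X = - (X * U) by rewrite /U -[_ * Z * X]mulrA ZX mulrN !mulrA iX.
have UU : U * U = 1.
  rewrite {2}/U -(mulrA _ X Z) (mulrA U) -(iX U) -(mulrA _ U) (mulrA U X Z) UX.
  rewrite mulNr mulrN /U -!mulrA ZZ mulr1 (mulrA X _ X) -(iX X) -mulrA XX mulr1.
  by rewrite imag_sq opprK.
have UZ c : X * c = c * X -> Z * c = c * Z -> U * (Z * c) = - (Z * c * U).
  move=> Xc Zc.
  rewrite /U -!mulrA (mulrA Z Z) ZZ mul1r (mulrA c) -(iX c) -(mulrA _ c).
  rewrite (mulrA c X) -Xc -(mulrA X) -Zc (mulrA Z) -(iX Z) -(mulrA _ Z).
  by rewrite (mulrA Z X) ZX mulNr mulrN opprK -(mulrA X Z) (mulrA Z Z) ZZ mul1r.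
have XZc c : X * c = c * X -> X * (Z * c) = - (Z * c * X).
  by move=> Xc; rewrite mulrA XZ mulNr -!mulrA Xc.
split.
- rewrite -!mulrA [ep * (Z * _)]mulrA -Zp [em * (Z * _)]mulrA -Zm.
  rewrite -!(mulrA Z) !(mulrA Z Z) ZZ !mul1r dE; congr (_ + _).
  rewrite (prod_w_up X Z w).
  rewrite prod_mul_involution //; move: (\prod_j _) => P.
  have -> : X * (- (('i : C)%:S * X * Z) * (Z * P)) = - (('i : C)%:S * P).
    rewrite mulNr mulrN; congr (- _).
    by rewrite -!mulrA (mulrA Z Z) ZZ mul1r mulrA -iX -mulrA (mulrA X X) XX mul1r.
  rewrite exprS rmorphM /= -mulrA iX -!mulrA; congr (_ * (_ * _)).
  by rewrite mulNr -mulrA -iX mulrA imag_sq mulN1r !opprK.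
- elim/ord2P=> [||j]; elim/ord2P=> [||k]; rewrite ?w_up0 ?w_up1 ?w_upS.
  + by rewrite XX scal_two eqxx.
  + by apply: ww => //; rewrite mulrN mulNr UX !opprK.
  + by apply: ww => //; apply: XZc.
  + by apply: ww => //; rewrite mulrN mulNr UX !opprK.
  + by rewrite mulrNN UU scal_two.
  + by apply: ww => //; rewrite mulrN mulNr UZ ?opprK.
  + by apply: ww => //; rewrite XZc ?opprK.
  + by apply: ww => //; rewrite mulrN mulNr UZ ?opprK.
  + rewrite !(inj_eq lift_inj) -dw -!mulrA !(mulrA _ Z) -!Zw -!mulrA !(mulrA Z Z).
    by rewrite ZZ !mul1r.
- elim/ord2P=> [||j]; rewrite ?w_up0 ?w_up1 ?w_upS.
  + by rewrite XZc // opprK.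
  + by rewrite mulrN mulNr UZ // !opprK.
  + rewrite -!mulrA (mulrA ep Z) -Zp (mulrA _ Z ep) -Zw -!mulrA !(mulrA Z Z) ZZ !mul1r.
    exact: dp.
- elim/ord2P=> [||j]; rewrite ?w_up0 ?w_up1 ?w_upS.
  + by rewrite XZc // opprK.
  + by rewrite mulrN mulNr UZ // !opprK.
  + rewrite -!mulrA (mulrA em Z) -Zm (mulrA _ Z em) -Zw -!mulrA !(mulrA Z Z) ZZ !mul1r.
    exact: dm.
Qed.

Definition w_tail m (w : 'I_m.+2 -> B) (j : 'I_m) : B := w (lift ord0 (lift ord0 j)).

Lemma prod_w_tail m (w : 'I_m.+2 -> B) :
  \prod_j w j = w ord0 * (w (lift ord0 ord0) * \prod_j w_tail w j).
Proof. by rewrite big_ord_recl big_ord_recl. Qed.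

(** Inverse of [A_data_up]. An element anticommuting with the first two generators commutes with
    [Z], which is their product up to i; multiplied by [Z], it commutes with [X] too. *)
Lemma A_data_down n (L : B) (w : 'I_(n.*2.+3) -> B) ep em :
  @A_data C n.+1 B L w ep em -> @L_data C n.+1 None B L w ep em ->
  let X := w ord0 in let Z := ('i : C)%:S * w ord0 * w (lift ord0 ord0) in
  let v j := Z * w_tail w j in
  [/\ X * X = 1, Z * Z = 1, X * Z = - (Z * X), L * X = X * L & L * Z = Z * L] /\
  [/\ forall j, X * v j = v j * X, X * (Z * ep) = Z * ep * X &
      X * (Z * em) = Z * em * X] /\
  [/\ forall j, Z * v j = v j * Z, Z * (Z * ep) = Z * ep * Z &
      Z * (Z * em) = Z * em * Z] /\
  [/\ w =1 w_up X Z v, ep = Z * (Z * ep), em = Z * (Z * em),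
      A_data L v (Z * ep) (Z * em) & L_data None L v (Z * ep) (Z * em)].
Proof.
move=> [dE dw dp dm] [Lw Lp Lm _] X; set V := w (lift _ _) => Z v.
have iX a : ('i : C)%:S * a = a * ('i : C)%:S by rewrite scalC.
have sq j : w j * w j = 1.
  by apply: addrr_inj; rewrite dw eqxx scal_two.
have anti j k : j != k -> w j * w k = - (w k * w j).
  move=> /negPf jk; apply/eqP; rewrite -subr_eq0 opprK; apply/eqP.
  by rewrite dw jk scal_two.
have XX : X * X = 1 by apply: sq.
have VV : V * V = 1 by apply: sq.
have VX : V * X = - (X * V) by apply: anti.
have ZX : Z * X = - (X * Z).
  by rewrite /Z -/X -/V -!mulrA VX !mulrN; congr (- _);
     rewrite (mulrA _ X (X * V)) (iX X) -(mulrA X).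
have XZ : X * Z = - (Z * X) by rewrite ZX opprK.
have ZZ : Z * Z = 1.
  rewrite /Z -/X -/V -!mulrA (mulrA V) -(iX V) -(mulrA _ V) (mulrA V X) VX.
  rewrite mulNr -!mulrA VV mulr1 !mulrN (mulrA X) -(iX X) -mulrA XX mulr1.
  by rewrite imag_sq opprK.
have comZ c : X * c = - (c * X) -> V * c = - (c * V) -> Z * c = c * Z.
  move=> Xc Vc; rewrite /Z -/X -/V -!mulrA Vc !mulrN (mulrA X c) Xc mulNr mulrN opprK.
  by rewrite -(mulrA c) (mulrA _ c) (iX c) -(mulrA c).
have comX c : X * c = - (c * X) -> X * (Z * c) = Z * c * X.
  move: XZ; clearbody Z X => XZ Xc.
  by rewrite mulrA XZ mulNr -!mulrA Xc mulrN opprK.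
have ZZc c : Z * (Z * c) = c by rewrite mulrA ZZ mul1r.
have neg c d : c * d = - (d * c) -> d * c = - (c * d) by move=> ->; rewrite opprK.
have Xt j : X * w_tail w j = - (w_tail w j * X) by apply: anti.
have Vt j : V * w_tail w j = - (w_tail w j * V).
  by apply: anti; rewrite (inj_eq lift_inj).
have Zt j := comZ _ (Xt j) (Vt j).
have Zp : Z * ep = ep * Z by apply: comZ; apply: neg; apply: dp.
have Zm : Z * em = em * Z by apply: comZ; apply: neg; apply: dm.
have LX : L * X = X * L by apply: Lw.
have LZ : L * Z = Z * L.
  rewrite /Z -/X -/V -!mulrA -[V * L](Lw (lift ord0 ord0)) -/V (mulrA X) -LX.
  by rewrite !mulrA -scalC.
have cZ c : Z * c = c * Z -> Z * (Z * c) = Z * c * Z.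
  by clearbody Z => Zc; rewrite -mulrA -Zc.
have pp c d : Z * c = c * Z -> (Z * c) * (Z * d) = c * d.
  by move: ZZc; clearbody Z => ZZc Zc; rewrite Zc -mulrA ZZc.
have Lc c : L * c = c * L -> L * (Z * c) = Z * c * L.
  by move: LZ; clearbody Z => LZ Lc; rewrite mulrA LZ -!mulrA Lc.
split; [by split=> //; rewrite ?ZX ?opprK|split; [split|split; [split|split]]].
- by move=> j; apply: comX.
- by apply: comX; apply: neg; apply: dp.
- by apply: comX; apply: neg; apply: dm.
- by move=> j; apply: cZ.
- exact: cZ.
- exact: cZ.
- elim/ord2P=> [||j]; rewrite ?w_up0 ?w_up1 ?w_upS /v ?ZZc //.
  rewrite /Z -/X -/V -!mulrA (mulrA X) -(iX X) -(mulrA _ X) (mulrA X X) XX mul1r.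
  by rewrite mulrA imag_sq mulN1r opprK.
- by rewrite ZZc.
- by rewrite ZZc.
- split=> [|j k|j|j].
  + rewrite !pp // dE; congr (_ + _).
    have -> : \prod_j v j = Z * \prod_j w_tail w j by apply: prod_mul_involution.
    rewrite (prod_w_tail w) /Z -/X -/V -!mulrA exprS rmorphM /= -mulrA.
    rewrite mulrA (iX (scal _)) -mulrA; congr (_ * _).
    by rewrite mulrA (iX L) -mulrA.
  + by rewrite /v !pp // dw !(inj_eq lift_inj).
  + by rewrite /v !pp // -dp.
  + by rewrite /v !pp // -dm.
- split=> // [j||]; rewrite /v.
  + by apply: Lc; apply: Lw.
  + exact: Lc.
  + exact: Lc.
Qed.

End Doubling.

Lemma ord2_ind (P : 'I_2 -> Prop) : P ord0 -> P ord_max -> forall i, P i.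
Proof.
move=> P0 P1 [[|[|//]] i2]; [move: P0|move: P1];
  by congr P; apply: val_inj.
Qed.

Lemma big_ord2 (V : nmodType) (F : 'I_2 -> V) : \sum_i F i = F ord0 + F ord_max.
Proof.
by rewrite big_ord_recl big_ord1; congr (_ + F _); apply: val_inj.
Qed.

Section PauliUnits.
Context (C : numClosedFieldType) (B : pzAlgType C).
Implicit Types (X Z : B).

(** Spectral projections of the involution [Z]. Since [X] exchanges them, they complete with [X] to
    a system of 2 x 2 matrix units. *)
Definition pauli_proj Z (j : 'I_2) : B :=
  (2^-1 : C)%:S * (1 + (if j == ord0 then Z else - Z)).
Definition pauli_unit X Z (i j : 'I_2) : B :=
  (if i == j then 1 else X) * pauli_proj Z j.

Lemma pauli_proj_sum Z : pauli_proj Z ord0 + pauli_proj Z ord_max = 1.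
Proof.
rewrite /pauli_proj /= -mulrDr (_ : 1 + Z + (1 - Z) = 1 + 1) ?scal_half //.
by ncring.
Qed.

Lemma pauli_proj_diff Z : pauli_proj Z ord0 - pauli_proj Z ord_max = Z.
Proof.
rewrite /pauli_proj /= -mulrBr (_ : 1 + Z - (1 - Z) = Z + Z) ?scal_half //.
by ncring.
Qed.

Lemma pauli_units X Z : X * X = 1 -> Z * Z = 1 -> X * Z = - (Z * X) ->
  matrix_units (pauli_unit X Z).
Proof.
move=> XX ZZ XZ; pose h := (2^-1 : C)%:S : B.
have hC a : h * a = a * h by apply: scalC.
have sq s : s * s = 1 -> h * (1 + s) * (h * (1 + s)) = h * (1 + s).
  move=> ss; rewrite -mulrA (mulrA _ h) -hC -!mulrA.
  have -> : (1 + s) * (1 + s) = 1 + s + s + s * s by ncring.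
  by rewrite ss (_ : 1 + s + s + 1 = (1 + s) + (1 + s)) ?scal_half //; ncring.
have ort s : s * s = 1 -> h * (1 + s) * (h * (1 - s)) = 0.
  move=> ss; rewrite -mulrA (mulrA _ h) -hC -!mulrA.
  have -> : (1 + s) * (1 - s) = 1 - s * s by ncring.
  by rewrite ss subrr !mulr0.
have PP i j : pauli_proj Z i * pauli_proj Z j = if i == j then pauli_proj Z i else 0.
  rewrite /pauli_proj -/h.
  elim/ord2_ind: i; elim/ord2_ind: j => /=; rewrite ?sq ?ort ?mulrNN //.
  by rewrite -{2}(opprK Z) ort ?mulrNN.
have XP i : X * pauli_proj Z i = pauli_proj Z (rev_ord i) * X.
  rewrite /pauli_proj -/h mulrA -(hC X) -!mulrA; congr (_ * _).
  by elim/ord2_ind: i => /=; rewrite mulrDr mulrDl mulr1 mul1r ?mulrN ?mulNr XZ ?opprK.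
have PX0 : pauli_proj Z ord0 * X = X * pauli_proj Z ord_max.
  by rewrite XP; congr (pauli_proj _ _ * _); apply: val_inj.
have PX1 : pauli_proj Z ord_max * X = X * pauli_proj Z ord0.
  by rewrite XP; congr (pauli_proj _ _ * _); apply: val_inj.
split=> [i j k l|]; last by rewrite big_ord2 /pauli_unit !eqxx !mul1r pauli_proj_sum.
rewrite /pauli_unit; move: (pauli_proj Z) PP PX0 PX1 => P PP PX0 PX1.
elim/ord2_ind: i; elim/ord2_ind: j; elim/ord2_ind: k; elim/ord2_ind: l;
  rewrite /= ?mul1r -?mulrA ?(mulrA (P _) X) ?PX0 ?PX1 -?(mulrA X) ?PP /= ?mulr0
    ?(mulrA X X) ?XX ?mul1r //.
Qed.

Lemma pauli_unit_comm X Z (a : B) : X * a = a * X -> Z * a = a * Z ->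
  forall i j, pauli_unit X Z i j * a = a * pauli_unit X Z i j.
Proof.
move=> Xa Za i j; have Pa : pauli_proj Z j * a = a * pauli_proj Z j.
  rewrite /pauli_proj -mulrA (mulrA a) -scalC -mulrA; congr (_ * _).
  by case: ifP => _; rewrite mulrDl mulrDr mul1r mulr1 ?mulNr ?mulrN Za.
rewrite /pauli_unit -mulrA Pa !mulrA; case: ifP => _; last by rewrite Xa.
by rewrite mul1r mulr1.
Qed.

End PauliUnits.

Lemma pauli_unit_morph (C : numClosedFieldType) (A B : pzAlgType C)
    (f : {rmorphism A -> B}) X Z i j : alg_morph f ->
  f (pauli_unit X Z i j) = pauli_unit (f X) (f Z) i j.
Proof.
move=> fS; rewrite /pauli_unit /pauli_proj !rmorphM fS rmorphD rmorph1.
by do 2 case: ifP => _; rewrite ?rmorph1 ?rmorphN.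
Qed.

Section PauliMatrices.
Context (C : numClosedFieldType) (A : pzAlgType C).

Definition pauliX : 'M[C]_2 := \matrix_(i, j) (i != j)%:R.
Definition pauliZ : 'M[C]_2 := \matrix_(i, j) ((i == j)%:R * (-1) ^+ i).

Ltac mx2 := apply/matrixP; elim/ord2_ind; elim/ord2_ind;
  rewrite !mxE ?big_ord2 ?mxE /= ?expr0 ?expr1
    ?(mulr1, mul1r, mulr0, mul0r, addr0, add0r, mulrN, mulNr, opprK, oppr0, mulr1n, mulr0n).

Lemma pauliXX : pauliX *m pauliX = 1%:M.
Proof. by mx2. Qed.
Lemma pauliZZ : pauliZ *m pauliZ = 1%:M.
Proof. by mx2. Qed.
Lemma pauliXZ : pauliX *m pauliZ = - (pauliZ *m pauliX).
Proof. by mx2. Qed.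

Lemma kron_scal s k : kron s (k%:S : A) = kron (k *: s) 1 :> 'M_2.
Proof. by apply/matrixP => i j; rewrite !mxE mulr1 rmorphM scalC. Qed.

Lemma pauli_unit_mx i j :
  pauli_unit (kron pauliX (1 : A)) (kron pauliZ 1) i j = kron (delta_mx i j) 1.
Proof.
have -> : pauli_unit (kron pauliX (1 : A)) (kron pauliZ 1) i j =
  kron ((if i == j then 1%:M else pauliX) *m
    (2^-1 *: (1%:M + if j == ord0 then pauliZ else - pauliZ))) 1.
  rewrite /pauli_unit /pauli_proj -kron11 -kron1S kron_scal -!kronNl.
  rewrite (_ : kron 1%:M 1 + _ = kron (1%:M + if j == ord0 then pauliZ else - pauliZ) 1); last first.
    by case: ifP; rewrite kronDl.
  rewrite kronM mulr1 -scalemxAl mul1mx.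
  by case: ifP => _; rewrite kronM mulr1.
have h2 : 2^-1 + 2^-1 = 1 :> C.
  by rewrite -mulr2n -[_ *+ 2]mulr_natl mulfV ?pnatr_eq0.
congr (kron _ _); rewrite -scalemxAr.
by elim/ord2_ind: i; elim/ord2_ind: j => /=; mx2;
  rewrite ?subrr ?mulr0 ?mulrDr ?mulr1 ?h2.
Qed.

End PauliMatrices.

Section AODouble.
Context (C : numClosedFieldType).

Lemma A_data_morph n (A B : pzAlgType C) (f : {rmorphism A -> B}) L
    (w : 'I_(n.*2.+1) -> A) ep em : alg_morph f ->
  A_data L w ep em -> A_data (f L) (fun j => f (w j)) (f ep) (f em).
Proof.
move=> fS [dE dw dp dm]; split=> [|j k|j|j].
- by rewrite -!(rmorphM f) -(rmorphB f) dE rmorphD !(rmorphM f) !fS rmorph_prod.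
- by rewrite -!(rmorphM f) -(rmorphD f) dw fS.
- by rewrite -!(rmorphM f) dp (rmorphN f).
- by rewrite -!(rmorphM f) dm (rmorphN f).
Qed.

Lemma w_up_ext (B : pzAlgType C) m (X Z X' Z' : B) (w v : 'I_m -> B) :
  X = X' -> Z = Z' -> w =1 v -> w_up X Z w =1 w_up X' Z' v.
Proof. by move=> -> -> wv; elim/ord2P=> [||j]; rewrite ?w_up0 ?w_up1 ?w_upS ?wv. Qed.

Lemma w_up_morph (A B : pzAlgType C) (f : {rmorphism A -> B}) m X Z (w : 'I_m -> A) :
  alg_morph f -> forall j, f (w_up X Z w j) = w_up (f X) (f Z) (fun j => f (w j)) j.
Proof.
move=> fS; elim/ord2P=> [||j]; rewrite ?w_up0 ?w_up1 ?w_upS //.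
  by rewrite rmorphN !rmorphM fS.
by rewrite rmorphM.
Qed.

(** Both directions come from universal properties: [A_data_up] applied to the Pauli matrices gives
    the map into matrices, [A_data_down] gives the copy of level n and the matrix units for the
    inverse. That they cancel is then checked on generators. *)
Lemma AO_double (o : option C) n : alg_iso (AO o n.+1) 'M[AO o n]_2.
Proof.
have := A_data_down (AO_data o n.+1).
set B := AO o n.+1; set w : 'I_(n.*2.+3) -> B := @AO_w C o n.+1.
set ep : B := AO_p o n.+1; set em : B := AO_m o n.+1; set L : B := AO_L o n.+1.
have [Lw Lp Lm Lo] := AO_Ldata o n.+1.
case=> //; set X := w ord0; set Z : B := 'i%:S * X * _; set v : 'I_ _ -> B := fun _ => _.
move=> [XX ZZ XZ LX LZ] [[Xv Xp Xm] [[Zv Zp Zm] [wE pE mE dv dL]]].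
have [phi [phiS [phiw phip phim phiL]]] : exists f : {rmorphism AO o n -> B},
   alg_morph f /\
   [/\ forall j, f (AO_w o j) = v j, f (AO_p o n) = Z * ep,
       f (AO_m o n) = Z * em & f (AO_L o n) = L].
  by apply: (AO_univ dv); case: dL => Lv Lzp Lzm _; split; [exact: Lv|exact: Lzp|exact: Lzm|exact: Lo].
pose A := AO o n.
pose X' : 'M[A]_2 := kron (pauliX C) 1; pose Z' : 'M[A]_2 := kron (pauliZ C) 1.
have kD := A_data_morph (@kron1S C A 2) (AO_data o n).
have kc (s : 'M[C]_2) (a : A) : kron s 1 * kron 1%:M a = kron 1%:M a * kron s 1.
  by rewrite !kronM mulmx1 mul1mx mulr1 mul1r.
have ks (s : 'M[C]_2) (a : A) : kron s 1 * kron 1%:M a = kron s a.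
  by rewrite kronM mulmx1 mul1r.
have X'X' : X' * X' = 1 by rewrite kronM pauliXX mulr1 kron11.
have Z'Z' : Z' * Z' = 1 by rewrite kronM pauliZZ mulr1 kron11.
have X'Z' : X' * Z' = - (Z' * X') by rewrite !kronM pauliXZ kronNl.
have [f [fS [fw fp fm fL]]] : exists f : {rmorphism B -> 'M[A]_2},
   alg_morph f /\
   [/\ forall j, f (w j) = w_up X' Z' (fun j => kron 1%:M (AO_w o j)) j,
      f ep = Z' * kron 1%:M (AO_p o n),
      f em = Z' * kron 1%:M (AO_m o n) & f L = kron 1%:M (AO_L o n)].
  apply: (@AO_univ C o n.+1); first by apply: A_data_up => //; by [move=> *; apply: kc|move=> *; apply: esym; apply: kc].
  have [Lw' Lp' Lm' Lo'] := AO_Ldata o n.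
  have cc a b : a * b = b * a :> A -> kron 1%:M a * kron 1%:M b
      = kron 1%:M b * kron 1%:M a :> 'M[A]_2.
    by move=> e; rewrite !kronM e.
  split.
  - apply: (@ord2P _ (fun j => _ * w_up X' Z' (fun j0 => kron 1%:M (AO_w o j0)) j
        = w_up X' Z' (fun j0 => kron 1%:M (AO_w o j0)) j * _)) => [||j].
    + by rewrite w_up0 kc.
    + by rewrite w_up1 mulrN mulNr -[_ * X' * Z']mulrA kronM -kronZl kronM kronM
        mulmx1 mul1mx !mul1r !mulr1.
    + by rewrite w_upS !ks !kronM mul1mx mulmx1 Lw'.
  - by rewrite !ks !kronM mul1mx mulmx1 Lp'.
  - by rewrite !ks !kronM mul1mx mulmx1 Lm'.
  (* [o] also occurs in the algebra itself, so only its occurrence in the condition is generalized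
     before the case split. *)
  - have H : forall o', (if o' is Some l then AO_L o n = l%:S else True) ->
      if o' is Some l then kron 1%:M (AO_L o n) = l%:S :> 'M[A]_2 else True.
      by case=> // l ->; rewrite kron1S.
    exact: H.
have fX : f X = X' by rewrite fw w_up0.
have fZ : f Z = Z'.
  rewrite !rmorphM fS fX fw w_up1 mulrN -!mulrA (mulrA X') -scalC -mulrA (mulrA X').
  by rewrite X'X' mul1r mulrA imag_sq mulN1r opprK.
have EU := pauli_units XX ZZ XZ.
have phic i j a : pauli_unit X Z i j * phi a = phi a * pauli_unit X Z i j.
  have [Xa Za] : X * phi a = phi a * X /\ Z * phi a = phi a * Z.
    apply: (@AO_ind C o n (fun a => X * phi a = phi a * X /\ Z * phi a = phi a * Z)).
    - by move=> k; rewrite phiS -!scalC.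
    - by move=> j'; rewrite phiw; split; [exact: Xv|exact: Zv].
    - by rewrite phip; split; [exact: Xp|exact: Zp].
    - by rewrite phim; split; [exact: Xm|exact: Zm].
    - by rewrite phiL; split; apply: esym; [exact: LX|exact: LZ].
    - by move=> b c [Xb Zb] [Xc Zc]; rewrite !rmorphD; split; apply: commrD.
    - by move=> b c [Xb Zb] [Xc Zc]; rewrite !rmorphM; split; apply: commrM.
  exact: pauli_unit_comm.
have g1 := mx_lift_kron (pauli_unit X Z) phiS.
pose g := mx_lift_rmorph EU phiS phic.
have gX : g X' = X.
  rewrite [LHS]g1 rmorph1 mulr1 !big_ord2 !mxE /= /pauli_unit /=.
  by rewrite !rmorph0 !rmorph1 !mul0r !mul1r addr0 add0r addrC -mulrDr
    pauli_proj_sum mulr1.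
have gZ : g Z' = Z.
  rewrite [LHS]g1 rmorph1 mulr1 !big_ord2 !mxE /= /pauli_unit /=.
  rewrite !mul0r !mul1r expr0 expr1 !rmorph0 !mul0r rmorph1 rmorphN1 !mul1r.
  by rewrite addr0 add0r mulN1r pauli_proj_diff.
have gphi a : g (kron 1%:M a) = phi a by apply: mx_lift_1phi.
apply: (@mx_iso C _ _ 2 (pauli_unit X Z) phi f) => //.
- by move=> i j; rewrite pauli_unit_morph // fX fZ pauli_unit_mx.
- apply: (@AO_eq C o n _ (f \o phi) (kron 1%:M)) => [k|k|j|||] /=.
  + by rewrite phiS fS.
  + exact: kron1S.
  + rewrite phiw /v rmorphM fZ /w_tail fw w_upS mulrA Z'Z' mul1r //.
  + by rewrite phip rmorphM fZ fp mulrA Z'Z' mul1r.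
  + by rewrite phim rmorphM fZ fm mulrA Z'Z' mul1r.
  + by rewrite phiL fL.
- move=> b; apply: (@AO_eq C o n.+1 _ (g \o f) idfun) => [k|k|j|||] //=.
  + by rewrite fS mx_liftS.
  + rewrite [f _]fw w_up_morph ?gX ?gZ; last exact: mx_liftS.
    by rewrite [RHS]wE; apply: w_up_ext => // k; rewrite gphi phiw.
  + by rewrite [f _]fp rmorphM gZ gphi phip -pE.
  + by rewrite [f _]fm rmorphM gZ gphi phim -mE.
  + by rewrite [f _]fL gphi phiL.
Qed.

Lemma alg_iso_mx1 (A : pzAlgType C) : alg_iso A 'M[A]_1.
Proof.
exists (kron 1%:M); split=> [k|]; first exact: kron1S.
exists (fun M : 'M[A]_1 => M ord0 ord0) => [a|M].
  by rewrite !mxE eqxx rmorph1 mul1r.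
by apply/matrixP => i j; rewrite !ord1 !mxE eqxx rmorph1 mul1r.
Qed.

Lemma AO_reduce (o : option C) n : alg_iso (AO o n) 'M[AO o 0]_(2 ^ n).
Proof.
elim: n => [|n IH]; first exact: alg_iso_mx1.
apply: alg_iso_trans (AO_double o n) _.
apply: alg_iso_trans (alg_iso_mx 2 IH) _.
by rewrite expnS; apply: alg_iso_mxmx.
Qed.

End AODouble.

Lemma pgen_lift (K : comNzRingType) (X : choiceType)
    (rel : free_alg K X -> free_alg K X -> Prop) l r :
  rel l r -> free_lift (pgen rel) l = free_lift (pgen rel) r.
Proof.
have H a : pres rel a = free_lift (pgen rel) a.
  apply: (@free_ind K X (fun a => pres rel a = free_lift (pgen rel) a)).
  - by move=> k; rewrite free_liftS.
  - by move=> x; rewrite free_lift_gen.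
  - by move=> b c eb ec; rewrite presD free_liftD eb ec.
  - by move=> b c eb ec; rewrite presM free_liftM eb ec.
by move=> lr; rewrite -!H; apply: pgen_rel.
Qed.

(** * U(osp(1,2)) presented by its odd generators *)

Section Osp.
Context (C : numClosedFieldType).
Section Image.
Context (B : pzAlgType C) (e f : B).

(** The even basis elements are forced by the brackets [E_+,E_-] = Y, [E_+,E_+] = F and [E_-,E_-] =
    -G. *)
Definition osp_img (x : osp_basis) : B :=
  match x with
  | osp_Y => e * f + f * e
  | osp_F => e * e + e * e
  | osp_G => - (f * f + f * f)
  | osp_Ep => e
  | osp_Em => f
  end.

Definition theta : B := (4^-1 : C)%:S + (e * f - f * e).

(* The two relations say that theta anticommutes with e and f. *)
Definition osp_data : Prop :=
  [/\ (2^-1 : C)%:S * e = f * e * e - e * e * f &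
      (2^-1 : C)%:S * f = f * f * e - e * f * f].

Lemma scal_quarter2 : (4^-1 : C)%:S + (4^-1 : C)%:S = (2^-1 : C)%:S :> B.
Proof.
by rewrite -rmorphD; congr (_%:S); field.
Qed.

Lemma osp_dataP : osp_data <-> theta * e = - (e * theta) /\ theta * f = - (f * theta).
Proof.
have E : theta * e + e * theta = (2^-1 : C)%:S * e - (f * e * e - e * e * f).
  rewrite -scal_quarter2 /theta mulrDr -(scalC _ e); set q := (4^-1 : C)%:S.
  by ncring.
have F : theta * f + f * theta = (2^-1 : C)%:S * f - (f * f * e - e * f * f).
  rewrite -scal_quarter2 /theta mulrDr -(scalC _ f); set q := (4^-1 : C)%:S.
  by ncring.
split=> [[He Hf]|[He Hf]]; split.
- by apply/eqP; rewrite -addr_eq0 E He subrr.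
- by apply/eqP; rewrite -addr_eq0 F Hf subrr.
- by apply/eqP; rewrite -subr_eq0 -E He addNr.
- by apply/eqP; rewrite -subr_eq0 -F Hf addNr.
Qed.

(** The hypothesis is [Y,E_+] = E_+/2 and [Y,E_-] = -E_-/2. Bracketing with an even element is a
    derivation, so the brackets among Y, F, G follow from those with [e] and [f]. *)
Lemma osp_img_bracket : osp_data -> forall x y,
  osp_img x * osp_img y
    - (-1) ^+ (osp_parity x && osp_parity y) * (osp_img y * osp_img x)
  = free_lift osp_img (osp_bracket C x y).
Proof.
move=> [He Hf].
have two : (2 : C)%:S = 1 + 1 :> B by rewrite rmorph_nat.
have de : e = (f * e * e - e * e * f) + (f * e * e - e * e * f).
  by rewrite -He -mulrDr scal_half.
have df : f = (f * f * e - e * f * f) + (f * f * e - e * f * f).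
  by rewrite -Hf -mulrDr scal_half.
pose Y := osp_img osp_Y; pose F := osp_img osp_F; pose G := osp_img osp_G.
have YE : Y * e - e * Y = (2^-1 : C)%:S * e by rewrite He /Y /=; ncring.
have YEm : Y * f - f * Y = - ((2^-1 : C)%:S * f) by rewrite Hf /Y /=; ncring.
have FE : F * e - e * F = 0 by rewrite /F /=; ncring.
have FEm : F * f - f * F = - e by rewrite [in RHS]de /F /=; ncring.
have GE : G * e - e * G = - f by rewrite [in RHS]df /G /=; ncring.
have GEm : G * f - f * G = 0 by rewrite /G /=; ncring.
have YF : Y * F - F * Y = F.
  transitivity ((Y * e - e * Y) * e + e * (Y * e - e * Y)
    + ((Y * e - e * Y) * e + e * (Y * e - e * Y))).
    by rewrite /F /=; ncring.
  by rewrite YE mulrA -(scalC _ e) -!mulrA -mulrDr !scal_half.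
have YG : Y * G - G * Y = - G.
  transitivity (- ((Y * f - f * Y) * f + f * (Y * f - f * Y)
    + ((Y * f - f * Y) * f + f * (Y * f - f * Y)))).
    by rewrite /G /=; ncring.
  rewrite YEm; set hf := (2^-1)%:S * f; have hff : hf * f + f * hf = f * f.
    by rewrite /hf mulrA -(scalC _ f) -!mulrA -mulrDr scal_half.
  transitivity ((hf * f + f * hf) + (hf * f + f * hf)); first by ncring.
  by rewrite hff /G /=; ncring.
have FG : F * G - G * F = (1 + 1) * Y.
  transitivity (- ((F * f - f * F) * f + f * (F * f - f * F)
    + ((F * f - f * F) * f + f * (F * f - f * F)))).
    by rewrite /G /=; ncring.
  by rewrite FEm /Y /=; ncring.
have sw (a b c : B) : a * b - b * a = c -> b * a - a * b = - c by move=> <-; ncring.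
case=> -[]; cbv beta iota delta [osp_bracket osp_parity andb nat_of_bool];
  match goal with |- _ = free_lift ?phi ?t => 
    let p := free_lift_eval phi t in refine (etrans _ (esym p)) end;
  rewrite ?expr0 ?expr1 ?two; cbv beta iota delta [osp_img];
  first [ncring
  | rewrite -/(osp_img osp_Y) -/(osp_img osp_F) -/(osp_img osp_G) -/Y -/F -/G mul1r
      ?YF ?YG ?YE ?YEm ?FG ?FEm ?GE ?(sw _ _ _ YF) ?(sw _ _ _ YG) ?(sw _ _ _ YE)
      ?(sw _ _ _ YEm) ?(sw _ _ _ FG) ?(sw _ _ _ FEm) ?(sw _ _ _ GE) ?opprK //].
Qed.
End Image.

Local Notation U := (U_osp12 C).
Local Notation u x := (pgen (@U_rel C) x).

Lemma free_lift_superbracket (B : pzAlgType C) (phi : osp_basis -> B) x y (d : bool) :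
  free_lift phi (fgen C x * fgen C y - (-1) ^+ d * (fgen C y * fgen C x))
  = phi x * phi y - (-1) ^+ d * (phi y * phi x).
Proof.
have M (z t : osp_basis) :=
  etrans (free_liftM phi _ _) (f_equal2 *%R (free_lift_gen phi z) (free_lift_gen phi t)).
have s : free_lift phi ((-1) ^+ d) = (-1) ^+ d.
  by case: d; [rewrite !expr1 free_liftN free_lift1|rewrite !expr0 free_lift1].
exact: (etrans (free_liftD phi _ _) (f_equal2 +%R (M x y) (etrans (free_liftN phi _)
  (f_equal -%R (etrans (free_liftM phi _ _) (f_equal2 *%R s (M y x))))))).
Qed.

Lemma osp_univ (B : pzAlgType C) (e f : B) : osp_data e f ->
  exists phi : {rmorphism U -> B}, alg_morph phi /\
    forall x, phi (u x) = osp_img e f x.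
Proof.
move=> ef; apply: pgen_univ => l r [x y].
exact: (etrans (free_lift_superbracket _ _ _ _) (osp_img_bracket ef x y)).
Qed.

Section Generators.
Context (B : pzAlgType C) (v : osp_basis -> B).
Hypothesis v_rel : forall l r, U_rel l r -> free_lift v l = free_lift v r.

Lemma v_bracket x y : v x * v y
    - (-1) ^+ (osp_parity x && osp_parity y) * (v y * v x) = free_lift v (osp_bracket C x y).
Proof.
exact: (etrans (esym (free_lift_superbracket _ _ _ _)) (v_rel (U_rel_bracket C x y))).
Qed.

Ltac bracket x y :=
  let H := fresh in
  have H := v_bracket x y;
  cbv beta iota delta [osp_bracket osp_parity andb nat_of_bool] in H;
  lazymatch type of H with
  | ?a = free_lift ?phi ?t =>
    let p := free_lift_eval phi t in
    move: {H} (etrans H p); rewrite ?expr0 ?expr1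
  end.

Lemma osp_img_gen x : v x = osp_img (v osp_Ep) (v osp_Em) x.
Proof.
case: x; cbv beta iota delta [osp_img]; [| | |exact: erefl|exact: erefl].
- by bracket osp_Ep osp_Em; rewrite mulN1r opprK.
- by bracket osp_Ep osp_Ep; rewrite mulN1r opprK.
- by bracket osp_Em osp_Em; rewrite mulN1r opprK => ->; rewrite opprK.
Qed.

Lemma osp_data_gen : osp_data (v osp_Ep) (v osp_Em).
Proof.
have eY := osp_img_gen osp_Y; cbv beta iota delta [osp_img] in eY.
bracket osp_Y osp_Ep => Yp; bracket osp_Y osp_Em => Ym.
rewrite eY mul1r in Yp; rewrite eY mul1r in Ym.
set e := v osp_Ep in Yp Ym *; set f := v osp_Em in Yp Ym *; split.
  by rewrite -Yp; ncring.
by rewrite -[LHS]opprK -Ym; ncring.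
Qed.

End Generators.

Lemma U_rel_gen l r : U_rel l r ->
  free_lift (pgen (@U_rel C)) l = free_lift (pgen (@U_rel C)) r.
Proof. exact: pgen_lift. Qed.

End Osp.

(** * Universal property of the smash product with the group of order two *)

Section Smash.
Context (K : comNzRingType) (A : pzAlgType K) (gr : bool -> set A).
Local Notation i a := (fgen K (Some a)).
Local Notation P := (fgen K None).

Lemma free_lift_smashP (B : pzAlgType K) (v : option A -> B) (d : bool) a :
  free_lift v ((-1) ^+ d * (i a * P)) = (-1) ^+ d * (v (Some a) * v None).
Proof.
have s : free_lift v ((-1) ^+ d) = (-1) ^+ d.
  by case: d; [rewrite !expr1 free_liftN free_lift1|rewrite !expr0 free_lift1].
exact: (etrans (free_liftM v _ _) (f_equal2 *%R s (etrans (free_liftM v _ _)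
  (f_equal2 *%R (free_lift_gen v _) (free_lift_gen v _))))).
Qed.

Lemma free_lift_gen2 (B : pzAlgType K) (v : option A -> B) x y :
  free_lift v (fgen K x * fgen K y) = v x * v y.
Proof.
exact: (etrans (free_liftM v _ _) (f_equal2 *%R (free_lift_gen v _) (free_lift_gen v _))).
Qed.

Lemma smash_univ (B : pzAlgType K) (phi : {rmorphism A -> B}) (p : B) :
  alg_morph phi -> p * p = 1 ->
  (forall d a, gr d a -> p * phi a = (-1) ^+ d * (phi a * p)) ->
  exists g : {rmorphism smash_alg gr -> B}, alg_morph g /\
    (forall a, g (pgen (smash_rel gr) (Some a)) = phi a) /\
    g (pgen (smash_rel gr) None) = p.
Proof.
move=> phiS pp pa.
pose v (x : option A) := if x is Some a then phi a else p.
have [|g [gS gE]] := @pgen_univ K _ (smash_rel gr) B v.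
  move=> l r [a b|a b|k||d a ga].
  - free_lift_simp; exact: rmorphD.
  - free_lift_simp; exact: rmorphM.
  - free_lift_simp; exact: phiS.
  - free_lift_simp; exact: pp.
  - by apply: (etrans (free_lift_gen2 v _ _) (etrans _ (esym (free_lift_smashP v _ _))));
      apply: pa.
by exists g; split=> //; split=> [a|]; rewrite gE.
Qed.

Section Gen.
Context (B : pzAlgType K) (v : option A -> B).
Hypothesis v_rel : forall l r, smash_rel gr l r -> free_lift v l = free_lift v r.

Lemma smash_genD a b : v (Some (a + b)) = v (Some a) + v (Some b).
Proof.
exact: (etrans (esym (free_lift_gen v _)) (etrans (v_rel (smash_add gr a b))
  (etrans (free_liftD v _ _) (f_equal2 +%R (free_lift_gen v _) (free_lift_gen v _))))).
Qed.
Lemma smash_genM a b : v (Some (a * b)) = v (Some a) * v (Some b).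
Proof.
exact: (etrans (esym (free_lift_gen v _)) (etrans (v_rel (smash_mul gr a b))
  (free_lift_gen2 v _ _))).
Qed.
Lemma smash_genS k : v (Some k%:S) = k%:S.
Proof.
exact: (etrans (esym (free_lift_gen v _)) (etrans (v_rel (smash_scal gr k))
  (free_liftS v _))).
Qed.
Lemma smash_genP : v None * v None = 1.
Proof.
exact: (etrans (esym (free_lift_gen2 v _ _)) (etrans (v_rel (smash_PP gr))
  (free_lift1 v))).
Qed.
Lemma smash_genPa d a : gr d a -> v None * v (Some a) = (-1) ^+ d * (v (Some a) * v None).
Proof.
move=> ga; exact: (etrans (esym (free_lift_gen2 v _ _)) (etrans (v_rel (smash_P ga))
  (free_lift_smashP v _ _))).
Qed.
End Gen.

Let v := pgen (smash_rel gr).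
Let v_rel := @pgen_lift _ _ (smash_rel gr).

Definition smash_incl (a : A) : smash_alg gr := v (Some a).

Fact smash_incl_zmod : zmod_morphism smash_incl.
Proof.
move=> a b; apply: (@addIr _ (smash_incl b)); rewrite subrK.
have e := smash_genD v_rel (a - b) b; rewrite (subrK b a) in e.
exact: esym e.
Qed.
Fact smash_incl_monoid : monoid_morphism smash_incl.
Proof.
split=> [|a b]; last exact: (smash_genM v_rel).
by have := smash_genS v_rel 1; rewrite !rmorph1.
Qed.
HB.instance Definition _ :=
  GRing.isZmodMorphism.Build A (smash_alg gr) smash_incl smash_incl_zmod.
HB.instance Definition _ :=
  GRing.isMonoidMorphism.Build A (smash_alg gr) smash_incl smash_incl_monoid.
Lemma smash_inclS : alg_morph smash_incl.
Proof. by move=> k; apply: (smash_genS v_rel). Qed.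

Definition smash_inv : smash_alg gr := v None.
Lemma smash_inv2 : smash_inv * smash_inv = 1.
Proof. exact: (smash_genP v_rel). Qed.
Lemma smash_inv_incl d a : gr d a ->
  smash_inv * smash_incl a = (-1) ^+ d * (smash_incl a * smash_inv).
Proof. exact: (smash_genPa v_rel). Qed.

End Smash.

(** * The case n = 0: theta = Lambda omega, and the smash product *)

Section ZeroData.
Context (C : numClosedFieldType).

Definition data0 (B : pzAlgType C) (L w x y : B) :=
  [/\ x * y - y * x = (- 4^-1 : C)%:S + L * w, w * w = 1,
      x * w = - (w * x) & y * w = - (w * y)].
Definition central0 (B : pzAlgType C) (L w x y : B) :=
  [/\ L * w = w * L, L * x = x * L & L * y = y * L].

Lemma A_data0 (B : pzAlgType C) (L w x y : B) :
  data0 L w x y -> @A_data C 0 B L (fun _ => w) x y.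
Proof.
move=> [dE ww xw yw]; split=> // [|j k].
  by rewrite dE big_ord1 expr0 rmorph1 mul1r.
by rewrite !ord1 eqxx ww scal_two.
Qed.

Lemma data0_of (B : pzAlgType C) (L : B) (w : 'I_1 -> B) x y :
  @A_data C 0 B L w x y -> data0 L (w ord0) x y.
Proof.
move=> [dE dw dx dy]; split; [| |exact: dx|exact: dy].
  by rewrite dE big_ord1 expr0 rmorph1 mul1r.
have e := dw ord0 ord0; rewrite eqxx scal_two in e.
exact: (@addrr_inj C B _ _ e).
Qed.

Lemma data0_theta (B : pzAlgType C) (L w x y : B) : data0 L w x y -> theta x y = L * w.
Proof.
by move=> [dE _ _ _]; rewrite /theta dE rmorphN addrA subrr add0r.
Qed.

(** Here theta = L w, where [L] commutes and [w] anticommutes with [x] and [y]; so theta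
    anticommutes with both, which is [osp_data]. *)
Lemma data0_osp (B : pzAlgType C) (L w x y : B) : data0 L w x y ->
  L * x = x * L -> L * y = y * L -> osp_data x y.
Proof.
move=> d0 Lx Ly; have [_ _ xw yw] := d0; apply/osp_dataP.
rewrite (data0_theta d0); split.
  by rewrite mulrA -Lx -!mulrA xw mulrN opprK.
by rewrite mulrA -Ly -!mulrA yw mulrN opprK.
Qed.

Lemma AO0_univ (o : option C) (B : pzAlgType C) (L w x y : B) :
  data0 L w x y -> central0 L w x y -> (if o is Some l then L = l%:S else True) ->
  exists f : {rmorphism AO o 0 -> B}, alg_morph f /\
    [/\ f (AO_w o ord0) = w, f (AO_p o 0) = x, f (AO_m o 0) = y & f (AO_L o 0) = L].
Proof.
move=> d0 [Lw Lx Ly] eL.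
have [|f [fS [fw fx fy fL]]] := AO_univ (A_data0 d0) (o := o); first by split.
by exists f; split=> //; split.
Qed.

Lemma AO0_data (o : option C) :
  data0 (AO_L o 0) (AO_w o ord0) (AO_p o 0) (AO_m o 0).
Proof. exact: data0_of (AO_data o 0). Qed.

Lemma AO0_central (o : option C) :
  central0 (AO_L o 0) (AO_w o ord0) (AO_p o 0) (AO_m o 0).
Proof. by case: (AO_Ldata o 0) => Lw Lp Lm _; split; [exact: Lw|exact: Lp|exact: Lm]. Qed.

Lemma AO0_eq (o : option C) (B : pzAlgType C) (f g : {rmorphism AO o 0 -> B}) :
  alg_morph f -> alg_morph g -> f (AO_w o ord0) = g (AO_w o ord0) ->
  f (AO_p o 0) = g (AO_p o 0) -> f (AO_m o 0) = g (AO_m o 0) ->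
  f (AO_L o 0) = g (AO_L o 0) -> f =1 g.
Proof. by move=> fS gS fw; apply: AO_eq => // j; rewrite [j]ord1. Qed.

End ZeroData.

Section ZeroIsos.
Context (C : numClosedFieldType).
Local Notation U := (U_osp12 C).
Local Notation u x := (pgen (@U_rel C) x).

Lemma theta_morph (A B : pzAlgType C) (h : {rmorphism A -> B}) e f :
  alg_morph h -> h (theta e f) = theta (h e) (h f).
Proof. by move=> hS; rewrite /theta rmorphD rmorphB !rmorphM hS. Qed.

Lemma osp_img_morph (A B : pzAlgType C) (h : {rmorphism A -> B}) e f x :
  h (osp_img e f x) = osp_img (h e) (h f) x.
Proof. by case: x; rewrite /osp_img ?rmorphN ?rmorphD ?rmorphM. Qed.

Lemma osp_data_morph (A B : pzAlgType C) (h : {rmorphism A -> B}) e f :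
  alg_morph h -> osp_data e f -> osp_data (h e) (h f).
Proof.
by move=> hS [He Hf]; split; rewrite -hS -!rmorphM -rmorphB; [rewrite He|rewrite Hf].
Qed.

Section Parity.
Context (B : pzAlgType C) (p e f : B).
Hypothesis pp : p * p = 1.
Hypothesis pe : p * e = - (e * p).
Hypothesis pf : p * f = - (f * p).

Lemma parity_mul2 a b : p * a = - (a * p) -> p * b = - (b * p) ->
  p * (a * b) = a * b * p.
Proof. by move=> pa pb; rewrite mulrA pa mulNr -!mulrA pb mulrN opprK. Qed.

Lemma parity_theta : p * theta e f = theta e f * p.
Proof.
rewrite /theta mulrDr mulrDl -scalC; congr (_ + _).
by rewrite mulrBr mulrBl !parity_mul2.
Qed.

(** The identities theta = L w and w^2 = 1 leave no choice but L = theta p once w = p. It is central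
    because theta and [p] both anticommute with [e] and [f] and commute with each other. *)
Lemma data0_of_osp : osp_data e f ->
  data0 (theta e f * p) p e f /\ central0 (theta e f * p) p e f.
Proof.
move=> /osp_dataP[te tf]; split; split.
- by rewrite -mulrA pp mulr1 /theta rmorphN addKr.
- by [].
- by rewrite pe opprK.
- by rewrite pf opprK.
- by rewrite mulrA parity_theta.
- by rewrite -mulrA pe mulrN !mulrA te mulNr opprK.
- by rewrite -mulrA pf mulrN !mulrA tf mulNr opprK.
Qed.

Lemma parity_img x :
  p * osp_img e f x = (-1) ^+ osp_parity x * (osp_img e f x * p).
Proof.
case: x; rewrite /= ?expr0 ?mul1r ?expr1 ?mulN1r //.
- by rewrite mulrDr mulrDl !parity_mul2.
- by rewrite mulrDr mulrDl !parity_mul2.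
- by rewrite mulrN mulrDr mulNr mulrDl !parity_mul2.
Qed.

Lemma parity_gr (phi : {rmorphism U -> B}) : alg_morph phi ->
  (forall x, phi (u x) = osp_img e f x) ->
  forall d a, U_gr d a -> p * phi a = (-1) ^+ d * (phi a * p).
Proof.
move=> phiS phiu d a; elim=> {d a}.
- by rewrite rmorph1 mulr1 expr0 !mul1r.
- by move=> x; rewrite phiu parity_img.
- move=> d d' a b _ pa _ pb; rewrite rmorphM (mulrA p) pa -(mulrA _ _ (phi b)).
  rewrite -(mulrA (phi a)) pb signr_addb -!mulrA; congr (_ * _).
  by case: d' {pb}; rewrite ?expr1 ?expr0 ?mulN1r ?mulrN ?mul1r.
- by move=> d; rewrite rmorph0 mulr0 mul0r mulr0.
- by move=> d a b _ pa _ pb; rewrite rmorphD mulrDr pa pb -mulrDr -mulrDl.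
- move=> d k a _ pa; rewrite rmorphM phiS (mulrA p) -(scalC k p) -(mulrA _ p) pa.
  by rewrite !mulrA (scalC k ((-1) ^+ d)).
Qed.
End Parity.

Lemma U_theta_morph (B : pzAlgType C) (h : {rmorphism U -> B}) :
  alg_morph h -> h (U_theta C) = theta (h (u osp_Ep)) (h (u osp_Em)).
Proof. exact: (@theta_morph U B h (u osp_Ep) (u osp_Em)). Qed.

Lemma U_eq (B : pzAlgType C) (g h : {rmorphism U -> B}) :
  alg_morph g -> alg_morph h -> g (u osp_Ep) = h (u osp_Ep) ->
  g (u osp_Em) = h (u osp_Em) -> g =1 h.
Proof.
move=> gS hS gp gm; apply: pgen_eq => // x.
have E := osp_img_gen (@pgen_lift _ _ (@U_rel C)) x.
have G := etrans (congr1 g E) (osp_img_morph g _ _ x).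
have H := etrans (congr1 h E) (osp_img_morph h _ _ x).
by rewrite G H gp gm.
Qed.

Lemma U_data : osp_data (u osp_Ep) (u osp_Em).
Proof. exact: (osp_data_gen (@pgen_lift _ _ (@U_rel C))). Qed.

(** [W] stands for the enveloping algebra and [S] for the smash product, both known only through
    their universal properties. Under the isomorphism omega goes to [p] and Lambda to theta p. *)
Lemma smash_iso (W S : pzAlgType C) (e f : W) (i : {rmorphism W -> S}) (p : S) :
  osp_data e f ->
  (forall (B : pzAlgType C) (x y : B), osp_data x y ->
    exists phi : {rmorphism W -> B}, [/\ alg_morph phi, phi e = x & phi f = y]) ->
  (forall (B : pzAlgType C) (g h : {rmorphism W -> B}), alg_morph g -> alg_morph h ->
    g e = h e -> g f = h f -> g =1 h) ->
  alg_morph i -> p * p = 1 -> p * i e = - (i e * p) -> p * i f = - (i f * p) ->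
  (forall (B : pzAlgType C) (phi : {rmorphism W -> B}) (q : B), alg_morph phi ->
    q * q = 1 -> q * phi e = - (phi e * q) -> q * phi f = - (phi f * q) ->
    exists g : {rmorphism S -> B}, [/\ alg_morph g, forall a, g (i a) = phi a & g p = q]) ->
  (forall (B : pzAlgType C) (g h : {rmorphism S -> B}), alg_morph g -> alg_morph h ->
    (forall a, g (i a) = h (i a)) -> g p = h p -> g =1 h) ->
  alg_iso (AO (None : option C) 0) S.
Proof.
move=> dW uW eW iS pp pe pf uS eS.
have [d0 c0] := data0_of_osp pp pe pf (osp_data_morph iS dW).
have [F [FS [Fw Fx Fy FL]]] := AO0_univ (o := None) d0 c0 I.
have := AO0_data (None : option C); have := AO0_central (None : option C).
have := @AO0_eq C None; move: F FS Fw Fx Fy FL.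
move: (AO_L None 0) (AO_w None ord0) (AO_p None 0) (AO_m None 0).
move: (AO None 0) => A L w x y F FS Fw Fx Fy FL eA [Lw Lx Ly] dA.
have [_ ww xw yw] := dA.
have [phi [phiS phie phif]] := uW _ _ _ (data0_osp dA Lx Ly).
have [||G [GS Gi Gp]] := uS _ phi w phiS ww.
- by rewrite phie xw opprK.
- by rewrite phif yw opprK.
apply: (@alg_iso_of _ _ _ F G FS).
  apply: (eA _ (G \o F) idfun) => [k|k||||] //=.
  - by rewrite FS GS.
  - by rewrite Fw Gp.
  - by rewrite Fx Gi phie.
  - by rewrite Fy Gi phif.
  - rewrite FL -(theta_morph _ _ iS) rmorphM Gi Gp.
    by rewrite (theta_morph _ _ phiS) phie phif (data0_theta dA) -mulrA ww mulr1.
apply: (eS _ (F \o G) idfun) => [k|k|a|] //=.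
- by rewrite GS FS.
- rewrite Gi; apply: (eW _ (F \o phi) i) => [k|k||] //=.
  + by rewrite phiS FS.
  + by rewrite phie Fx.
  + by rewrite phif Fy.
- by rewrite Gp Fw.
Qed.

Lemma U_univ (B : pzAlgType C) (x y : B) : osp_data x y ->
  exists phi : {rmorphism U -> B},
    [/\ alg_morph phi, phi (u osp_Ep) = x & phi (u osp_Em) = y].
Proof.
move=> /osp_univ[phi [phiS phiu]]; exists phi; split; first exact: phiS.
  exact: (phiu osp_Ep).
exact: (phiu osp_Em).
Qed.

Lemma U_morph_img (B : pzAlgType C) (phi : {rmorphism U -> B}) x :
  phi (u x) = osp_img (phi (u osp_Ep)) (phi (u osp_Em)) x.
Proof.
have E := osp_img_gen (@pgen_lift _ _ (@U_rel C)) x.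
exact: etrans (congr1 phi E) (osp_img_morph phi _ _ x).
Qed.

Lemma sign_mul (B : pzAlgType C) (d : bool) (t : B) :
  (-1) ^+ d * t = if d then - t else t.
Proof. by case: d; rewrite ?expr1 ?mulN1r ?expr0 ?mul1r. Qed.

Lemma A_Lambda0_smash : alg_iso (AO (None : option C) 0) (S2_smash_U C).
Proof.
pose gr := @U_gr C.
have pa x : smash_inv gr * smash_incl gr (u x) = _ := smash_inv_incl (U_gr_gen C x).
apply: (@smash_iso U (S2_smash_U C) (u osp_Ep) (u osp_Em) (smash_incl gr) (smash_inv gr)).
- exact: U_data.
- exact: U_univ.
- exact: U_eq.
- exact: smash_inclS.
- exact: smash_inv2.
- exact: (etrans (pa osp_Ep) (sign_mul true _)).
- exact: (etrans (pa osp_Em) (sign_mul true _)).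
- move=> B phi q phiS qq qe qf.
  have [g [gS [gi gp]]] := smash_univ phiS qq (parity_gr qe qf phiS (U_morph_img phi)).
  by exists g; split; [exact: gS|exact: gi|exact: gp].
- move=> B g h gS hS gi gp.
  by apply: (@pgen_eq _ _ _ _ g h) => // -[a|]; [exact: gi|exact: gp].
Qed.

End ZeroIsos.

(** * Specialization of Lambda, Casimir quotients, the algebra C(1,2) *)

(** [A'] and [Q] are two quotients of [A] whose projections factor through one another. *)
Lemma quotient_iso (K : comNzRingType) (A Q A' : pzAlgType K)
    (pi : {rmorphism A -> Q}) (h : {rmorphism A -> A'}) (g : {rmorphism Q -> A'})
    (f : {rmorphism A' -> Q}) :
  alg_morph f -> (forall a, g (pi a) = h a) -> (forall q, exists a, q = pi a) ->
  (forall a, f (h a) = pi a) -> (forall b, exists a, b = h a) -> alg_iso A' Q.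
Proof.
move=> fS gpi pis fh hs; apply: (alg_iso_of (f := f) (g := g)) => // [b|q].
  by have [a ->] := hs b; rewrite fh gpi.
by have [a ->] := pis q; rewrite gpi fh.
Qed.

Section Quotients.
Context (C : numClosedFieldType).

Lemma aq_pi_surj (K : comNzRingType) (A : pzAlgType K) (S : set A) (q : algquot S) :
  exists a, q = aq_pi S a.
Proof. by exists (repr q); rewrite aq_reprK. Qed.

Lemma aq_pi0 (K : comNzRingType) (A : pzAlgType K) (S : set A) a :
  S a -> aq_pi S a = 0.
Proof. by move=> Sa; apply/aq_piP; rewrite subr0; apply: ideal_gen_in. Qed.

Lemma surj_closed (K : comNzRingType) (A B : pzAlgType K) (h : {rmorphism A -> B}) :
  alg_morph h ->
  [/\ forall k : K, exists a, k%:S = h a,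
      forall b c, (exists a, b = h a) -> (exists a, c = h a) -> exists a, b + c = h a &
      forall b c, (exists a, b = h a) -> (exists a, c = h a) -> exists a, b * c = h a].
Proof.
move=> hS; split=> [k|b c [a ->] [a' ->]|b c [a ->] [a' ->]].
- by exists k%:S; rewrite hS.
- by exists (a + a'); rewrite rmorphD.
- by exists (a * a'); rewrite rmorphM.
Qed.

Lemma AO_quotient n (lam : C) (S := [set (AO_L None n - lam%:S) * x | x in setT]) :
  alg_iso (AO (Some lam) n) (algquot S).
Proof.
have [h [hS [hw hp hm hL]]] := AO_univ (o := None) (AO_data (Some lam) n)
  (let: And4 a b c _ := AO_Ldata (Some lam) n in And4 a b c I).
have L0 : aq_pi S (AO_L None n) = lam%:S.
  have S1 : S (AO_L None n - lam%:S) by exists 1; [exact: I|exact: mulr1].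
  have := aq_pi0 S1; rewrite (rmorphB (aq_pi S)) => /eqP.
  by rewrite subr_eq0 => /eqP ->; apply: aq_piS.
have pS : alg_morph (aq_pi S) := aq_piS S.
have [Lw Lp Lm _] := @AO_Ldata C None n.
have cc a b : a * b = b * a :> AO None n -> aq_pi S a * aq_pi S b = aq_pi S b * aq_pi S a.
  by move=> e; rewrite -!rmorphM e.
have [f [fS [fw fp fm fL]]] := AO_univ (o := Some lam) (A_data_morph pS (@AO_data C None n))
  (And4 (fun j => cc _ _ (Lw j)) (cc _ _ Lp) (cc _ _ Lm) L0).
have [|g [gS gpi]] := @aq_univ _ _ S _ h hS.
  by move=> a [x _ <-]; rewrite rmorphM rmorphB hL hS subrr mul0r.
apply: (@quotient_iso _ _ _ _ (aq_pi S) h g f fS gpi).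
- exact: aq_pi_surj.
- apply: (@AO_eq _ None n _ (f \o h) (aq_pi S)) => [k|k|j|||] /=.
  + exact: etrans (congr1 f (hS k)) (fS k).
  + exact: aq_piS.
  + exact: etrans (congr1 f (hw j)) (fw j).
  + exact: etrans (congr1 f hp) fp.
  + exact: etrans (congr1 f hm) fm.
  + exact: etrans (congr1 f hL) fL.
- have [sS sD sM] := surj_closed hS.
  apply: (@AO_ind _ (Some lam) n (fun b => exists a, b = h a) sS _ _ _ _ sD sM).
  + by move=> j; exists (AO_w None j); exact: esym (hw j).
  + by exists (AO_p None n); exact: esym hp.
  + by exists (AO_m None n); exact: esym hm.
  + by exists (AO_L None n); exact: esym hL.
Qed.

Local Notation U := (U_osp12 C).
Local Notation u x := (pgen (@U_rel C) x).

Lemma U_casimir_morph (B : pzAlgType C) (h : {rmorphism U -> B}) : alg_morph h ->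
  h (U_casimir C) = theta (h (u osp_Ep)) (h (u osp_Em)) * theta (h (u osp_Ep)) (h (u osp_Em))
    - (16^-1)%:S.
Proof.
move=> hS; rewrite -(U_theta_morph hS) -(hS 16^-1) -(rmorphM h) -(rmorphB h).
exact: erefl.
Qed.

Lemma data0_theta_sq (B : pzAlgType C) (L w x y : B) :
  data0 L w x y -> central0 L w x y -> theta x y * theta x y = L * L.
Proof.
move=> d0 [Lw _ _]; have [_ ww _ _] := d0.
by rewrite (data0_theta d0) {2}Lw -mulrA (mulrA w) ww mul1r.
Qed.

Lemma scalVK (B : pzAlgType C) (k : C) (a : B) : k != 0 -> k^-1%:S * (k%:S * a) = a.
Proof. by move=> k0; rewrite mulrA -rmorphM mulVf // rmorph1 mul1r. Qed.

(** For nonzero [lam] the generator omega is recovered as theta / lam; it squares to 1 because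
    theta^2 = lam^2. *)
Lemma data0_of_sqrt (B : pzAlgType C) (lam : C) (e f : B) : lam != 0 ->
  osp_data e f -> theta e f * theta e f = (lam ^+ 2)%:S ->
  data0 lam%:S ((lam^-1)%:S * theta e f) e f.
Proof.
move=> lam0 /osp_dataP[te tf] td.
have lw : lam%:S * ((lam^-1)%:S * theta e f) = theta e f.
  by rewrite mulrA -rmorphM mulfV // rmorph1 mul1r.
split.
- by rewrite lw /theta rmorphN addKr.
- rewrite -mulrA (mulrA (theta e f)) -scalC -mulrA td -!rmorphM.
  by rewrite mulrA -expr2 exprVn mulVf ?expf_neq0 ?rmorph1.
- by rewrite mulrA -scalC -!mulrA te mulrN opprK.
- by rewrite mulrA -scalC -!mulrA tf mulrN opprK.
Qed.

Lemma casimir_iso (lam : C) : lam != 0 ->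
  alg_iso (AO (Some lam) 0) (B_alg (lam ^+ 2 - 16^-1)).
Proof.
move=> lam0; rewrite /B_alg; set S := [set _ | _ in _].
have [h [hS he hf]] := U_univ (data0_osp (AO0_data (Some lam))
  (let: And3 _ a _ := AO0_central (Some lam) in a)
  (let: And3 _ _ a := AO0_central (Some lam) in a)).
have ht : h (U_theta C) = lam%:S * AO_w (Some lam) ord0.
  by rewrite U_theta_morph // he hf (data0_theta (AO0_data (Some lam))).
have [_ ww _ _] := AO0_data (Some lam).
have [|g [gS gpi]] := @aq_univ _ _ S _ h hS.
  have hc : h (U_casimir C) = (lam ^+ 2 - 16^-1)%:S.
    apply: (etrans (U_casimir_morph hS) (etrans (f_equal2
      (fun e f => theta e f * theta e f - (16^-1)%:S) he hf) _)).
    rewrite (data0_theta_sq (AO0_data (Some lam)) (AO0_central (Some lam))).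
    by rewrite rmorphB /= expr2 rmorphM.
  by move=> a [x _ <-]; rewrite rmorphM (rmorphB h) hc hS subrr mul0r.
pose pi : {rmorphism U -> algquot S} := aq_pi S.
have pS : alg_morph pi := aq_piS S.
pose e := pi (u osp_Ep); pose f := pi (u osp_Em).
(* Since C = theta^2 - 1/16, imposing C = lam^2 - 1/16 amounts to theta^2 = lam^2. *)
have td : theta e f * theta e f = (lam ^+ 2)%:S.
  have S1 : S (U_casimir C - (lam ^+ 2 - 16^-1)%:S).
    by exists 1; [exact: I|exact: mulr1].
  have e0 := aq_pi0 S1; rewrite (rmorphB pi) (U_casimir_morph pS) pS rmorphB /= in e0.
  by apply: (addIr (- (16^-1)%:S)); apply/eqP; rewrite -subr_eq0; apply/eqP.
have od : osp_data e f by apply: osp_data_morph => //; apply: U_data.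
pose w := (lam^-1)%:S * theta e f.
have d0 : data0 lam%:S w e f := data0_of_sqrt lam0 od td.
have c0 : central0 lam%:S w e f by split; apply: scalC.
have [F [FS [Fw Fx Fy FL]]] := AO0_univ (o := Some lam) d0 c0 erefl.
apply: (@quotient_iso _ _ _ _ pi h g F FS gpi).
- exact: aq_pi_surj.
- apply: (@U_eq _ _ (F \o h) pi) => [k|k||] /=.
  + exact: etrans (congr1 F (hS k)) (FS k).
  + exact: pS.
  + exact: etrans (congr1 F he) Fx.
  + exact: etrans (congr1 F hf) Fy.
- have [sS sD sM] := surj_closed hS.
  apply: (@AO_ind _ (Some lam) 0 (fun b => exists a, b = h a) sS _ _ _ _ sD sM).
  + move=> j; rewrite [j]ord1; exists ((lam^-1)%:S * U_theta C).
    by rewrite (rmorphM h) hS ht scalVK.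
  + by exists (u osp_Ep); exact: esym he.
  + by exists (u osp_Em); exact: esym hf.
  + exact: sS.
Qed.

Section Weyl.
Local Notation D := (C12 C).
Local Notation c := (pgen (@C12_rel C)).

Lemma C12_univ (B : pzAlgType C) (w p q : B) :
  w * w = 1 -> p * q - q * p = 1 -> w * p = - (p * w) -> w * q = - (q * w) ->
  exists f : {rmorphism D -> B}, alg_morph f /\
    [/\ f (c C12_omega) = w, f (c C12_p) = p & f (c C12_q) = q].
Proof.
move=> ww pq wp wq.
pose v x := match x with C12_omega => w | C12_p => p | C12_q => q end.
have [|f [fS fE]] := @pgen_univ C C12_gen (@C12_rel C) B v.
  by move=> l r []; free_lift_simp; [exact: ww|exact: pq|exact: wp|exact: wq].
exists f; split; first exact: fS.
by split; [exact: (fE C12_omega)|exact: (fE C12_p)|exact: (fE C12_q)].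
Qed.

Lemma C12_data :
  [/\ c C12_omega * c C12_omega = 1, c C12_p * c C12_q - c C12_q * c C12_p = 1,
      c C12_omega * c C12_p = - (c C12_p * c C12_omega) &
      c C12_omega * c C12_q = - (c C12_q * c C12_omega)].
Proof.
split.
- by pgen_rel_simp (C12_rel_w C).
- by pgen_rel_simp (C12_rel_pq C).
- by pgen_rel_simp (C12_rel_wp C).
- by pgen_rel_simp (C12_rel_wq C).
Qed.

(** From [p,q] = 1 one gets [q/2, p/2] = -1/4, so E_+ = q/2 and E_- = p/2. *)
Lemma weyl_data0 (B : pzAlgType C) (w p q : B) :
  w * w = 1 -> p * q - q * p = 1 -> w * p = - (p * w) -> w * q = - (q * w) ->
  data0 0%:S w ((2^-1 : C)%:S * q) ((2^-1 : C)%:S * p).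
Proof.
move=> ww pq wp wq; set h := (2^-1 : C)%:S.
have hh : h * h = (4^-1 : C)%:S by rewrite -rmorphM; congr (_%:S); field.
have hC a : h * a = a * h by apply: scalC.
split; rewrite ?rmorph0 ?mul0r ?addr0 //.
- rewrite -!mulrA (mulrA q) (mulrA p) -!hC -!mulrA -!mulrBr mulrA hh.
  by rewrite -opprB pq mulrN1 rmorphN.
- by rewrite -mulrA (mulrA w) -hC -mulrA wq mulrN opprK.
- by rewrite -mulrA (mulrA w) -hC -mulrA wp mulrN opprK.
Qed.

Lemma data0_weyl (B : pzAlgType C) (w x y : B) : data0 0%:S w x y ->
  [/\ w * w = 1, (y + y) * (x + x) - (x + x) * (y + y) = 1,
      w * (y + y) = - ((y + y) * w) & w * (x + x) = - ((x + x) * w)].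
Proof.
move=> [dE ww xw yw]; split=> //.
- rewrite rmorph0 mul0r addr0 rmorphN in dE.
  transitivity ((- (x * y - y * x)) *+ 4); first by ncring.
  have c4 : 4^-1 *+ 4 = 1 :> C by rewrite -[_ *+ 4]mulr_natr mulVf // pnatr_eq0.
  by rewrite dE opprK; apply: (etrans (esym (raddfMn (@scal C B) 4 4^-1))); rewrite c4 /= rmorph1.
- by rewrite mulrDr mulrDl yw opprD !opprK.
- by rewrite mulrDr mulrDl xw opprD !opprK.
Qed.

Lemma weyl_iso : alg_iso (AO (Some (0 : C)) 0) D.
Proof.
have [ww pq wp wq] := C12_data.
have c0 (B : pzAlgType C) (w x y : B) : central0 0%:S w x y by split; apply: scalC.
have [f [fS [fw fx fy fL]]] := AO0_univ (o := Some 0) (weyl_data0 ww pq wp wq)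
  (c0 _ _ _ _) erefl.
have [ww' pq' wp' wq'] := data0_weyl (AO0_data (Some (0 : C))).
have [g [gS [gw gp gq]]] := C12_univ ww' pq' wp' wq'.
have half (B : pzAlgType C) (a : B) : (2^-1 : C)%:S * a + (2^-1 : C)%:S * a = a.
  by rewrite -mulrDr scal_half.
apply: (@alg_iso_of _ _ _ f g fS).
  apply: (@AO0_eq C (Some 0) _ (g \o f) idfun) => [k|k||||].
  - exact: etrans (congr1 g (fS k)) (gS k).
  - exact: erefl.
  - exact: etrans (congr1 g fw) gw.
  - apply: (etrans (congr1 g fx)); apply: (etrans (rmorphM g _ _)).
    by apply: (etrans (f_equal2 *%R (gS _) gq)); apply: scal_half.
  - apply: (etrans (congr1 g fy)); apply: (etrans (rmorphM g _ _)).
    by apply: (etrans (f_equal2 *%R (gS _) gp)); apply: scal_half.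
  - exact: etrans (congr1 g (fS 0)) (gS 0).
apply: (@pgen_eq _ _ _ _ (f \o g) idfun) => [k|k|[||]].
- exact: etrans (congr1 f (gS k)) (fS k).
- exact: erefl.
- exact: etrans (congr1 f gw) fw.
- apply: (etrans (congr1 f gp)); apply: (etrans (rmorphD f _ _)).
  by apply: (etrans (f_equal2 +%R fy fy)); apply: half.
- apply: (etrans (congr1 f gq)); apply: (etrans (rmorphD f _ _)).
  by apply: (etrans (f_equal2 +%R fx fx)); apply: half.
Qed.

End Weyl.

End Quotients.

(** * Polynomials in one element, the regular module, extraction of eigencomponents *)

Section PolyEval.
Context (K : comNzRingType) (A : pzAlgType K).
Implicit Types (a b x : A) (p q : {poly K}).

Definition pev a p : A := \sum_(i < size p) (p`_i)%:S * a ^+ i.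

Lemma pevEw n a p : (size p <= n)%N -> pev a p = \sum_(i < n) (p`_i)%:S * a ^+ i.
Proof.
move=> pn; rewrite /pev (big_ord_widen n (fun i => (p`_i)%:S * a ^+ i)) // big_mkcond.
apply: eq_bigr => i _; case: ltnP => // /leq_sizeP -> //.
by rewrite rmorph0 mul0r.
Qed.

Fact pev_zmod a : zmod_morphism (pev a).
Proof.
move=> p q; set n := maxn (size p) (size q).
rewrite (@pevEw n a p) ?leq_maxl // (@pevEw n a q) ?leq_maxr // (@pevEw n a (p - q)).
  by rewrite -sumrB; apply: eq_bigr => i _; rewrite coefB rmorphB mulrBl.
by apply: leq_trans (size_polyD _ _) _; rewrite size_polyN.
Qed.
HB.instance Definition _ a := GRing.isZmodMorphism.Build _ _ (pev a) (pev_zmod a).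

Lemma pevC a k : pev a k%:P = k%:S.
Proof.
rewrite (@pevEw 1) ?size_polyC ?leq_b1 // big_ord1 coefC eqxx.
by rewrite expr0 mulr1.
Qed.

Lemma pevMX a p : pev a (p * 'X) = pev a p * a.
Proof.
have sz : (size (p * 'X)%R <= (size p).+1)%N.
  by have := size_polyMleq p 'X; rewrite size_polyX addn2.
rewrite (pevEw a sz).
rewrite big_ord_recl coefMX eqxx rmorph0 mul0r add0r /pev mulr_suml.
by apply: eq_bigr => i _; rewrite coefMX /= exprSr mulrA.
Qed.

Lemma pevX a : pev a 'X = a.
Proof. by rewrite -['X]mul1r pevMX pevC rmorph1 mul1r. Qed.

Lemma pevCM a k p : pev a (k%:P * p) = k%:S * pev a p.
Proof.
elim/poly_ind: p => [|p c IH]; first by rewrite mulr0 raddf0 mulr0.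
by rewrite mulrDr mulrA -polyCM !raddfD /= !pevMX IH !pevC mulrDr mulrA rmorphM.
Qed.

Fact pev_monoid a : monoid_morphism (pev a).
Proof.
split=> [|p q]; first by rewrite pevC rmorph1.
elim/poly_ind: p q => [|p c IH] q; first by rewrite mul0r raddf0 mul0r.
rewrite mulrDl raddfD /= pevCM -mulrA ['X * q]mulrC mulrA pevMX IH.
rewrite raddfD /= pevMX pevC mulrDl; congr (_ + _).
rewrite -!mulrA; congr (_ * _); elim/poly_ind: q {IH} => [|q d IH].
  by rewrite raddf0 mul0r mulr0.
by rewrite raddfD /= pevMX pevC mulrDl mulrDr scalC mulrA -IH.
Qed.
HB.instance Definition _ a := GRing.isMonoidMorphism.Build _ _ (pev a) (pev_monoid a).

(** With [b] a shift of [a], this moves raising and lowering operators across polynomials in a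
    weight operator; with b = a, it is commutation. *)
Lemma pev_intertwine x a b p : x * a = b * x -> x * pev a p = pev b p * x.
Proof.
move=> xa; elim/poly_ind: p => [|p c IH]; first by rewrite !raddf0 mulr0 mul0r.
by rewrite !raddfD /= !pevMX !pevC mulrDr mulrDl scalC mulrA IH -!mulrA xa.
Qed.

Lemma pev_comp a p q : pev a (p \Po q) = pev (pev a q) p.
Proof.
elim/poly_ind: p => [|p c IH]; first by rewrite comp_poly0 !raddf0.
by rewrite comp_polyD comp_polyM comp_polyX comp_polyC !raddfD /= rmorphM /= IH pevMX !pevC.
Qed.

End PolyEval.

Section Regular.
Context (K : comNzRingType) (A : pzAlgType K).

Definition regmod : Type := A.
HB.instance Definition _ := GRing.Zmodule.on regmod.

Fact reg_scalA k l (v : regmod) : k%:S * (l%:S * v) = (k * l)%:S * v.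
Proof. by rewrite mulrA rmorphM. Qed.
Fact reg_scal1 : left_id (1 : K) (fun k (v : regmod) => k%:S * v).
Proof. by move=> v; rewrite rmorph1 mul1r. Qed.
Fact reg_scalDr : right_distributive (fun k (v : regmod) => k%:S * v) +%R.
Proof. by move=> k u v; apply: mulrDr. Qed.
Fact reg_scalDl (v : regmod) : {morph (fun k : K => k%:S * v) : k l / k + l}.
Proof. by move=> k l; rewrite /= rmorphD; apply: mulrDl. Qed.
HB.instance Definition _ := GRing.Zmodule_isLmodule.Build K regmod
  reg_scalA reg_scal1 reg_scalDr reg_scalDl.

Definition reg_rep : rep A regmod.
Proof.
apply: (@Rep K A regmod (fun a (v : regmod) => a * v)) => //.
- by move=> a b v; apply: mulrDl.
- by move=> a u v; apply: mulrDr.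
- by move=> a b v; apply: esym; apply: mulrA.
Defined.

End Regular.

(** Vandermonde argument by induction: T - c_(j0) kills one component and multiplies each other one
    by c_j - c_(j0). These differences are asked to be units because the lemma is also applied over
    C[Lambda]. *)
Lemma eigen_extract (K : comUnitRingType) (V : lmodType K) (J : eqType) (T : V -> V)
    (S : V -> Prop) (c : J -> K) :
  linear T -> (forall u v, S u -> S v -> S (u + v)) ->
  (forall k v, S v -> S (k *: v)) -> (forall v, S v -> S (T v)) ->
  forall (s : seq J) (f : J -> V), uniq s ->
  {in s &, forall i j, i != j -> c i - c j \is a GRing.unit} ->
  {in s, forall j, T (f j) = c j *: f j} -> S (\sum_(j <- s) f j) ->
  {in s, forall j, S (f j)}.
Proof.
move=> Tlin SD SZ ST; elim=> [//|j0 s IH] f /= /andP[j0s us] cu Tf Sf.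
have T0 : T 0 = 0 by have := Tlin (-1) 0 0; rewrite scaler0 addr0 scaleN1r addNr.
have TD u v : T (u + v) = T u + T v by have := Tlin 1 u v; rewrite !scale1r.
have TZ k u : T (k *: u) = k *: T u by have := Tlin k u 0; rewrite T0 !addr0.
have SN v : S v -> S (- v) by move=> /(SZ (-1)); rewrite scaleN1r.
have Tsum g : T (\sum_(j <- s) g j) = \sum_(j <- s) T (g j).
  exact: (big_morph _ TD T0).
have ns j : j \in s -> j != j0 by move=> js; apply: contraNneq j0s => <-.
have Ss : {in s, forall j, S (f j)}.
  have H : {in s, forall j, S ((c j - c j0) *: f j)}.
    apply: IH => // [i j si sj|j sj|].
    - by apply: cu; rewrite inE ?si ?sj orbT.
    - by rewrite TZ Tf ?inE ?sj ?orbT // !scalerA mulrC.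
    have := SD _ _ (ST _ Sf) (SN _ (SZ (c j0) _ Sf)).
    rewrite big_cons TD Tf ?mem_head // Tsum scalerDr opprD addrACA subrr add0r.
    rewrite scaler_sumr -sumrB big_seq [X in _ -> S X]big_seq.
    rewrite (eq_bigr (fun j => (c j - c j0) *: f j)) // => j sj.
    by rewrite Tf ?inE ?sj ?orbT // scalerBl.
  move=> j sj; have := SZ (c j - c j0)^-1 _ (H j sj).
  by rewrite scalerA mulVr ?scale1r //; apply: cu; rewrite ?mem_head ?inE ?sj ?orbT ?ns.
move=> j; rewrite inE => /orP[/eqP ->|/Ss //].
move: Sf; rewrite big_cons => Sf.
have S0 : S 0 by have := SZ 0 _ Sf; rewrite scale0r.
have Sr : S (\sum_(j <- s) f j).
  by rewrite big_seq; apply: (big_ind S).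
by have := SD _ _ Sf (SN _ Sr); rewrite addrK.
Qed.

(** * Matrices over the level 0 algebra, abstractly, and the weight operator *)

(** What remains of A_lambda(n) or A_Lambda(n) after the reduction: matrix units and, commuting with
    them, the level 0 generators, with [q] = 1/4. The base is any commutative ring, so that
    A_Lambda(n) may also be taken over C[Lambda], where Lambda is a scalar. *)
Record clifford_weyl (K : comNzRingType) (B : pzAlgType K) r (E : 'I_r -> 'I_r -> B)
    (q : K) (L w x y : B) : Prop := CliffordWeyl {
  cwE : matrix_units E;
  cwEw : forall i j, E i j * w = w * E i j;
  cwEx : forall i j, E i j * x = x * E i j;
  cwEy : forall i j, E i j * y = y * E i j;
  cwEL : forall i j, E i j * L = L * E i j;
  cwLw : L * w = w * L;
  cwLx : L * x = x * L;
  cwLy : L * y = y * L;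
  cwq : q *+ 4 = 1;
  cwww : w * w = 1;
  cwxw : x * w = - (w * x);
  cwyw : y * w = - (w * y);
  cwxy : x * y - y * x = - q%:S + L * w;
  cw_ind : forall P : B -> Prop, (forall k, P k%:S) -> (forall i j, P (E i j)) ->
    P w -> P x -> P y -> P L -> (forall a b, P a -> P b -> P (a + b)) ->
    (forall a b, P a -> P b -> P (a * b)) -> forall b, P b
}.

(* The symmetry exchanging raising and lowering operators. *)
Lemma clifford_weyl_sym (K : comNzRingType) (B : pzAlgType K) r
    (E : 'I_r -> 'I_r -> B) (q : K) (L w x y : B) :
  clifford_weyl E q L w x y -> clifford_weyl E q L w y (- x).
Proof.
case=> EU Ew Ex Ey EL Lw Lx Ly q4 ww xw yw xy ind; split=> //.
- by move=> i j; rewrite mulrN mulNr Ex.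
- by rewrite mulrN mulNr Lx.
- by rewrite mulrN mulNr xw.
- by rewrite mulrN mulNr opprK addrC.
move=> P PS PE Pw Py Px PL PD PM; apply: ind => //.
by have := PM _ _ (PS (-1)) Px; rewrite rmorphN1 mulN1r opprK.
Qed.

Section Basic.
Context (K : comNzRingType) (B : pzAlgType K) (r : nat) (E : 'I_r -> 'I_r -> B).
Context (q : K) (L w x y : B).
Hypothesis cw : clifford_weyl E q L w x y.

(** The element Y = [E_+,E_-] of osp(1,2): [x] raises and [y] lowers its eigenvalues by 1/2. *)
Definition wt : B := x * y + y * x.
Local Notation Y := wt.
Local Notation h := (q + q).

Lemma cwhh : h + h = 1.
Proof. by rewrite -(cwq cw); ncring. Qed.

Lemma scal_hh (a : B) : h%:S * (a + a) = a.
Proof. by rewrite mulrDr -mulrDl -rmorphD cwhh rmorph1 mul1r. Qed.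

Lemma wtx : x * Y = (Y - h%:S) * x.
Proof.
apply/eqP; rewrite -subr_eq0; apply/eqP.
transitivity (h%:S * x + (x * (x * y - y * x) + (x * y - y * x) * x)).
  by rewrite /wt; ncring.
rewrite (cwxy cw) rmorphD /=; set a := q%:S; set T := L * w.
have xa : x * a = a * x by rewrite -scalC.
have xT : x * T = - (T * x) by rewrite mulrA -(cwLx cw) -!mulrA (cwxw cw) mulrN.
transitivity ((a * x - x * a) + (x * T + T * x)); first by ncring.
by rewrite xa xT subrr addNr addr0.
Qed.

Lemma wty : y * Y = (Y + h%:S) * y.
Proof.
apply/eqP; rewrite -subr_eq0; apply/eqP.
transitivity (- (h%:S * y + (y * (x * y - y * x) + (x * y - y * x) * y))).
  by rewrite /wt; ncring.
rewrite (cwxy cw) rmorphD /=; set a := q%:S; set T := L * w.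
have ya : y * a = a * y by rewrite -scalC.
have yT : y * T = - (T * y) by rewrite mulrA -(cwLy cw) -!mulrA (cwyw cw) mulrN.
transitivity (- ((a * y - y * a) + (y * T + T * y))); first by ncring.
by rewrite ya yT subrr addNr addr0 oppr0.
Qed.

Lemma wtw : w * Y = Y * w.
Proof.
have wx : w * x = - (x * w) by rewrite (cwxw cw) opprK.
have wy : w * y = - (y * w) by rewrite (cwyw cw) opprK.
rewrite /wt mulrDr mulrDl; congr (_ + _).
  by rewrite mulrA wx mulNr -!mulrA wy mulrN opprK.
by rewrite mulrA wy mulNr -!mulrA wx mulrN opprK.
Qed.

Lemma wtL : L * Y = Y * L.
Proof.
rewrite /wt mulrDr mulrDl !mulrA (cwLx cw) (cwLy cw) -!mulrA.
by rewrite (cwLx cw) (cwLy cw).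
Qed.

Lemma wtE i j : E i j * Y = Y * E i j.
Proof.
rewrite /wt mulrDr mulrDl !mulrA (cwEx cw) (cwEy cw) -!mulrA.
by rewrite (cwEx cw) (cwEy cw).
Qed.

Lemma cw_xyE : x * y = h%:S * (Y - q%:S + L * w).
Proof.
rewrite -addrA -(cwxy cw) -[LHS]scal_hh; congr (_ * _).
by rewrite /wt; ncring.
Qed.

Lemma cw_yxE : y * x = h%:S * (Y + q%:S - L * w).
Proof.
have -> : Y + q%:S - L * w = Y - (- q%:S + L * w) by set a := q%:S; ncring.
rewrite -(cwxy cw) -[LHS]scal_hh; congr (_ * _).
by rewrite /wt; ncring.
Qed.

End Basic.

(** * The grading by ad Y *)

Section GWA.
Context (K : idomainType) (B : pzAlgType K) (r : nat) (E : 'I_r -> 'I_r -> B).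
Context (q l : K) (w x y : B).
Hypothesis cw : clifford_weyl E q l%:S w x y.
Hypothesis natu : forall n, n.+1%:R \is a @GRing.unit K.

Local Notation Y := (wt x y).
Local Notation h := (q + q).

Let sg (s : bool) (a : B) : B := if s then - a else a.

Definition sproj (s : bool) : B := h%:S * (1 + sg s w).

Lemma sproj_sum : sproj false + sproj true = 1.
Proof.
rewrite /sproj /= -mulrDr (_ : 1 + w + (1 - w) = 1 + 1); last by ncring.
exact: (scal_hh cw).
Qed.

Lemma sprojM s t : sproj s * sproj t = if s == t then sproj s else 0.
Proof.
rewrite /sproj -mulrA (mulrA _ h%:S) -(scalC h) -!mulrA.
have ww := cwww cw.
have -> : (1 + sg s w) * (1 + sg t w) = 1 + sg s w + (sg t w + sg s w * sg t w) by ncring.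
case: s t => -[] /=; rewrite ?mulrNN ?mulNr ?mulrN ww.
- by rewrite [- w + 1]addrC (scal_hh cw).
- by rewrite addrA subrK subrr !mulr0.
- by rewrite addrA addrK subrr !mulr0.
- by rewrite [w + 1]addrC (scal_hh cw).
Qed.

Lemma xsproj s : x * sproj s = sproj (~~ s) * x.
Proof.
rewrite /sproj mulrA -scalC -!mulrA; congr (_ * _).
by case: s; rewrite /= mulrDr mulrDl mulr1 mul1r ?mulrN ?mulNr (cwxw cw) ?opprK.
Qed.
Lemma ysproj s : y * sproj s = sproj (~~ s) * y.
Proof.
rewrite /sproj mulrA -scalC -!mulrA; congr (_ * _).
by case: s; rewrite /= mulrDr mulrDl mulr1 mul1r ?mulrN ?mulNr (cwyw cw) ?opprK.
Qed.
Lemma wsproj s : w * sproj s = sg s (sproj s).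
Proof.
rewrite /sproj mulrA -scalC -!mulrA; have ww := cwww cw.
case: s => /=; rewrite mulrDr mulr1 ?mulrN ww; last by rewrite (addrC w).
by rewrite -mulrN opprB.
Qed.
Lemma sproj_comm a s : GRing.comm a w -> GRing.comm a (sproj s).
Proof.
move=> aw; apply: commrM; first by apply/commr_sym/scalC.
by apply: commrD; [apply: commr1|case: s => //=; apply: commrN].
Qed.
Lemma Ysproj s : sproj s * Y = Y * sproj s.
Proof. by apply/commr_sym/sproj_comm/commr_sym/(wtw cw). Qed.
Lemma Esproj i j s : E i j * sproj s = sproj s * E i j.
Proof. by apply: sproj_comm; apply: (cwEw cw). Qed.

(** The polynomial p(Y) cut down to the eigenspace w = 1 ([false]) or w = -1 ([true]). Sums of such
    elements form the degree zero part [Dset]; moving [x] or [y] across flips the sign and shifts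
    the polynomial. *)
Definition ev (s : bool) (p : {poly K}) : B := pev Y p * sproj s.

Fact ev_zmod s : zmod_morphism (ev s).
Proof. by move=> p p'; rewrite /ev raddfB mulrBl. Qed.
HB.instance Definition _ s := GRing.isZmodMorphism.Build _ _ (ev s) (ev_zmod s).

Lemma pev_sproj s p : sproj s * pev Y p = pev Y p * sproj s.
Proof. by apply: pev_intertwine; rewrite Ysproj. Qed.

Lemma evM s t p p' : ev s p * ev t p' = if s == t then ev s (p * p') else 0.
Proof.
rewrite /ev -mulrA (mulrA (sproj s)) pev_sproj -mulrA sprojM.
by case: eqP => _; rewrite ?mulr0 // !mulrA rmorphM.
Qed.

Lemma pevM_ev s p p' : pev Y p * ev s p' = ev s (p * p').
Proof. by rewrite /ev mulrA -rmorphM. Qed.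

Lemma ev_sum p : pev Y p = ev false p + ev true p.
Proof. by rewrite /ev -mulrDr sproj_sum mulr1. Qed.

Lemma ev1_sum : 1 = ev false 1 + ev true 1.
Proof. by rewrite -ev_sum rmorph1. Qed.

Definition shx (p : {poly K}) := p \Po ('X - h%:P).
Definition shy (p : {poly K}) := p \Po ('X + h%:P).

Lemma xev s p : x * ev s p = ev (~~ s) (shx p) * x.
Proof.
rewrite /ev mulrA (pev_intertwine _ (wtx cw)) -(mulrA _ x) xsproj mulrA.
by rewrite /shx pev_comp raddfB /= pevX pevC.
Qed.
Lemma yev s p : y * ev s p = ev (~~ s) (shy p) * y.
Proof.
rewrite /ev mulrA (pev_intertwine _ (wty cw)) -(mulrA _ y) ysproj mulrA.
by rewrite /shy pev_comp (raddfD (pev Y)) /= pevX pevC.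
Qed.
Lemma wev s p : w * ev s p = ev s (if s then - p else p).
Proof.
rewrite /ev mulrA (pev_intertwine (b := Y)) ?(wtw cw) // -mulrA wsproj.
by case: s; rewrite //= raddfN mulrN mulNr.
Qed.
Lemma scal_ev s k p : k%:S * ev s p = ev s (k%:P * p).
Proof. by rewrite /ev pevCM mulrA. Qed.
Lemma Eev i j s p : E i j * ev s p = ev s p * E i j.
Proof.
rewrite /ev mulrA (pev_intertwine (b := Y)) ?(wtE cw) //.
by rewrite -mulrA Esproj mulrA.
Qed.

Definition sgl (s : bool) : K := if s then - l else l.
Definition cxy s : {poly K} := h%:P * ('X - q%:P + (sgl s)%:P).
Definition cyx s : {poly K} := h%:P * ('X + q%:P - (sgl s)%:P).

Lemma sgl_sproj s : l%:S * w * sproj s = (sgl s)%:S * sproj s.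
Proof. by rewrite -mulrA wsproj; case: s; rewrite //= rmorphN mulrN mulNr. Qed.

Lemma ev_xy s p : ev s p * (x * y) = ev s (p * cxy s).
Proof.
have e : sproj s * (x * y) = x * y * sproj s.
  rewrite (mulrA (sproj s)) -{1}(negbK s) -xsproj -(mulrA x (sproj _)) -ysproj.
  by rewrite (mulrA x y).
rewrite /ev rmorphM /= -(mulrA (pev Y p)) -(mulrA (pev Y p)) e; congr (_ * _).
rewrite (cw_xyE cw) /cxy pevCM !(raddfD (pev Y)) (raddfN (pev Y)) /= !pevC pevX.
rewrite -(mulrA h%:S) -(mulrA h%:S); congr (_ * _).
by rewrite mulrDl sgl_sproj -mulrDl.
Qed.

Lemma ev_yx s p : ev s p * (y * x) = ev s (p * cyx s).
Proof.
have e : sproj s * (y * x) = y * x * sproj s.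
  rewrite (mulrA (sproj s)) -{1}(negbK s) -ysproj -(mulrA y (sproj _)) -xsproj.
  by rewrite (mulrA y x).
rewrite /ev rmorphM /= -(mulrA (pev Y p)) -(mulrA (pev Y p)) e; congr (_ * _).
rewrite (cw_yxE cw) /cyx pevCM (raddfB (pev Y)) (raddfD (pev Y)) /= !pevC pevX.
rewrite -(mulrA h%:S) -(mulrA h%:S); congr (_ * _).
by rewrite mulrBl sgl_sproj -mulrBl.
Qed.

Lemma h_neq0 : h != 0.
Proof.
apply/eqP => h0; have := cwhh cw; rewrite h0 addr0 => /eqP.
by rewrite eq_sym oner_eq0.
Qed.

Lemma cxy_neq0 s : cxy s != 0.
Proof.
rewrite mulf_neq0 ?polyC_eq0 ?h_neq0 // -addrA -polyCN -polyCD.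
by rewrite -size_poly_eq0 size_XaddC.
Qed.
Lemma cyx_neq0 s : cyx s != 0.
Proof.
rewrite mulf_neq0 ?polyC_eq0 ?h_neq0 // -addrA -polyCN -polyCD.
by rewrite -size_poly_eq0 size_XaddC.
Qed.
Lemma shx_neq0 p : p != 0 -> shx p != 0.
Proof. by rewrite /shx comp_poly2_eq0 // size_XsubC. Qed.
Lemma shy_neq0 p : p != 0 -> shy p != 0.
Proof. by rewrite /shy comp_poly2_eq0 // size_XaddC. Qed.

Definition Dset (d : B) := exists p0 p1, d = ev false p0 + ev true p1.

Lemma DsetD d d' : Dset d -> Dset d' -> Dset (d + d').
Proof.
move=> [p0 [p1 ->]] [p0' [p1' ->]]; exists (p0 + p0'), (p1 + p1').
by rewrite !raddfD addrACA.
Qed.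
Lemma Dset0 : Dset 0.
Proof. by exists 0, 0; rewrite !raddf0 addr0. Qed.
Lemma Dset1 : Dset 1.
Proof. by exists 1, 1; rewrite -ev_sum rmorph1. Qed.
Lemma DsetS k d : Dset d -> Dset (k%:S * d).
Proof.
by move=> [p0 [p1 ->]]; exists (k%:P * p0), (k%:P * p1); rewrite mulrDr !scal_ev.
Qed.
Lemma Dsetw d : Dset d -> Dset (w * d).
Proof. by move=> [p0 [p1 ->]]; exists p0, (- p1); rewrite mulrDr !wev. Qed.
Lemma Dsetx d : Dset d -> exists2 d', Dset d' & x * d = d' * x.
Proof.
move=> [p0 [p1 ->]]; exists (ev false (shx p1) + ev true (shx p0)).
  by exists (shx p1), (shx p0).
by rewrite mulrDr !xev mulrDl addrC.
Qed.
Lemma Dsety d : Dset d -> exists2 d', Dset d' & y * d = d' * y.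
Proof.
move=> [p0 [p1 ->]]; exists (ev false (shy p1) + ev true (shy p0)).
  by exists (shy p1), (shy p0).
by rewrite mulrDr !yev mulrDl addrC.
Qed.
Lemma Dset_xy d : Dset d -> Dset (d * (x * y)).
Proof.
move=> [p0 [p1 ->]]; exists (p0 * cxy false), (p1 * cxy true).
by rewrite mulrDl !ev_xy.
Qed.
Lemma Dset_yx d : Dset d -> Dset (d * (y * x)).
Proof.
move=> [p0 [p1 ->]]; exists (p0 * cyx false), (p1 * cyx true).
by rewrite mulrDl !ev_yx.
Qed.
Lemma DsetE i j d : Dset d -> E i j * d = d * E i j.
Proof. by move=> [p0 [p1 ->]]; rewrite mulrDr mulrDl !Eev. Qed.
Lemma DsetY d : Dset d -> Y * d = d * Y.
Proof.
have Yev s p : Y * ev s p = ev s p * Y.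
  by rewrite /ev mulrA (pev_intertwine p (erefl (Y * Y))) -(mulrA _ Y) -Ysproj mulrA.
by move=> [p0 [p1 ->]]; rewrite (mulrDr Y) (mulrDl _ _ Y) !Yev.
Qed.

Definition Xp (k : int) : B := match k with Posz m => x ^+ m | Negz m => y ^+ m.+1 end.

Definition hom (k : int) (z : B) := exists2 d, Dset d & z = d * Xp k.

Lemma hom0 k : hom k 0.
Proof. by exists 0; [exact: Dset0|rewrite mul0r]. Qed.
Lemma homD k z z' : hom k z -> hom k z' -> hom k (z + z').
Proof.
by move=> [d Dd ->] [d' Dd' ->]; exists (d + d'); [exact: DsetD|rewrite mulrDl].
Qed.
Lemma homS k c z : hom k z -> hom k (c%:S * z).
Proof.
by move=> [d Dd ->]; exists (c%:S * d); [exact: DsetS|rewrite mulrA].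
Qed.
Lemma homw k z : hom k z -> hom k (w * z).
Proof. by move=> [d Dd ->]; exists (w * d); [exact: Dsetw|rewrite mulrA]. Qed.

Lemma homx k z : hom k z -> hom (k + 1) (x * z).
Proof.
move=> [d Dd ->]; have [d' Dd' xd] := Dsetx Dd; rewrite mulrA xd.
case: k => [m|[|m]] /=.
- by exists d' => //; rewrite -mulrA -exprS -addn1.
- by exists (d' * (x * y)); [exact: Dset_xy|rewrite expr1 -mulrA /= mulr1].
- exists (d' * (x * y)); first exact: Dset_xy.
  by rewrite exprS -!mulrA /= subn1.
Qed.
Lemma homy k z : hom k z -> hom (k - 1) (y * z).
Proof.
move=> [d Dd ->]; have [d' Dd' yd] := Dsety Dd; rewrite mulrA yd.
case: k => [[|m]|m].
- by exists d'; rewrite //= expr0 mulr1.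
- rewrite (_ : Posz m.+1 - 1 = m); last by rewrite -addn1 PoszD addrK.
  exists (d' * (y * x)); first exact: Dset_yx.
  by rewrite /= exprS -!mulrA.
- rewrite (_ : Negz m - 1 = Negz m.+1); last first.
    by rewrite !NegzE -opprD -[in RHS]addn1 PoszD.
  by exists d' => //; rewrite -mulrA /= -exprS.
Qed.

Lemma homE k z i j : hom k z -> E i j * z = z * E i j.
Proof.
move=> [d Dd ->]; rewrite mulrA DsetE // -!mulrA; congr (_ * _).
by case: k => m /=; apply: commrX; [exact: (cwEx cw)|exact: (cwEy cw)].
Qed.

Lemma wtXp k : Y * Xp k = Xp k * Y + (k%:~R * h)%:S * Xp k.
Proof.
have Yx : Y * x = x * Y + h%:S * x by rewrite (wtx cw) mulrBl subrK.
have Yy : Y * y = y * Y - h%:S * y by rewrite (wty cw) (mulrDl Y) addrK.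
move: (wt x y) Yx Yy => Z Yx Yy.
have Yxm m : Z * x ^+ m = x ^+ m * Z + (m%:R * h)%:S * x ^+ m.
  elim: m => [|m IH]; first by rewrite mul0r rmorph0 mul0r addr0 mulr1 mul1r.
  rewrite exprSr mulrA IH mulrDl -mulrA Yx mulrDr -(mulrA _ _ x) mulrA -addrA.
  congr (_ + _); rewrite (mulrA _ h%:S) -(scalC h) -!mulrA -exprSr -mulrDl.
  by rewrite -rmorphD mulrS mulrDl mul1r.
have Yym m : Z * y ^+ m = y ^+ m * Z - (m%:R * h)%:S * y ^+ m.
  elim: m => [|m IH]; first by rewrite mul0r rmorph0 mul0r subr0 mulr1 mul1r.
  rewrite exprSr mulrA IH mulrBl -(mulrA _ Z y) Yy mulrBr -addrA -opprD (mulrA _ y Z).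
  congr (_ - _); rewrite (mulrA _ h%:S) -(scalC h) -!mulrA -exprSr -mulrDl.
  by rewrite -rmorphD mulrS mulrDl mul1r.
case: k => m; first exact: Yxm.
by rewrite /Xp Yym NegzE rmorphN /= mulNr rmorphN mulNr.
Qed.

Lemma hom_ad k z : hom k z -> Y * z = z * Y + (k%:~R * h)%:S * z.
Proof.
move=> [d Dd ->]; rewrite (mulrA Y) DsetY // -(mulrA d Y) wtXp (mulrDr d) (mulrA d).
by congr (_ + _); rewrite mulrA -scalC -mulrA.
Qed.

Definition homsum (z : B) : Prop :=
  exists2 s : seq (int * B), (forall t, t \in s -> hom t.1 t.2) & z = \sum_(t <- s) t.2.

Lemma homsum1 k z : hom k z -> homsum z.
Proof.
move=> hz; exists [:: (k, z)]; last by rewrite big_seq1.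
by move=> t; rewrite inE => /eqP ->.
Qed.
Lemma homsumD z z' : homsum z -> homsum z' -> homsum (z + z').
Proof.
move=> [s hs ->] [s' hs' ->]; exists (s ++ s'); last by rewrite big_cat.
by move=> t; rewrite mem_cat => /orP[/hs|/hs'].
Qed.
Lemma homsum_map (a : B) (k0 : int) z :
  (forall k z, hom k z -> hom (k + k0) (a * z)) -> homsum z -> homsum (a * z).
Proof.
move=> Ha [s hs ->]; exists [seq (t.1 + k0, a * t.2) | t <- s].
  by move=> t /mapP[t' /hs h' ->]; apply: Ha.
by rewrite big_map mulr_sumr.
Qed.
Lemma homsumE z i j : homsum z -> E i j * z = z * E i j.
Proof.
move=> [s hs ->]; rewrite mulr_sumr mulr_suml !big_seq; apply: eq_bigr => t ts.
exact: homE (hs _ ts).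
Qed.

Definition mxsum (z : B) : Prop :=
  exists2 b : 'I_r -> 'I_r -> B, (forall i j, homsum (b i j)) &
    z = \sum_i \sum_j E i j * b i j.

Lemma mxsumD z z' : mxsum z -> mxsum z' -> mxsum (z + z').
Proof.
move=> [b hb ->] [b' hb' ->]; exists (fun i j => b i j + b' i j).
  by move=> i j; apply: homsumD.
rewrite -big_split; apply: eq_bigr => i _ /=; rewrite -big_split.
by apply: eq_bigr => j _; rewrite mulrDr.
Qed.

Lemma mxsum_map (a : B) z : (forall i j, E i j * a = a * E i j) ->
  (forall z, homsum z -> homsum (a * z)) -> mxsum z -> mxsum (a * z).
Proof.
move=> Ea Ha [b hb ->]; exists (fun i j => a * b i j) => [i j|]; first exact: Ha.
rewrite mulr_sumr; apply: eq_bigr => i _; rewrite mulr_sumr; apply: eq_bigr => j _.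
by rewrite !mulrA Ea.
Qed.

Lemma mxsum_unit i j z : mxsum z -> mxsum (E i j * z).
Proof.
move=> [b hb ->]; exists (fun i' j' => if i' == i then b j j' else 0).
  by move=> i' j'; case: ifP => // _; apply: (@homsum1 0); apply: hom0.
rewrite mulr_sumr (bigD1 j) //= [X in _ + X]big1 ?addr0 => [|k kj]; last first.
  rewrite mulr_sumr big1 // => j' _.
  by rewrite mulrA (cwE cw).1 eq_sym (negPf kj) mul0r.
rewrite [RHS](bigD1 i) //= [X in _ + X]big1 ?addr0 => [|k ki]; last first.
  by rewrite big1 // => j' _; rewrite (negPf ki) mulr0.
rewrite mulr_sumr; apply: eq_bigr => j' _.
by rewrite mulrA (cwE cw).1 !eqxx.
Qed.

(** The elements of this form contain 1 and are stable under left multiplication by each generator,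
    hence by every element. *)
Lemma mxsum_all z : mxsum z.
Proof.
have M1 : mxsum 1.
  exists (fun i j => if i == j then 1 else 0) => [i j|].
    by case: ifP => _; apply: (@homsum1 0); [exists 1; [exact: Dset1|rewrite mul1r]|exact: hom0].
  rewrite -[LHS](cwE cw).2; apply: eq_bigr => i _; rewrite (bigD1 i) //= eqxx /= mulr1.
  by rewrite big1 ?addr0 // => j ji; rewrite eq_sym (negPf ji) mulr0.
suff H : forall b, (forall z, mxsum z -> mxsum (b * z)) by rewrite -(mulr1 z); apply: H.
apply: (cw_ind cw) => [k|i j|||||a b Ha Hb|a b Ha Hb] v.
- apply: mxsum_map => [i j|]; first by rewrite scalC.
  by move=> z'; apply: (@homsum_map _ 0) => k' z'' hz; rewrite addr0; apply: homS.
- exact: mxsum_unit.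
- apply: mxsum_map (cwEw cw) _ => z'.
  by apply: (@homsum_map _ 0) => k' z'' hz; rewrite addr0; apply: homw.
- by apply: mxsum_map (cwEx cw) _ => z'; apply: homsum_map => k' z''; apply: homx.
- by apply: mxsum_map (cwEy cw) _ => z'; apply: homsum_map => k' z''; apply: homy.
- apply: mxsum_map => [i j|]; first by rewrite scalC.
  by move=> z'; apply: (@homsum_map _ 0) => k' z'' hz; rewrite addr0; apply: homS.
- by move=> Hv; rewrite mulrDl; apply: mxsumD; [apply: Ha|apply: Hb].
- by move=> Hv; rewrite -mulrA; apply/Ha/Hb.
Qed.


(** * Every nonzero ideal contains a nonzero polynomial in Y *)

Section Ideal.
Context (I : set B).
Hypothesis tI : two_sided_ideal I.

Let I0 : I 0. Proof. by case: tI. Qed.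
Let ID u v : I u -> I v -> I (u + v). Proof. by case: tI => _ H _ _; apply: H. Qed.
Let IMl a u : I u -> I (a * u). Proof. by case: tI => _ _ H _; apply: H. Qed.
Let IMr a u : I u -> I (u * a). Proof. by case: tI => _ _ _ H; apply: H. Qed.

(** An ideal is stable under ad Y, whose eigenvalue on degree k is k/2, so it contains the
    homogeneous components of its elements. *)
Lemma ideal_homsum z : I z -> homsum z -> z != 0 ->
  exists k z', [/\ hom k z', I z' & z' != 0].
Proof.
move=> Iz [s hs zE] z0.
pose f k := \sum_(t <- s | t.1 == k) t.2.
have hf k : hom k (f k).
  rewrite /f big_seq_cond; apply: (big_ind (hom k)) => [|u v|t /andP[ts /eqP <-]].
  - exact: hom0.
  - exact: homD.
  - exact: hs.
have zf : z = \sum_(k <- undup (map fst s)) f k by rewrite zE (sum_by_key fst).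
have If : {in undup (map fst s), forall k, I (f k)}.
  apply: (@eigen_extract K (regmod B) _ (fun u : regmod B => Y * u - u * Y) I
    (fun k : int => k%:~R * h)).
  - move=> c u v; rewrite -[c *: u]/(c%:S * u) -[c *: (_ - _)]/(c%:S * _).
    rewrite (mulrDr Y) (mulrDl _ _ Y) opprD addrACA; congr (_ + _).
    by rewrite mulrBr (mulrA Y) -(scalC c Y) -(mulrA _ Y) -(mulrA _ u).
  - exact: ID.
  - by move=> c u Iu; apply: IMl.
  - by move=> u Iu; apply: ID; [apply: IMl|rewrite -mulNr -mulN1r -mulrA; apply/IMl/IMr].
  - exact: undup_uniq.
  - move=> i j _ _ ij; rewrite -mulrBl -rmorphB.
    have hU : h \is a GRing.unit.
      by apply/unitrPr; exists 2%:R; rewrite mulr_natr mulr2n (cwhh cw).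
    rewrite unitrM hU andbT; move: ij; rewrite -subr_eq0.
    case: (i - j) => [[|m] //|m] _; first exact: natu.
    by rewrite NegzE rmorphN unitrN; apply: natu.
  - by move=> k _; rewrite (hom_ad (hf k)) addrAC subrr add0r.
  - by rewrite -zf.
have [k [ku fk]] : exists k, k \in undup (map fst s) /\ f k != 0.
  apply: contrapT => H; case/eqP: z0; rewrite zf big_seq big1 // => k ku.
  by apply: contrapT => /eqP fk; apply: H; exists k.
by exists k, (f k); split=> //; apply: If.
Qed.

Lemma ideal_hom z : I z -> z != 0 -> exists k z', [/\ hom k z', I z' & z' != 0].
Proof.
move=> Iz z0; have [b hb zE] := mxsum_all z.
have Ib i j : I (b i j).
  (* Sandwiching [z] between matrix units isolates one entry and spreads it along the diagonal. *)
  have -> : b i j = \sum_k E k i * z * E j k.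
    rewrite -[LHS]mul1r -(cwE cw).2 mulr_suml; apply: eq_bigr => k _.
    rewrite zE mulr_sumr mulr_suml (bigD1 i) //= [X in _ + X]big1 ?addr0 => [|i' ii]; last first.
      rewrite mulr_sumr mulr_suml big1 // => j' _.
      by rewrite mulrA (cwE cw).1 eq_sym (negPf ii) !mul0r.
    rewrite mulr_sumr mulr_suml (bigD1 j) //= [X in _ + X]big1 ?addr0 => [|j' jj]; last first.
      rewrite mulrA (cwE cw).1 eqxx -mulrA -homsumE // mulrA (cwE cw).1.
      by rewrite (negPf jj) mul0r.
    rewrite mulrA (cwE cw).1 eqxx -mulrA -homsumE // mulrA (cwE cw).1 eqxx.
    by [].
  by apply: (big_ind I) => // k _; apply/IMr/IMl.
have [i [j bij]] : exists i j, b i j != 0.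
  apply: contrapT => H; case/eqP: z0; rewrite zE big1 // => i _; rewrite big1 // => j _.
  by have [->|bij] := eqVneq (b i j) 0; [rewrite mulr0|case: H; exists i, j].
exact: ideal_homsum (Ib i j) (hb i j) bij.
Qed.

(** The polynomial is a product of shifts of the linear polynomials [cxy], and [K] is a domain. *)
Lemma pow_xy m : exists2 c : bool -> {poly K}, (forall s, c s != 0) &
  forall s p, ev s p * (x ^+ m * y ^+ m) = ev s (p * c s).
Proof.
elim: m => [|m [c c0 cE]].
  by exists (fun _ => 1) => [s|s p]; rewrite ?oner_eq0 // !expr0 !mulr1.
exists (fun s => shx (c (~~ s)) * cxy s) => [s|s p].
  by rewrite mulf_neq0 ?shx_neq0 ?cxy_neq0.
have e : x * (x ^+ m * y ^+ m) = (ev false (shx (c true)) + ev true (shx (c false))) * x.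
  rewrite -[x ^+ m * _]mul1r ev1_sum (mulrDl (ev _ _)) !cE !mul1r.
  by rewrite (mulrDr x) !xev (mulrDl (ev _ _)) addrC.
rewrite exprS exprSr -mulrA (mulrA (x ^+ m)) (mulrA x) e -mulrA mulrA mulrDr !evM.
by case: s => /=; rewrite ?add0r ?addr0 ev_xy -(mulrA p).
Qed.

Lemma pow_yx m : exists2 c : bool -> {poly K}, (forall s, c s != 0) &
  forall s p, ev s p * (y ^+ m * x ^+ m) = ev s (p * c s).
Proof.
elim: m => [|m [c c0 cE]].
  by exists (fun _ => 1) => [s|s p]; rewrite ?oner_eq0 // !expr0 !mulr1.
exists (fun s => shy (c (~~ s)) * cyx s) => [s|s p].
  by rewrite mulf_neq0 ?shy_neq0 ?cyx_neq0.
have e : y * (y ^+ m * x ^+ m) = (ev false (shy (c true)) + ev true (shy (c false))) * y.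
  rewrite -[y ^+ m * _]mul1r ev1_sum (mulrDl (ev _ _)) !cE !mul1r.
  by rewrite (mulrDr y) !yev (mulrDl (ev _ _)) addrC.
rewrite exprS exprSr -mulrA (mulrA (y ^+ m)) (mulrA y) e -mulrA mulrA mulrDr !evM.
by case: s => /=; rewrite ?add0r ?addr0 ev_yx -(mulrA p).
Qed.

(** A homogeneous element is multiplied by the opposite power of [x] or [y], which brings it back to
    degree zero and multiplies its polynomial coefficients by nonzero polynomials. It is the
    polynomial, not its value in [B], that is shown to be nonzero. *)
Lemma ideal_ev z : I z -> z != 0 -> exists s p, p != 0 /\ I (ev s p).
Proof.
move=> Iz z0; have [k [{z0 Iz}z [[d [p0 [p1 dE]] zE] Iz z0]]] := ideal_hom Iz z0.
have [Xk HX] : exists Xk, exists2 c : bool -> {poly K}, (forall s, c s != 0) &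
    forall s p, ev s p * (Xp k * Xk) = ev s (p * c s).
  by case: (k) => m; [exists (y ^+ m); exact: pow_xy|exists (x ^+ m.+1); exact: pow_yx].
case: HX => c c0 cE.
pose ps s := if s then p1 else p0.
have Is s : I (ev s (ps s * c s)).
  rewrite -cE mulrA; apply: IMr.
  have -> : ev s (ps s) * Xp k = ev s 1 * z.
    rewrite zE (mulrA (ev s 1)) dE (mulrDr (ev s 1)) !evM !mul1r.
    by case: s; rewrite ?add0r ?addr0.
  exact: IMl.
have [s ps0] : exists s, ps s != 0.
  apply: contrapT => H; case/eqP: z0; rewrite zE dE.
  have [-> ->] : p0 = 0 /\ p1 = 0.
    by split; apply: contrapT => /eqP ?; apply: H; [exists false|exists true].
  by rewrite !raddf0 addr0 mul0r.
by exists s, (ps s * c s); split; rewrite ?mulf_neq0.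
Qed.

(** Conjugating by [x] and [y] carries the element for one sign of w to one for the other sign. The
    product of the two polynomials serves for both signs, and the two projections add up to 1. *)
Lemma ideal_pev z : I z -> z != 0 -> exists p, p != 0 /\ I (pev Y p).
Proof.
move=> Iz /(ideal_ev Iz)[s [p [p0 Ip]]].
have Ip' : I (ev (~~ s) (shx p * cxy (~~ s))).
  by rewrite -ev_xy (mulrA (ev _ _)) -xev; apply/IMr/IMl.
exists (p * (shx p * cxy (~~ s))); split.
  by apply: mulf_neq0 => //; apply: mulf_neq0; [apply: shx_neq0|apply: cxy_neq0].
rewrite ev_sum; have Is t : I (ev t (p * (shx p * cxy (~~ s)))).
  have [->|ts] := eqVneq t s; first by rewrite mulrC -pevM_ev; apply: IMl.
  have -> : t = ~~ s by case: (t) (s) ts => -[].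
  by rewrite -pevM_ev; apply: IMl.
exact: ID.
Qed.

End Ideal.
End GWA.

(** * From a polynomial in Y to powers of the raising and lowering operators *)

Section Nilpotent.
Context (C : numClosedFieldType).

(** The differences of two roots of [p] are finite in number, so some multiple of [c] is not among
    them. *)
Lemma translates_coprime (p : {poly C}) (c : C) : p != 0 -> c != 0 ->
  exists N, coprimep p (p \Po ('X - (N%:R * c)%:P)).
Proof.
move=> p0 c0; have [rs pE] := closed_field_poly_normal p.
pose D := [seq r - s | r <- rs, s <- rs].
have [N ND] : exists N, N%:R * c \notin D.
  apply: contrapT => H.
  have sub : {subset [seq (n%:R * c : C) | n <- iota 0 (size D).+1] <= D}.
    by move=> z /mapP[n _ ->]; apply: contrapT => /negP nD; apply: H; exists n.
  have uq : uniq [seq (n%:R * c : C) | n <- iota 0 (size D).+1].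
    rewrite map_inj_uniq ?iota_uniq // => m n /(mulIf c0)/eqP.
    by rewrite eqr_nat => /eqP.
  by have := uniq_leq_size uq sub; rewrite size_map size_iota ltnn.
exists N; apply/Pdiv.ClosedField.coprimepP => z /= pz.
apply/negP; rewrite horner_comp !hornerE => pz'.
have rootE u : root p u -> u \in rs.
  by rewrite pE rootZ ?lead_coef_eq0 // root_prod_XsubC.
case/negP: ND; apply/allpairsP; exists (z, z - N%:R * c); split=> //=.
- exact: rootE.
- exact: rootE.
- by rewrite opprB addrCA subrr addr0.
Qed.

(** The ideal contains p(Y) x^N and x^N p(Y) = p(Y - Nc) x^N. For a suitable N the two polynomials
    are coprime, and a Bezout relation gives x^N. *)
Lemma ideal_nilpotent (B : pzAlgType C) (I : set B) (Y x : B) (c : C) (p : {poly C}) :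
  two_sided_ideal I -> c != 0 -> p != 0 -> x * Y = (Y - c%:S) * x -> I (pev Y p) ->
  exists N, I (x ^+ N).
Proof.
move=> [I0 ID IMl IMr] c0 p0 xY Ip; have [N cop] := translates_coprime p0 c0.
have xN m : x ^+ m * Y = (Y - (m%:R * c)%:S) * x ^+ m.
  elim: m => [|m IH]; first by rewrite mul0r rmorph0 subr0 mulr1 mul1r.
  rewrite exprSr -mulrA xY mulrA mulrBr IH -scalC -mulrBl -mulrA; congr (_ * _).
  by rewrite -addrA -opprD -rmorphD mulrSr mulrDl mul1r.
have /Bezout_eq1_coprimepP[[u v] /= uv1] := cop.
exists N; rewrite -[x ^+ N]mul1r -(rmorph1 (pev Y)) -uv1 (rmorphD (pev Y)) !(rmorphM (pev Y)) mulrDl.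
apply: ID; first by apply/IMr/IMl.
rewrite /= -mulrA; apply: (IMl).
rewrite pev_comp raddfB /= pevX pevC -(pev_intertwine _ (xN N)).
exact: IMl.
Qed.

End Nilpotent.

(* In terms of a = Y + L w and b = Y - L w, where Y = x y + y x, the operators x
   and y exchange the eigenvalues of a and b up to a shift by 1/2. *)
Record weight_data (C : numClosedFieldType) (B : pzAlgType C) r (E : 'I_r -> 'I_r -> B)
    (w x y a b : B) : Prop := WeightData {
  wdE : matrix_units E;
  wdEw : forall i j, E i j * w = w * E i j;
  wdEx : forall i j, E i j * x = x * E i j;
  wdEy : forall i j, E i j * y = y * E i j;
  wdEa : forall i j, E i j * a = a * E i j;
  wdEb : forall i j, E i j * b = b * E i j;
  wdww : w * w = 1;
  wdxw : x * w = - (w * x);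
  wdyw : y * w = - (w * y);
  wdaw : a * w = w * a;
  wdbw : b * w = w * b;
  wdab : a * b = b * a;
  wdxa : x * a = (b - (2^-1)%:S) * x;
  wdxb : x * b = (a - (2^-1)%:S) * x;
  wdya : y * a = (b + (2^-1)%:S) * y;
  wdyb : y * b = (a + (2^-1)%:S) * y;
  wdxy : x * y = (2^-1)%:S * (a - (4^-1)%:S);
  wdyx : y * x = (2^-1)%:S * (b + (4^-1)%:S);
  wd_ind : forall P : B -> Prop, (forall k, P k%:S) -> (forall i j, P (E i j)) ->
    P w -> P x -> P y -> P a -> P b -> (forall c d, P c -> P d -> P (c + d)) ->
    (forall c d, P c -> P d -> P (c * d)) -> forall c, P c
}.

Lemma weight_data_sym (C : numClosedFieldType) (B : pzAlgType C) r
    (E : 'I_r -> 'I_r -> B) (w x y a b : B) :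
  weight_data E w x y a b -> weight_data E w y (- x) (- b) (- a).
Proof.
case=> EU Ew Ex Ey Ea Eb ww xw yw aw bw ab xa xb ya yb xy yx ind; split=> //.
- by move=> i j; rewrite mulrN mulNr Ex.
- by move=> i j; rewrite mulrN mulNr Eb.
- by move=> i j; rewrite mulrN mulNr Ea.
- by rewrite mulrN mulNr xw.
- by rewrite mulrN mulNr bw.
- by rewrite mulrN mulNr aw.
- by rewrite !mulrNN ab.
- by rewrite mulrN yb -mulNr opprD.
- by rewrite mulrN ya -mulNr opprD.
- by rewrite mulrNN xb mulrN -mulNr opprD opprK.
- by rewrite mulrNN xa mulrN -mulNr opprD opprK.
- by rewrite mulrN yx -mulrN opprD.
- by rewrite mulNr xy -mulrN opprB addrC.
move=> P PS PE Pw Py Px Pb Pa PD PM; apply: ind => //.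
- by have := PM _ _ (PS (-1)) Px; rewrite rmorphN1 mulN1r opprK.
- by have := PM _ _ (PS (-1)) Pa; rewrite rmorphN1 mulN1r opprK.
- by have := PM _ _ (PS (-1)) Pb; rewrite rmorphN1 mulN1r opprK.
Qed.

Lemma weight_data_of (C : numClosedFieldType) (B : pzAlgType C) r
    (E : 'I_r -> 'I_r -> B) (L w x y : B) :
  clifford_weyl E (4^-1) L w x y ->
  weight_data E w x y (wt x y + L * w) (wt x y - L * w).
Proof.
move=> cw; have hE : 4^-1 + 4^-1 = 2^-1 :> C by field.
have xT : x * (L * w) = - (L * w * x).
  by rewrite mulrA -(cwLx cw) -!mulrA (cwxw cw) mulrN.
have yT : y * (L * w) = - (L * w * y).
  by rewrite mulrA -(cwLy cw) -!mulrA (cwyw cw) mulrN.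
have Tw : L * w * w = w * (L * w) by rewrite mulrA -(cwLw cw).
have ET i j : E i j * (L * w) = L * w * E i j.
  by rewrite mulrA (cwEL cw) -!mulrA (cwEw cw).
have YT : wt x y * (L * w) = L * w * wt x y.
  by rewrite mulrA -(wtL cw) -!mulrA (wtw cw).
have xY := wtx cw; have yY := wty cw; have xyE := cw_xyE cw; have yxE := cw_yxE cw.
have wY := wtw cw; have EY := wtE cw; rewrite !hE in xY yY xyE yxE.
(* Since L = (a - b) w / 2, the elements a and b may replace [L] among the generators. *)
have LE : L = (2^-1)%:S * ((wt x y + L * w - (wt x y - L * w)) * w).
  have -> : wt x y + L * w - (wt x y - L * w) = L * w + L * w by ncring.
  by rewrite mulrDl -!mulrA (cwww cw) mulr1 -hE (scal_hh cw).
case: cw => EU Ew Ex Ey EL Lw Lx Ly q4 ww xw yw xy ind.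
move: (wt x y) (L * w) xT yT Tw ET YT xY yY xyE yxE wY EY LE => Y T.
move=> xT yT Tw ET YT xY yY xyE yxE wY EY LE.
split=> //.
- by move=> i j; rewrite mulrDr mulrDl EY ET.
- by move=> i j; rewrite mulrBr mulrBl EY ET.
- by rewrite mulrDr mulrDl wY Tw.
- by rewrite mulrBr mulrBl wY Tw.
- transitivity (Y * Y - Y * T + T * Y - T * T); first by ncring.
  transitivity (Y * Y + Y * T - T * Y - T * T); last by ncring.
  by rewrite YT; ncring.
- by rewrite mulrDr xY xT -mulNr -mulrDl addrAC.
- by rewrite mulrBr xY xT opprK -mulrDl addrAC.
- by rewrite mulrDr yY yT -mulNr -mulrDl addrAC.
- by rewrite mulrBr yY yT opprK -mulrDl addrAC.
- by rewrite xyE addrAC.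
- by rewrite yxE addrAC.
move=> P PS PE Pw Px Py Pa Pb PD PM; apply: ind => //.
rewrite LE; apply: (PM) => //; apply: (PM) => //; apply: (PD) => //.
by have := PM _ _ (PS (-1)) Pb; rewrite rmorphN1 mulN1r.
Qed.

(** * Representations, cyclic submodules and diagonalizable operators *)

Section RepTheory.
Context (K : comNzRingType) (A : pzAlgType K) (V : lmodType K) (rho : rep A V).

Lemma rep0l v : rho 0 v = 0.
Proof. by apply: (@addrI _ (rho 0 v)); rewrite -rep_actDl !addr0. Qed.
Lemma rep0r a : rho a 0 = 0.
Proof. by apply: (@addrI _ (rho a 0)); rewrite -rep_actDr !addr0. Qed.
Lemma repNl a v : rho (- a) v = - rho a v.
Proof. by apply/eqP; rewrite -addr_eq0 -rep_actDl addNr rep0l. Qed.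
Lemma repNr a v : rho a (- v) = - rho a v.
Proof. by apply/eqP; rewrite -addr_eq0 -rep_actDr addNr rep0r. Qed.
Lemma rep1 v : rho 1 v = v.
Proof. by have := rep_actS rho 1 v; rewrite rmorph1 scale1r. Qed.
Lemma repZ a k v : rho a (k *: v) = k *: rho a v.
Proof. by rewrite -!(rep_actS rho) -!rep_actM scalC. Qed.
Lemma repSl k a v : rho (k%:S * a) v = k *: rho a v.
Proof. by rewrite rep_actM rep_actS. Qed.
Lemma rep_suml I (s : seq I) (P : pred I) F v :
  rho (\sum_(i <- s | P i) F i) v = \sum_(i <- s | P i) rho (F i) v.
Proof. by apply: (big_morph (fun a => rho a v)) => [a b|]; [exact: rep_actDl|exact: rep0l]. Qed.
Lemma rep_sumr I (s : seq I) (P : pred I) a F :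
  rho a (\sum_(i <- s | P i) F i) = \sum_(i <- s | P i) rho a (F i).
Proof. by apply: (big_morph (rho a)) => [u v|]; [exact: rep_actDr|exact: rep0r]. Qed.

Lemma rep_ker_ideal : two_sided_ideal (rep_ker rho).
Proof.
split=> [v|a b ka kb v|a b kb v|a b kb v].
- exact: rep0l.
- by rewrite rep_actDl ka kb addr0.
- by rewrite rep_actM kb rep0r.
- by rewrite rep_actM kb.
Qed.

Definition cyc (u : V) : set V := [set v | exists a, v = rho a u].

Lemma cyc_subrep u : subrep rho (cyc u).
Proof.
split=> [|v v' [a ->] [b ->]|k v [a ->]|b v [a ->]].
- by exists 0; rewrite rep0l.
- by exists (a + b); rewrite rep_actDl.
- by exists (k%:S * a); rewrite repSl.
- by exists (b * a); rewrite rep_actM.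
Qed.

Lemma cyc_refl u : cyc u u.
Proof. by exists 1; rewrite rep1. Qed.

Lemma cyc_sub u S : subrep rho S -> S u -> cyc u `<=` S.
Proof. by move=> [_ _ _ SA] Su v [a ->]; apply: SA. Qed.

End RepTheory.

Section Eigen.
Context (C : fieldType) (A : pzAlgType C) (V : lmodType C) (rho : rep A V).

Definition Pr (c : A) (rs : seq C) : A := \prod_(r <- rs) (c - r%:S).

Lemma Pr_nil c : Pr c [::] = 1.
Proof. by rewrite /Pr big_nil. Qed.
Lemma Pr_cons c s rs : Pr c (s :: rs) = (c - s%:S) * Pr c rs.
Proof. by rewrite /Pr big_cons. Qed.

Lemma Pr_pev c rs : Pr c rs = pev c (\prod_(r <- rs) ('X - r%:P)).
Proof.
rewrite (rmorph_prod (pev c)); apply: eq_bigr => r _.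
by rewrite /= raddfB /= pevX pevC.
Qed.

Lemma rep_XsubC c r v : rho (c - r%:S) v = rho c v - r *: v.
Proof. by rewrite rep_actDl repNl rep_actS. Qed.

Lemma rep_Pr_eig c rs v k : rho c v = k *: v ->
  rho (Pr c rs) v = (\prod_(r <- rs) (k - r)) *: v.
Proof.
move=> cv; elim: rs => [|r rs IH]; first by rewrite /Pr !big_nil rep1 scale1r.
rewrite /Pr !big_cons rep_actM -/(Pr c rs) IH repZ rep_XsubC cv -scalerBl scalerA.
by rewrite mulrC.
Qed.

(** Diagonalization in the form of an induction principle: an operator killed by a polynomial with
    simple roots splits each vector of [S] into eigenvectors lying in [S]. *)
Lemma eig_ind (c : A) (S P : V -> Prop) (rs : seq C) :
  P 0 -> (forall u v, P u -> P v -> P (u + v)) ->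
  (forall u v, S u -> S v -> S (u + v)) -> (forall k v, S v -> S (k *: v)) ->
  (forall v, S v -> S (rho c v)) -> uniq rs ->
  (forall v k, S v -> k \in rs -> rho c v = k *: v -> P v) ->
  forall v, S v -> rho (Pr c rs) v = 0 -> P v.
Proof.
move=> P0 PD SD SZ Sc; have SPr s v : S v -> S (rho (Pr c s) v).
  move=> Sv; elim: s => [|k s IH]; first by rewrite /Pr big_nil rep1.
  rewrite /Pr big_cons rep_actM -/(Pr c s) rep_XsubC; apply: SD; first exact: Sc.
  by rewrite -scaleNr; apply: SZ.
elim: rs => [_ _ v _|r rs IH /= /andP[rrs urs] Pe v Sv].
  by rewrite /Pr big_nil rep1 => ->.
rewrite /Pr big_cons rep_actM -/(Pr c rs); set u := rho (Pr c rs) v => cu.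
have {}cu : rho c u = r *: u by apply/eqP; rewrite -subr_eq0 -rep_XsubC cu.
(* Lagrange interpolation: u / k is the component of [v] for the eigenvalue [r], and the remaining
   part is killed by the other factors. *)
pose k := \prod_(s <- rs) (r - s).
have k0 : k != 0.
  rewrite prodf_seq_neq0; apply/allP => s srs; apply/implyP => _.
  by rewrite subr_eq0; apply: contraNneq rrs => ->.
have Su : S (k^-1 *: u) by apply/SZ/SPr.
rewrite -(subrK (k^-1 *: u) v); apply: PD; last first.
  by apply: (Pe _ r) => //; rewrite ?mem_head // repZ cu !scalerA mulrC.
apply: IH => //.
- by move=> v' k' Sv' k'rs; apply: Pe => //; rewrite inE k'rs orbT.
- by apply: SD => //; rewrite -scaleNr; apply: SZ; apply: SPr.
- rewrite rep_actDr repNr repZ (rep_Pr_eig _ cu) scalerA mulVf //.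
  by rewrite scale1r subrr.
Qed.

End Eigen.

(** * Consequences of the nilpotency of x and y: spectra and the sign rule *)

Section Bounded.
Context (C : numClosedFieldType) (B : pzAlgType C) (r : nat) (E : 'I_r -> 'I_r -> B).
Context (w x y a b : B).

(** The roots of f and g in x^k y^k = 2^(-k) f(a) g(b): initial segments of 1/4, 5/4, 9/4, ... for f
    and of 3/4, 7/4, ... for g. The recursion reflects that [x] exchanges a and b with a shift by
    1/2. *)
Fixpoint nodes (k : nat) : seq C * seq C :=
  if k is k'.+1 then
    (4^-1 :: map (+%R^~ (2^-1)) (nodes k').2, map (+%R^~ (2^-1)) (nodes k').1)
  else ([::], [::]).

Lemma nodes_gt0 k : all (> 0) (nodes k).1 /\ all (> 0) (nodes k).2.
Proof.
elim: k => [//|k [H1 H2]] /=; rewrite !all_map invr_gt0 ltr0n /=.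
by split; [apply: sub_all H2|apply: sub_all H1] => z /= z0;
  rewrite addr_gt0 ?invr_gt0 ?ltr0n.
Qed.

Lemma nodes_uniq k : uniq (nodes k).1 /\ uniq (nodes k).2.
Proof.
elim: k => [//|k [H1 H2]] /=; rewrite !map_inj_uniq ?H1 ?H2; try exact: addIr.
split=> //; rewrite andbT; apply/mapP => -[z zg e].
have [_ /allP/(_ z zg) z0] := nodes_gt0 k.
have : z = - (4^-1) by apply: (addIr (2^-1)); rewrite -e; field.
by move=> ze; move: z0; rewrite ze oppr_gt0 invr_lt0 ltrn0.
Qed.

Lemma Pr_shift (c c' : B) rs k : c' = c - k%:S -> Pr c' rs = Pr c (map (+%R^~ k) rs).
Proof.
move=> ->; rewrite /Pr big_map; apply: eq_bigr => s _.
by rewrite rmorphD opprD addrA addrAC.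
Qed.

Lemma Pr_intertwine (z c c' : B) rs : z * c = c' * z -> z * Pr c rs = Pr c' rs * z.
Proof. by move=> zc; rewrite !Pr_pev; apply: pev_intertwine. Qed.

Lemma Pr_comm (c c' : B) rs rs' : c * c' = c' * c -> Pr c rs * Pr c' rs' = Pr c' rs' * Pr c rs.
Proof. by move=> cc; apply/Pr_intertwine/esym/Pr_intertwine. Qed.

Lemma Pr_opp (c : B) rs : Pr (- c) rs = ((-1) ^+ size rs)%:S * Pr c (map -%R rs).
Proof.
elim: rs => [|s rs IH] /=; first by rewrite !Pr_nil expr0 rmorph1 mul1r.
rewrite !Pr_cons IH exprS rmorphM rmorphN1 rmorphN opprK -opprD mulN1r mulNr.
by rewrite [in RHS]mulNr; congr (- _); rewrite mulrA -scalC mulrA.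
Qed.

Lemma pow_nodes k : weight_data E w x y a b ->
  x ^+ k * y ^+ k = (2^-1 ^+ k)%:S * (Pr a (nodes k).1 * Pr b (nodes k).2).
Proof.
move=> wd; elim: k => [|k IH].
  by rewrite !expr0 !Pr_nil !mulr1 rmorph1.
rewrite exprS exprSr -mulrA (mulrA (x ^+ k)) IH /=; move: (nodes k) => [f g] /=.
rewrite Pr_cons; set f' := map _ f; set g' := map _ g.
have -> : x * ((2^-1 ^+ k)%:S * (Pr a f * Pr b g) * y)
    = (2^-1 ^+ k)%:S * (x * Pr a f * Pr b g * y) by rewrite !mulrA scalC.
rewrite (Pr_intertwine _ (wdxa wd)) -(mulrA _ x) (Pr_intertwine _ (wdxb wd)).
rewrite (Pr_shift _ (erefl (b - (2^-1)%:S))) (Pr_shift _ (erefl (a - (2^-1)%:S))) -/f' -/g'.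
rewrite (mulrA _ _ x) -(mulrA _ x) (wdxy wd) (Pr_comm _ _ (esym (wdab wd))).
rewrite exprSr rmorphM -[RHS]mulrA; congr (_ * _).
rewrite (mulrA _ (2^-1)%:S) -scalC -[LHS]mulrA; congr (_ * _).
have aP : (a - (4^-1)%:S) * Pr a g' = Pr a g' * (a - (4^-1)%:S).
  by apply: Pr_intertwine; rewrite mulrBr mulrBl scalC.
have aPb : (a - (4^-1)%:S) * Pr b f' = Pr b f' * (a - (4^-1)%:S).
  by apply: Pr_intertwine; rewrite mulrBr mulrBl scalC (wdab wd).
by rewrite aP -!mulrA aPb.
Qed.

End Bounded.

Section BoundedIdeal.
Context (C : numClosedFieldType) (B : pzAlgType C) (r : nat) (E : 'I_r -> 'I_r -> B).
Context (w x y a b : B).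
Hypothesis wd : weight_data E w x y a b.
Context (I : set B) (N : nat).
Hypothesis tI : two_sided_ideal I.
Hypothesis IyN : I (y ^+ N).

Local Notation f := (nodes C N).1.
Local Notation g := (nodes C N).2.
Local Notation f' := (map -%R f).
Local Notation g' := (map -%R g).

Let ID u v : I u -> I v -> I (u + v). Proof. by case: tI => _ H _ _; apply: H. Qed.
Let IMl c u : I u -> I (c * u). Proof. by case: tI => _ _ H _; apply: H. Qed.
Let IMr c u : I u -> I (u * c). Proof. by case: tI => _ _ _ H; apply: H. Qed.

Lemma ideal_scalV k u : k != 0 -> I (k%:S * u) -> I u.
Proof.
by move=> k0 /(IMl k^-1%:S); rewrite mulrA -rmorphM mulVf // rmorph1 mul1r.
Qed.

(** The first element is x^N y^N up to a scalar. The second is y^N (-x)^N, computed through the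
    symmetry that replaces x, y, a, b by y, -x, -b, -a. *)
Lemma ideal_nodes : I (Pr a f * Pr b g) /\ I (Pr b f' * Pr a g').
Proof.
have h0 k : (2^-1 : C) ^+ k != 0 by rewrite expf_neq0 // invr_neq0 // pnatr_eq0.
split; first by apply: (ideal_scalV (h0 N)); rewrite -(pow_nodes N wd); apply: IMl.
have := pow_nodes N (weight_data_sym wd); rewrite !Pr_opp => e.
have : I (y ^+ N * (- x) ^+ N) by apply: IMr.
rewrite e => /(ideal_scalV (h0 N)).
rewrite -mulrA => /ideal_scalV H; have {H} : I (Pr b f' * (((-1) ^+ size g)%:S * Pr a g')).
  by apply: H; rewrite expf_neq0 // oppr_eq0 oner_eq0.
rewrite mulrA -scalC -mulrA => /ideal_scalV; apply.
by rewrite expf_neq0 // oppr_eq0 oner_eq0.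
Qed.

Lemma nodes_opp_coprime (s t : seq C) : all (> 0) s -> all (> 0) t ->
  coprimep (\prod_(z <- s) ('X - z%:P)) (\prod_(z <- map -%R t) ('X - z%:P)).
Proof.
move=> /allP s0 /allP t0; apply/Pdiv.ClosedField.coprimepP => z.
rewrite root_prod_XsubC => /s0 z0; rewrite -rootE root_prod_XsubC.
apply/mapP => -[u /t0 u0 zu]; move: z0; rewrite zu oppr_gt0 => /lt_trans/(_ u0).
by rewrite ltxx.
Qed.

Lemma pev_comm (c d : B) (p p' : {poly C}) : c * d = d * c -> pev c p * pev d p' = pev d p' * pev c p.
Proof. by move=> cd; apply/pev_intertwine/esym/pev_intertwine. Qed.

Lemma Pr_cat (c : B) s t : Pr c (s ++ t) = Pr c s * Pr c t.
Proof. by rewrite /Pr big_cat. Qed.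

(* I contains f(a) g(b) and f(-b) g(-a), and g(t), f(-t) are coprime since all
   nodes are positive; so b can be eliminated. *)
Lemma ideal_elim (c d : B) (s t s' t' : seq C) : c * d = d * c ->
  coprimep (\prod_(z <- t) ('X - z%:P)) (\prod_(z <- t') ('X - z%:P)) ->
  I (Pr c s * Pr d t) -> I (Pr c s' * Pr d t') -> I (Pr c (s ++ s')).
Proof.
move=> cd /Bezout_eq1_coprimepP[[u v] /= uv] H1 H2.
have cc : Pr c s * Pr c s' = Pr c s' * Pr c s by apply: Pr_comm.
have PC t1 p : Pr c t1 * pev d p = pev d p * Pr c t1.
  by rewrite Pr_pev; apply: pev_comm.
rewrite Pr_cat -[X in I X]mulr1 -(rmorph1 (pev d)) -uv (rmorphD (pev d)).
rewrite !(rmorphM (pev d)) /= -!Pr_pev mulrDr; apply: ID.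
  by rewrite cc -mulrA (mulrA (Pr c s)) PC -(mulrA (pev d u)); apply/IMl/IMl.
by rewrite -mulrA (mulrA (Pr c s')) PC -(mulrA (pev d v)); apply/IMl/IMl.
Qed.

Lemma ideal_Pr_a : I (Pr a (f ++ g')).
Proof.
have [H1 H2] := ideal_nodes; have [f0 g0] := nodes_gt0 C N.
apply: (ideal_elim (wdab wd) (nodes_opp_coprime g0 f0) H1).
by rewrite (Pr_comm _ _ (wdab wd)).
Qed.

Lemma ideal_Pr_b : I (Pr b (g ++ f')).
Proof.
have [H1 H2] := ideal_nodes; have [f0 g0] := nodes_gt0 C N.
apply: (ideal_elim (esym (wdab wd)) (nodes_opp_coprime f0 g0) _ H2).
by rewrite (Pr_comm _ _ (esym (wdab wd))).
Qed.

Lemma nodes_signed_uniq : uniq (f ++ g') /\ uniq (g ++ f').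
Proof.
have [f0 g0] := nodes_gt0 C N; have [uf ug] := nodes_uniq C N.
have H (s t : seq C) : all (> 0) s -> all (> 0) t -> uniq s -> uniq t -> uniq (s ++ map -%R t).
  move=> /allP s0 /allP t0 us ut; rewrite cat_uniq us map_inj_uniq ?ut ?andbT; last exact: oppr_inj.
  apply/hasPn => z /mapP[u /t0 u0 ->]; apply/negP => /s0; rewrite oppr_gt0 => /lt_trans/(_ u0).
  by rewrite ltxx.
by split; apply: H.
Qed.

End BoundedIdeal.

Section BoundedRep.
Context (C : numClosedFieldType) (B : pzAlgType C) (r : nat) (E : 'I_r -> 'I_r -> B).
Context (w x y a b : B).
Hypothesis wd : weight_data E w x y a b.
Context (V : lmodType C) (rho : rep B V) (N : nat).
Hypothesis xN0 : forall v, rho (x ^+ N) v = 0.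
Hypothesis yN0 : forall v, rho (y ^+ N) v = 0.

Definition jeig (v : V) (al be ep : C) : Prop :=
  [/\ rho a v = al *: v, rho b v = be *: v & rho w v = ep *: v].

(** The commuting operators a, b and w are each killed by a polynomial with simple roots, so they
    are split one after the other; the idempotents [E i i] then split each joint eigenspace. *)
Lemma joint_ind (S P : V -> Prop) : subrep rho S -> P 0 ->
  (forall u v, P u -> P v -> P (u + v)) ->
  (forall v al be ep i, S v -> jeig v al be ep -> rho (E i i) v = v -> P v) ->
  forall v, S v -> P v.
Proof.
move=> [S0 SD SZ SA] P0 PD PE.
have tI := rep_ker_ideal rho.
have [ua ub] := nodes_signed_uniq C N.
have ka := ideal_Pr_a wd tI yN0; have kb := ideal_Pr_b wd tI yN0.
have comm c d v k : c * d = d * c -> rho c v = k *: v -> rho c (rho d v) = k *: rho d v.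
  by move=> cd cv; rewrite -rep_actM cd rep_actM cv repZ.
have kw v : rho (Pr w [:: 1; -1]) v = 0.
  have -> : Pr w [:: 1; -1] = w * w - 1.
    by rewrite !Pr_cons Pr_nil rmorphN !rmorph1; ncring.
  by rewrite (wdww wd) subrr rep0l.
move=> v Sv.
apply: (@eig_ind _ _ _ rho a S P _ P0 PD SD SZ (SA a) ua _ v Sv (ka v)) => {Sv}v al Sv _ av.
apply: (@eig_ind _ _ _ rho b (fun v => S v /\ rho a v = al *: v) P _ P0 PD _ _ _ ub _ v
  (conj Sv av) (kb v)) => {Sv av}.
- by move=> u u' [Su au] [Su' au']; split; [exact: SD|rewrite rep_actDr au au' scalerDr].
- by move=> k u [Su au]; split; [exact: SZ|rewrite repZ au !scalerA mulrC].
- by move=> u [Su au]; split; [exact: SA|apply: comm => //; apply: (wdab wd)].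
move=> {}v be [Sv av] _ bv.
apply: (@eig_ind _ _ _ rho w (fun v => [/\ S v, rho a v = al *: v & rho b v = be *: v]) P
  [:: 1; -1] P0 PD _ _ _ _ _ v (And3 Sv av bv) (kw v)) => {Sv av bv}.
- by move=> u u' [Su au bu] [Su' au' bu']; split; rewrite ?rep_actDr ?au ?au' ?bu ?bu' ?scalerDr //; apply: SD.
- by move=> k u [Su au bu]; split; rewrite ?repZ ?au ?bu ?scalerA 1?mulrC //; apply: SZ.
- move=> u [Su au bu]; split; first exact: SA.
    by apply: comm => //; apply: (wdaw wd).
  by apply: comm => //; apply: (wdbw wd).
- by rewrite /= inE andbT -subr_eq0 opprK -mulr2n pnatr_eq0.
move=> {}v ep [Sv av bv] _ wv.
rewrite -(rep1 rho v) -(wdE wd).2 rep_suml; apply: (big_ind P) => // i _.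
apply: (PE _ al be ep i); first exact: SA.
  by split; apply: comm => //; apply/esym; [apply: wdEa wd _ _|apply: wdEb wd _ _|apply: wdEw wd _ _].
by rewrite -rep_actM (wdE wd).1 eqxx.
Qed.

(** All nodes are positive: f(a) g(b) = 0 makes one of the two eigenvalues positive, and f(-b) g(-a)
    = 0 makes one of them negative. *)
Lemma sign_cond v al be : v != 0 -> rho a v = al *: v -> rho b v = be *: v ->
  (0 < al /\ be < 0) \/ (al < 0 /\ 0 < be).
Proof.
move=> v0 av bv; have [H1 H2] := ideal_nodes wd (rep_ker_ideal rho) yN0.
have [/allP f0 /allP g0] := nodes_gt0 C N.
have H s t : rho (Pr a s * Pr b t) v = 0 -> (al \in s) || (be \in t).
  rewrite rep_actM (rep_Pr_eig _ bv) repZ (rep_Pr_eig _ av) scalerA => /eqP.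
  rewrite scaler_eq0 (negPf v0) orbF mulf_eq0 !prodf_seq_eq0 => /orP[]/hasP[z zs];
    by rewrite /= subr_eq0 => /eqP ->; rewrite zs ?orbT.
have A1 := H _ _ (H1 v).
rewrite (Pr_comm _ _ (esym (wdab wd))) in H2; have A2 := H _ _ (H2 v).
have {A1} A1 : (0 < al) || (0 < be) by case/orP: A1 => [/f0->|/g0 ->]; rewrite ?orbT.
have {A2} A2 : (al < 0) || (be < 0).
  by case/orP: A2 => /mapP[z zs ->]; rewrite !oppr_lt0; [rewrite g0|rewrite f0 ?orbT].
case/orP: A1 => [al0|be0]; case/orP: A2 => [al1|be1].
- by have := lt_trans al0 al1; rewrite ltxx.
- by left.
- by right.
- by have := lt_trans be0 be1; rewrite ltxx.
Qed.

Lemma jeig_x v al be ep : jeig v al be ep ->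
  jeig (rho x v) (be + 2^-1) (al + 2^-1) (- ep).
Proof.
move=> [av bv wv]; split; rewrite -rep_actM.
- have -> : a * x = x * b + (2^-1)%:S * x by rewrite (wdxb wd) mulrBl subrK.
  by rewrite rep_actDl repSl rep_actM bv repZ -scalerDl.
- have -> : b * x = x * a + (2^-1)%:S * x by rewrite (wdxa wd) mulrBl subrK.
  by rewrite rep_actDl repSl rep_actM av repZ -scalerDl.
- have -> : w * x = - (x * w) by rewrite (wdxw wd) opprK.
  by rewrite repNl rep_actM wv repZ scaleNr.
Qed.

Lemma jeig_y v al be ep : jeig v al be ep ->
  jeig (rho y v) (be - 2^-1) (al - 2^-1) (- ep).
Proof.
move=> [av bv wv]; split; rewrite -rep_actM.
- have -> : a * y = y * b - (2^-1)%:S * y by rewrite (wdyb wd) mulrDl addrK.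
  by rewrite rep_actDl repNl repSl rep_actM bv repZ -scalerBl.
- have -> : b * y = y * a - (2^-1)%:S * y by rewrite (wdya wd) mulrDl addrK.
  by rewrite rep_actDl repNl repSl rep_actM av repZ -scalerBl.
- have -> : w * y = - (y * w) by rewrite (wdyw wd) opprK.
  by rewrite repNl rep_actM wv repZ scaleNr.
Qed.

Lemma rep_yx v al be ep : jeig v al be ep ->
  rho y (rho x v) = (2^-1 * (be + 4^-1)) *: v.
Proof.
by move=> [_ bv _]; rewrite -rep_actM (wdyx wd) repSl rep_actDl rep_actS bv -scalerDl scalerA.
Qed.
Lemma rep_xy v al be ep : jeig v al be ep ->
  rho x (rho y v) = (2^-1 * (al - 4^-1)) *: v.
Proof.
move=> [av _ _]; rewrite -rep_actM (wdxy wd) repSl rep_actDl repNl rep_actS av.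
by rewrite -scalerBl scalerA.
Qed.

(** If [be] were -1/4, then [al] would be positive by the sign rule, and x v would have the
    eigenvalues 1/4 and al + 1/2, both positive. Hence [y] undoes [x] up to a nonzero scalar
    wherever x v is nonzero. *)
Lemma yx_neq0 v al be ep : jeig v al be ep -> rho x v != 0 -> be + 4^-1 != 0.
Proof.
move=> j xv; apply/eqP => be0; have [ax bx _] := jeig_x j.
have v0 : v != 0 by apply: contraNneq xv => ->; rewrite rep0r.
have q0 : 0 < 4^-1 :> C by rewrite invr_gt0 ltr0n.
have beE : be = - (4^-1) by apply/eqP; rewrite -addr_eq0 be0.
have ben : be < 0 by rewrite beE oppr_lt0.
have aln : 0 < al.
  case: j => av bv _; case: (sign_cond v0 av bv) => [[]//|[_]].
  by move=> /lt_trans/(_ ben); rewrite ltxx.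
have h2 : be + 2^-1 = 4^-1 by rewrite beE; field.
case: (sign_cond xv ax bx); rewrite h2 => -[H1 H2].
  have h0 : 0 < 2^-1 :> C by rewrite invr_gt0 ltr0n.
  by have := lt_trans H2 (addr_gt0 aln h0); rewrite ltxx.
by have := lt_trans H1 q0; rewrite ltxx.
Qed.

End BoundedRep.

(** * The cyclic module of a joint eigenvector killed by y *)

Section Cyclic.
Context (C : numClosedFieldType) (B : pzAlgType C) (r : nat) (E : 'I_r -> 'I_r -> B).
Context (w x y a b : B).
Hypothesis wd : weight_data E w x y a b.
Context (V : lmodType C) (rho : rep B V).
Local Notation jeig := (jeig w a b rho).

Context (i0 : 'I_r) (u : V) (al be ep : C).
Hypothesis ju : jeig u al be ep.
Hypothesis yu : rho y u = 0.
Hypothesis Eu : rho (E i0 i0) u = u.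

(** The space C[x] u is stable under x, y, w, a and b; the whole cyclic module is spread out from it
    by the matrix units [E i i0]. *)
Let W1 (v : V) := exists p, v = rho (pev x p) u.

Let W1D v v' : W1 v -> W1 v' -> W1 (v + v').
Proof. by move=> [p ->] [p' ->]; exists (p + p'); rewrite raddfD rep_actDl. Qed.
Let W1Z k v : W1 v -> W1 (k *: v).
Proof. by move=> [p ->]; exists (k%:P * p); rewrite pevCM repSl. Qed.
Let W1x v : W1 v -> W1 (rho x v).
Proof. by move=> [p ->]; exists ('X * p); rewrite rmorphM /= pevX rep_actM. Qed.
Let W1u : W1 u.
Proof. by exists 1; rewrite rmorph1 rep1. Qed.

Lemma rep_pev_step p c : rho (pev x (p * 'X + c%:P)) u = rho x (rho (pev x p) u) + c *: u.
Proof.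
rewrite raddfD /= pevC rep_actDl rep_actS pevMX -rep_actM; congr (rho _ _ + _).
by apply/esym/pev_intertwine.
Qed.

Let W1ab v : W1 v -> W1 (rho a v) /\ W1 (rho b v).
Proof.
move=> [p -> {v}]; have [au bu _] := ju.
elim/poly_ind: p => [|p c [IHa IHb]].
  by rewrite raddf0 rep0l !rep0r; split; exists 0; rewrite raddf0 rep0l.
rewrite rep_pev_step; have Wv : W1 (rho (pev x p) u) by exists p.
move: (rho (pev x p) u) IHa IHb Wv => v IHa IHb Wv.
rewrite !rep_actDr !repZ au bu -!rep_actM.
have -> : a * x = x * b + (2^-1)%:S * x by rewrite (wdxb wd) mulrBl subrK.
have -> : b * x = x * a + (2^-1)%:S * x by rewrite (wdxa wd) mulrBl subrK.
rewrite !rep_actDl !repSl !rep_actM.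
by split; apply: W1D; do ?[apply: W1D|apply: W1Z|apply: W1x].
Qed.

Let W1y v : W1 v -> W1 (rho y v).
Proof.
move=> [p ->]; elim/poly_ind: p => [|p c _].
  by rewrite raddf0 rep0l rep0r; exists 0; rewrite raddf0 rep0l.
rewrite rep_pev_step rep_actDr repZ yu scaler0 addr0 -rep_actM (wdyx wd) repSl.
rewrite rep_actDl rep_actS; have Wv : W1 (rho (pev x p) u) by exists p.
by apply/W1Z/W1D; [case: (W1ab Wv)|apply: W1Z].
Qed.

Let W1w v : W1 v -> W1 (rho w v).
Proof.
move=> [p ->]; exists (ep%:P * (p \Po - 'X)); have [_ _ wu] := ju.
have wx : w * x = - x * w by rewrite mulNr (wdxw wd) opprK.
rewrite -rep_actM (pev_intertwine p wx) rep_actM wu repZ pevCM repSl pev_comp.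
by rewrite raddfN /= pevX.
Qed.

Lemma rep_pev_E i p : rho (E i0 i) (rho (E i i0) (rho (pev x p) u)) = rho (pev x p) u.
Proof.
rewrite -rep_actM (wdE wd).1 eqxx -rep_actM.
by rewrite (pev_intertwine p (wdEx wd i0 i0)) rep_actM Eu.
Qed.

Lemma cyc_form v : cyc rho u v ->
  exists p : 'I_r -> {poly C}, v = \sum_i rho (E i i0) (rho (pev x (p i)) u).
Proof.
pose W v := exists p : 'I_r -> {poly C}, v = \sum_i rho (E i i0) (rho (pev x (p i)) u).
have WD v1 v2 : W v1 -> W v2 -> W (v1 + v2).
  move=> [p ->] [p' ->]; exists (fun i => p i + p' i); rewrite -big_split.
  by apply: eq_bigr => i _; rewrite raddfD rep_actDl rep_actDr.
have Wmap c v1 : (forall i, c * E i i0 = E i i0 * c) -> (forall v, W1 v -> W1 (rho c v)) ->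
    W v1 -> W (rho c v1).
  move=> cE cW [p ->].
  have H i : exists p', rho c (rho (pev x (p i)) u) = rho (pev x p') u.
    by apply: cW; exists (p i).
  have [p' p'E] := choice H; exists p'.
  rewrite rep_sumr; apply: eq_bigr => i _.
  by rewrite -rep_actM cE rep_actM p'E.
suff HW c v1 : W v1 -> W (rho c v1).
  move=> [c ->]; apply: HW; exists (fun i => if i == i0 then 1 else 0).
  rewrite (bigD1 i0) //= eqxx rmorph1 rep1 Eu big1 ?addr0 // => i /negPf ->.
  by rewrite raddf0 rep0l rep0r.
move: c v1; apply: (wd_ind wd) => [k|i j||||||c d Hc Hd|c d Hc Hd] v1 Wv.
- by apply: Wmap Wv => [i|v' Wv]; [exact: scalC|rewrite rep_actS; apply: W1Z].
- have [p ->] := Wv; exists (fun i' => if i' == i then p j else 0).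
  rewrite rep_sumr (bigD1 j) //= big1 ?addr0 => [|k /negPf kj]; last first.
    by rewrite -rep_actM (wdE wd).1 eq_sym kj rep0l.
  rewrite -rep_actM (wdE wd).1 eqxx (bigD1 i) //= eqxx big1 ?addr0 // => k /negPf ->.
  by rewrite raddf0 rep0l rep0r.
- by apply: Wmap Wv => [i|]; [rewrite (wdEw wd)|exact: W1w].
- by apply: Wmap Wv => [i|]; [rewrite (wdEx wd)|exact: W1x].
- by apply: Wmap Wv => [i|]; [rewrite (wdEy wd)|exact: W1y].
- by apply: Wmap Wv => [i|v' /W1ab[]]; [rewrite (wdEa wd)|].
- by apply: Wmap Wv => [i|v' /W1ab[]]; [rewrite (wdEb wd)|].
- by rewrite rep_actDl; apply: WD; [apply: Hc|apply: Hd].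
- by rewrite rep_actM; apply/Hc/Hd.
Qed.

Lemma jeig_pow k : exists al' be' ep',
  jeig (rho (x ^+ k) u) al' be' ep' /\ al' + be' = al + be + k%:R.
Proof.
elim: k => [|k [al' [be' [ep' [j e]]]]].
  by exists al, be, ep; rewrite expr0 rep1 addr0.
exists (be' + 2^-1), (al' + 2^-1), (- ep'); split.
  by rewrite exprS rep_actM; apply: (jeig_x wd).
have -> : k.+1%:R = k%:R + 1 :> C by rewrite natr1.
rewrite [RHS]addrA -e; have h2 : (2 : C) != 0 by rewrite pnatr_eq0.
by field.
Qed.

(** The operator a + b has the eigenvalue al + be + k on x^k u, and these are distinct, so a
    submodule contains each term of p(x) u. *)
Lemma subrep_extract S p : subrep rho S -> S (rho (pev x p) u) ->
  rho (pev x p) u != 0 -> exists k, S (rho (x ^+ k) u) /\ rho (x ^+ k) u != 0.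
Proof.
move=> [S0 SD SZ SA] Sp p0.
have pE : rho (pev x p) u = \sum_(k <- iota 0 (size p)) p`_k *: rho (x ^+ k) u.
  rewrite /pev rep_suml -(big_mkord xpredT (fun k => rho ((p`_k)%:S * x ^+ k) u)).
  by rewrite /index_iota subn0; apply: eq_bigr => k _; rewrite repSl.
have Sk : {in iota 0 (size p), forall k, S (p`_k *: rho (x ^+ k) u)}.
  apply: (@eigen_extract C V _ (rho (a + b)) S (fun k => al + be + k%:R)) => //.
  - by move=> k v v'; rewrite rep_actDr repZ.
  - exact: SA.
  - exact: iota_uniq.
  - by move=> k l _ _ kl; rewrite opprD addrACA subrr add0r unitfE subr_eq0 eqr_nat.
  - move=> k _; have [al' [be' [ep' [[ak bk _] e]]]] := jeig_pow k.
    by rewrite repZ rep_actDl ak bk -scalerDl e !scalerA mulrC.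
  - by rewrite -pE.
have [k [ks pk]] : exists k, k \in iota 0 (size p) /\ p`_k *: rho (x ^+ k) u != 0.
  apply: contrapT => H; case/eqP: p0; rewrite pE big_seq big1 // => k ks.
  by apply: contrapT => /eqP fk; apply: H; exists k.
move: pk; rewrite scaler_eq0 negb_or => /andP[pk xk].
exists k; split=> //; have := SZ (p`_k)^-1 _ (Sk k ks).
by rewrite scalerA mulVf // scale1r.
Qed.

(** The scalar be' + 1/4 is, up to the factor 1/2, that of yx on x^k u; while it is nonzero, one
    descends from x^(k+1) u to x^k u. Bounded modules satisfy this by the sign rule, generic Verma
    modules by direct computation. *)
Hypothesis Hstep : forall k al' be' ep', jeig (rho (x ^+ k) u) al' be' ep' ->
  rho (x ^+ k.+1) u != 0 -> be' + 4^-1 != 0.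

Lemma subrep_pow S k : subrep rho S -> S (rho (x ^+ k) u) -> rho (x ^+ k) u != 0 -> S u.
Proof.
move=> sS; have [S0 SD SZ SA] := sS.
elim: k => [|k IH]; first by rewrite expr0 rep1.
move=> Sx x0; have [al' [be' [ep' [j _]]]] := jeig_pow k.
have xk0 : rho (x ^+ k) u != 0.
  by apply: contraNneq x0; rewrite exprS rep_actM => ->; rewrite rep0r.
apply: IH => //; have c0 := Hstep j x0.
have := SA y _ Sx; rewrite exprS rep_actM (rep_yx wd j) => /(SZ (2^-1 * (be' + 4^-1))^-1).
by rewrite scalerA mulVf ?scale1r // mulf_neq0 // invr_neq0 // pnatr_eq0.
Qed.

Lemma subrep_cyc S v : subrep rho S -> S v -> cyc rho u v -> v != 0 -> S u.
Proof.
move=> sS Sv /cyc_form[p vE] v0; have [S0 SD SZ SA] := sS.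
have Ev i : rho (E i0 i) v = rho (pev x (p i)) u.
  rewrite vE rep_sumr (bigD1 i) //= rep_pev_E big1 ?addr0 // => k ki.
  by rewrite -rep_actM (wdE wd).1 eq_sym (negPf ki) rep0l.
have [i pi0] : exists i, rho (pev x (p i)) u != 0.
  apply: contrapT => H; case/eqP: v0; rewrite vE big1 // => i _.
  by have [->|pi0] := eqVneq (rho (pev x (p i)) u) 0; [rewrite rep0r|case: H; exists i].
have [|k [Sk k0]] := subrep_extract sS _ pi0; first by rewrite -Ev; apply: SA.
exact: subrep_pow Sk k0.
Qed.

Lemma cyc_irreducible : u != 0 -> irreducible_subrep rho (cyc rho u).
Proof.
move=> u0; split=> [||U sU UW]; first exact: cyc_subrep.
  move=> e; have : cyc rho u u := cyc_refl rho u.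
  by rewrite e => /eqP; rewrite (negPf u0).
have [[v [Uv v0]]|H] := pselect (exists v, U v /\ v != 0).
  right; apply/seteqP; split=> //; apply: cyc_sub => //.
  exact: subrep_cyc (UW _ Uv) v0.
left; apply/seteqP; split=> [v Uv|v ->]; last by case: sU.
by apply: contrapT => /eqP v0; apply: H; exists v.
Qed.

End Cyclic.

(** * Lowest vectors in bounded representations and their weights *)

Section Lowest.
Context (C : numClosedFieldType) (B : pzAlgType C) (r : nat) (E : 'I_r -> 'I_r -> B).
Context (w x y a b : B).
Hypothesis wd : weight_data E w x y a b.
Context (V : lmodType C) (rho : rep B V) (N : nat).
Hypothesis xN0 : forall v, rho (x ^+ N) v = 0.
Hypothesis yN0 : forall v, rho (y ^+ N) v = 0.
Local Notation jeig := (jeig w a b rho).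

Lemma xy_neq0 v al be ep : jeig v al be ep -> rho y v != 0 -> al - 4^-1 != 0.
Proof.
move=> [av bv wv] yv; rewrite -oppr_eq0 opprB addrC.
have mxN v' : rho ((- x) ^+ N) v' = 0.
  by rewrite exprNn rep_actM xN0 rep0r.
apply: (yx_neq0 (weight_data_sym wd) mxN (v := v) (al := - be) (ep := ep)) => //.
by split; rewrite ?repNl ?av ?bv ?scaleNr.
Qed.

Definition lowest (i : 'I_r) (u : V) (al be ep : C) : Prop :=
  [/\ u != 0, jeig u al be ep, rho y u = 0 & rho (E i i) u = u].

Lemma cyc_trans u v v' : cyc rho u v -> cyc rho v v' -> cyc rho u v'.
Proof. by move=> [c ->] [d ->]; exists (d * c); rewrite rep_actM. Qed.

Lemma jeig_E i j v al be ep : jeig v al be ep -> jeig (rho (E i j) v) al be ep.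
Proof.
by move=> [av bv wv]; split; rewrite -rep_actM -?(wdEa wd) -?(wdEb wd) -?(wdEw wd)
  rep_actM ?av ?bv ?wv repZ.
Qed.

(** Apply [y] as long as the result is nonzero. Each step is undone by [x] up to a nonzero scalar
    ([xy_neq0]), so [v] and the vector finally reached generate the same submodule. *)
Lemma lower i v al be ep : jeig v al be ep -> rho (E i i) v = v -> v != 0 ->
  exists u al be ep, [/\ lowest i u al be ep, cyc rho u v & cyc rho v u].
Proof.
move: v al be ep; suff H k v al be ep : rho (y ^+ k) v = 0 -> jeig v al be ep ->
    rho (E i i) v = v -> v != 0 ->
    exists u al be ep, [/\ lowest i u al be ep, cyc rho u v & cyc rho v u].
  by move=> v al be ep; apply: (H N).
elim: k v al be ep => [|k IH] v al be ep.
  by rewrite expr0 rep1 => ->; rewrite eqxx.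
rewrite exprSr rep_actM => yk j Ev v0; have [yv|yv] := eqVneq (rho y v) 0.
  by exists v, al, be, ep; split; [|exact: cyc_refl|exact: cyc_refl].
have [|u [al' [be' [ep' [lu uv vu]]]]] := IH _ _ _ _ yk (jeig_y wd j) _ yv.
  by rewrite -rep_actM (wdEy wd) rep_actM Ev.
exists u, al', be', ep'; split=> //; last by apply: cyc_trans vu; exists y.
apply: cyc_trans uv _; exists ((2^-1 * (al - 4^-1))^-1%:S * x).
rewrite repSl (rep_xy wd j) scalerA mulVf ?scale1r // mulf_neq0 ?invr_neq0 ?pnatr_eq0 //.
exact: xy_neq0 j yv.
Qed.

Lemma lowest_move i j u al be ep : lowest i u al be ep ->
  [/\ lowest j (rho (E j i) u) al be ep, cyc rho u (rho (E j i) u) &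
      cyc rho (rho (E j i) u) u].
Proof.
move=> [u0 ju yu Eu]; have EK : rho (E i j) (rho (E j i) u) = u.
  by rewrite -rep_actM (wdE wd).1 eqxx.
split; [split|by exists (E j i)|by exists (E i j); rewrite EK].
- by apply: contraNneq u0 => e; rewrite -EK e rep0r.
- exact: jeig_E.
- by rewrite -rep_actM -(wdEy wd) rep_actM yu rep0r.
- by rewrite -rep_actM (wdE wd).1 eqxx.
Qed.

Lemma lowest_irreducible i u al be ep : lowest i u al be ep ->
  irreducible_subrep rho (cyc rho u).
Proof.
move=> [u0 ju yu Eu]; apply: (cyc_irreducible wd ju yu Eu) => // k al' be' ep' j.
by rewrite exprS rep_actM; apply: (yx_neq0 wd yN0 j).
Qed.

Lemma lowest_gen i (S P : V -> Prop) : subrep rho S -> P 0 ->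
  (forall u v, P u -> P v -> P (u + v)) ->
  (forall u al be ep, S u -> lowest i u al be ep -> forall v, cyc rho u v -> P v) ->
  forall v, S v -> P v.
Proof.
move=> sS P0 PD PL; apply: (joint_ind wd yN0 sS) => // v al be ep j Sv jv Ev.
have [->//|v0] := eqVneq v 0; have [u [al' [be' [ep' [lu uv vu]]]]] := lower jv Ev v0.
have [lu' uu' u'u] := lowest_move i lu.
apply: PL lu' _ _; last exact: cyc_trans u'u uv.
exact: (cyc_sub sS Sv (cyc_trans vu uu')).
Qed.

Lemma lowest_exists i (S : set V) v : subrep rho S -> S v -> v != 0 ->
  exists u al be ep, S u /\ lowest i u al be ep.
Proof.
move=> sS Sv v0; pose P (v : V) := v = 0 \/ exists u al be ep, S u /\ lowest i u al be ep.
suff : P v by move=> [e|//]; rewrite e eqxx in v0.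
apply: (lowest_gen (i := i) (P := P) sS _ _ _ Sv) => [|u u' [->|H]|u al be ep Su lu v' _].
- by left.
- by rewrite add0r.
- by right.
- by right; exists u, al, be, ep.
Qed.

Section Scalar.
Variable lam : C.
Hypothesis abw : a - b = (lam *+ 2)%:S * w.

Lemma lowest_weights i u al be ep : lowest i u al be ep ->
  [/\ al = 4^-1, be = 4^-1 - lam *+ 2 * ep, ep * ep = 1 &
      exists m : nat, lam * ep = m%:R / 2 + 4^-1].
Proof.
move=> [u0 ju yu Eu]; have [au bu wu] := ju.
have h2 : (2 : C) != 0 by rewrite pnatr_eq0.
have scal0 k : k *: u = 0 -> k = 0.
  by move/eqP; rewrite scaler_eq0 (negPf u0) orbF => /eqP.
have alE : al = 4^-1.
  have := rep_xy wd ju; rewrite yu rep0r => /esym/scal0/eqP.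
  by rewrite mulf_eq0 invr_eq0 (negPf h2) /= subr_eq0 => /eqP.
have beE : be = 4^-1 - lam *+ 2 * ep.
  have : (al - be - lam *+ 2 * ep) *: u = 0.
    rewrite !scalerBl -au -bu -scalerA -wu -(rep_actS rho) -[rho w u]/(rho w u) -rep_actM -abw.
    by rewrite rep_actDl repNl subrr.
  by move/scal0/eqP; rewrite subr_eq0 alE => /eqP <-; rewrite opprB addrC subrK.
have epE : ep * ep = 1.
  apply/eqP; rewrite -subr_eq0; apply/eqP/scal0.
  by rewrite scalerBl -scalerA -wu -repZ -wu -rep_actM (wdww wd) rep1 scale1r subrr.
split=> //.
have jx k : jeig (rho (x ^+ k) u) ((if odd k then be else al) + k%:R / 2)
    ((if odd k then al else be) + k%:R / 2) ((-1) ^+ k * ep).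
  elim: k => [|k IH]; first by rewrite expr0 rep1 mul0r !addr0 mul1r.
  have := jeig_x wd IH; rewrite -rep_actM -exprS -!addrA.
  have -> : - ((-1) ^+ k * ep) = (-1) ^+ k.+1 * ep by rewrite exprS mulN1r mulNr.
  have -> : k%:R / 2 + 2^-1 = k.+1%:R / 2 :> C by rewrite -(natr1 k) mulrDl mul1r.
  by rewrite /=; case: (odd k).
(* Let d + 1 be the least exponent with x^(d+1) u = 0. Then y x^(d+1) u = 0 forces the b-eigenvalue
   of x^d u to be -1/4. *)
pose Q k := rho (x ^+ k) u == 0.
have exQ : exists k, Q k by exists N; rewrite /Q xN0.
case: (ex_minnP exQ) => -[|d]; rewrite /Q; first by rewrite expr0 rep1 (negPf u0).
move=> /eqP xd dmin.
have xd0 : rho (x ^+ d) u != 0 by apply/negP => /dmin; rewrite ltnn.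
have := rep_yx wd (jx d); rewrite -[rho x _]rep_actM -exprS xd rep0r => /esym/eqP.
rewrite scaler_eq0 (negPf xd0) orbF mulf_eq0 invr_eq0 (negPf h2) /=.
(* For odd d that eigenvalue is 1/4 + d/2, which is positive. For even d it is 1/4 - 2 lam ep + d/2,
   so lam ep = d/4 + 1/4 and m = d/2. *)
have [dodd|dev] := boolP (odd d).
  rewrite alE => /eqP e; have : 0 < 4^-1 + d%:R / 2 + 4^-1 :> C.
    by rewrite !addr_gt0 ?mulr_gt0 ?invr_gt0 ?ltr0n //; case: (d) dodd.
  by rewrite e ltxx.
rewrite beE => /eqP e; exists (d./2).
have dE : d%:R = (d./2)%:R *+ 2 :> C.
  by rewrite -mulrnA muln2 -{1}(odd_double_half d) (negPf dev).
move: e; rewrite dE => e; apply/eqP; rewrite -subr_eq0 -(mulIr_eq0 _ (mulIf h2)).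
by rewrite -oppr_eq0 -{}e; apply/eqP; field.
Qed.

End Scalar.
End Lowest.

Lemma subrepI (K : comNzRingType) (A : pzAlgType K) (V : lmodType K) (rho : rep A V) S T :
  subrep rho S -> subrep rho T -> subrep rho (S `&` T).
Proof.
move=> [S0 SD SZ SA] [T0 TD TZ TA]; split.
- by [].
- by move=> u v [Su Tu] [Sv Tv]; split; [apply: SD|apply: TD].
- by move=> k v [Sv Tv]; split; [apply: SZ|apply: TZ].
- by move=> k v [Sv Tv]; split; [apply: SA|apply: TA].
Qed.

(** * Complete reducibility of modules generated by irreducible submodules *)

Section CompleteReducibility.
Context (K : fieldType) (V : vectType K).

(** A subspace of maximal dimension inside [S] exhausts it, since any further vector could be
    added. *)
Lemma vspace_of_set (S : set V) : S 0 -> (forall u v, S u -> S v -> S (u + v)) ->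
  (forall k v, S v -> S (k *: v)) -> exists W : {vspace V}, forall v, (v \in W) = `[< S v >].
Proof.
move=> S0 SD SZ.
pose Q k := `[< exists W : {vspace V}, \dim W = k /\ forall v, v \in W -> S v >].
have exQ : exists k, Q k.
  exists 0%N; apply/asboolP; exists 0%VS; rewrite dimv0; split=> // v.
  by rewrite memv0 => /eqP ->.
have Qb k : Q k -> (k <= \dim {:V})%N.
  by move=> /asboolP[W [<- _]]; apply/dimvS/subvf.
have [k /asboolP[W [dW WS]] kmax] := ex_maxnP exQ Qb.
exists W => v; apply/idP/asboolP => [/WS//|Sv]; apply: contrapT => /negP vW.
suff /kmax : Q (k.+1) by rewrite ltnn.
apply/asboolP; exists (W + <[v]>)%VS; split; last first.
  by move=> _ /memv_addP[u uW [_ /vlineP[c ->] ->]]; apply/SD/SZ => //; apply: WS.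
rewrite dimv_disjoint_sum ?dW ?dim_vline; last first.
  apply/eqP; rewrite -subv0; apply/subvP => u /memv_capP[uW /vlineP[c e]].
  move: uW; rewrite e memv0; have [->|c0] := eqVneq c 0; first by rewrite scale0r eqxx.
  by rewrite rpredZeq (negPf c0) (negPf vW).
case: eqVneq vW => [->|_ _]; last by rewrite addn1.
by rewrite mem0v.
Qed.

Context (A : pzAlgType K) (rho : rep A V).

Definition independent_family m (W : 'I_m -> {vspace V}) :=
  (forall j, irreducible_subrep rho [set v | v \in W j]) /\
  \dim (\sum_(j < m) W j)%VS = (\sum_(j < m) \dim (W j))%N.

Lemma subrep_sum m (W : 'I_m -> {vspace V}) :
  (forall j, subrep rho [set v | v \in W j]) ->
  subrep rho [set v | v \in (\sum_(j < m) W j)%VS].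
Proof.
move=> sW; split=> [|u v|k v|a v] /=.
- exact: mem0v.
- exact: memvD.
- exact: memvZ.
- move=> /memv_sumP[f fW ->]; rewrite rep_sumr; apply: memv_sumr => j _.
  by have [_ _ _] := sW j; apply; apply: fW.
Qed.

(** Take an independent family of irreducible submodules with as many members as possible. An
    irreducible submodule not contained in its sum meets the sum in zero and could be added; so the
    sum contains them all. *)
Lemma generated_completely_reducible :
  (forall P : V -> Prop, P 0 -> (forall u v, P u -> P v -> P (u + v)) ->
     (forall S, irreducible_subrep rho S -> forall v, S v -> P v) -> forall v, P v) ->
  completely_reducible rho.
Proof.
move=> gen.
pose Q m := `[< exists W : 'I_m -> {vspace V}, independent_family W >].
have exQ : exists m, Q m.
  by exists 0%N; apply/asboolP; exists (fun=> 0%VS); split=> [[]//|]; rewrite !big_ord0 dimv0.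
have Qb m : Q m -> (m <= \dim {:V})%N.
  move=> /asboolP[W [iW dW]]; apply: (@leq_trans (\dim (\sum_(j < m) W j)%VS)).
    rewrite dW -[leqLHS]card_ord -sum1_card; apply: leq_sum => j _.
    rewrite lt0n dimv_eq0; apply/eqP => W0; have [_ + _] := iW j; apply.
    by rewrite W0; apply/seteqP; split=> v /=; rewrite memv0 => /eqP.
  exact/dimvS/subvf.
have [m /asboolP[W [iW dW]] mmax] := ex_maxnP exQ Qb.
exists m, W; split=> //; first by apply/directvP.
have sSum : subrep rho [set v | v \in (\sum_(j < m) W j)%VS].
  by apply: subrep_sum => j; have [] := iW j.
apply/vspaceP => v; rewrite memvf; apply: (gen (fun v => v \in (\sum_(j < m) W j)%VS)).
- exact: mem0v.
- exact: memvD.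
move=> S iS {}v Sv; have [sS Sn0 Smin] := iS; apply: contrapT => /negP vW.
suff /mmax : Q m.+1 by rewrite ltnn.
have [S0 SD SZ _] := sS; have [U UE] := vspace_of_set S0 SD SZ.
have US : [set v | v \in U] = S by apply/seteqP; split=> u /=; rewrite UE => /asboolP.
have dis : (\sum_(j < m) W j :&: U = 0)%VS.
  apply/eqP; rewrite -subv0; apply/subvP => u /memv_capP[uW]; rewrite UE => /asboolP uS.
  rewrite memv0; apply/eqP.
  case: (Smin _ (subrepI sS sSum)) => [u' []//|e|e].
    by have : [set 0] u by rewrite -e.
  by move: Sv; rewrite -e => -[_ /=]; rewrite (negPf vW).
pose W' j := if unlift ord_max j is Some j' then W j' else U.
have W'l j : W' (widen_ord (leqnSn m) j) = W j.
  rewrite /W'; have -> : widen_ord (leqnSn m) j = lift ord_max j.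
    by apply: val_inj; rewrite /= /bump leqNgt ltn_ord.
  by rewrite liftK.
have W'm : W' ord_max = U by rewrite /W' unlift_none.
apply/asboolP; exists W'; split=> [j|].
  by rewrite /W'; case: unliftP => [j' _|_] //; rewrite US.
rewrite !big_ord_recr /= W'm dimv_disjoint_sum; last by under eq_bigr do rewrite W'l.
by under eq_bigr do rewrite W'l; rewrite dW; under [in RHS]eq_bigr do rewrite W'l.
Qed.

End CompleteReducibility.

Lemma linear_of_fun (K : comNzRingType) (U V : lmodType K) (f : U -> V) :
  linear f -> exists g : {linear U -> V}, g =1 f.
Proof.
move=> lf; pose F := GRing.isLinear.Build K U V *:%R f lf.
pose g : {linear U -> V} := HB.pack f F; by exists g.
Qed.

Lemma bijective_of (T U : Type) (f : T -> U) :
  injective f -> (forall u, exists t, f t = u) -> bijective f.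
Proof.
move=> fI /choice[g fg]; exists g => [t|//]; exact/fI/fg.
Qed.

(** * Lowest vectors of equal weight: annihilators, intertwiners, isotypy *)

Section PairRep.
Context (K : comNzRingType) (A : pzAlgType K) (V1 V2 : lmodType K).
Context (rho1 : rep A V1) (rho2 : rep A V2).

Definition pair_act (a : A) (v : V1 * V2) : V1 * V2 := (rho1 a v.1, rho2 a v.2).

Definition pair_rep : rep A (V1 * V2)%type.
Proof.
by exists pair_act => [a b v|a u v|a b v|k v]; rewrite /pair_act;
  congr (_, _); rewrite /= ?rep_actDl ?rep_actDr ?rep_actM ?rep_actS.
Defined.
End PairRep.

Section Compare.
Context (C : numClosedFieldType) (B : pzAlgType C) (r : nat) (E : 'I_r -> 'I_r -> B).
Context (w x y a b : B).
Hypothesis wd : weight_data E w x y a b.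

(** The finiteness condition on which the weight arguments rest. Besides finite-dimensional
    representations it covers the quotients of [B] by nonzero ideals. *)
Definition bounded (V : lmodType C) (rho : rep B V) : Prop :=
  exists N, (forall v, rho (x ^+ N) v = 0) /\ (forall v, rho (y ^+ N) v = 0).

Lemma bounded_pair (V1 V2 : lmodType C) (rho1 : rep B V1) (rho2 : rep B V2) :
  bounded rho1 -> bounded rho2 -> bounded (pair_rep rho1 rho2).
Proof.
move=> [N1 [x1 y1]] [N2 [x2 y2]]; exists (N1 + N2)%N; split=> v.
  by congr (_, _); [rewrite addnC|]; rewrite exprD rep_actM ?x1 ?x2 rep0r.
by congr (_, _); [rewrite addnC|]; rewrite exprD rep_actM ?y1 ?y2 rep0r.
Qed.

(** The pair (u1, u2) is a lowest vector of the direct sum, so it generates an irreducible module.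
    The vectors of this module with zero first component form a submodule missing (u1, u2), hence
    zero: [c] cannot kill [u1] alone. *)
Lemma lowest_ann (V1 V2 : lmodType C) (rho1 : rep B V1) (rho2 : rep B V2) i u1 u2 al be ep c :
  bounded rho1 -> bounded rho2 ->
  lowest E w y a b rho1 i u1 al be ep -> lowest E w y a b rho2 i u2 al be ep ->
  rho1 c u1 = 0 -> rho2 c u2 = 0.
Proof.
move=> B1 B2 [u10 [au1 bu1 wu1] yu1 Eu1] [u20 [au2 bu2 wu2] yu2 Eu2] cu1.
apply: contrapT => /eqP cu2; have [N [xN yN]] := bounded_pair B1 B2.
have lu : lowest E w y a b (pair_rep rho1 rho2) i (u1, u2) al be ep.
  split.
  - by apply: contraNneq u10 => /(congr1 fst) /= ->.
  - by split; apply: injective_projections => /=.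
  - by apply: injective_projections => /=.
  - by apply: injective_projections => /=.
have [sU _ irr] := lowest_irreducible wd yN lu.
pose S : set (V1 * V2) := [set v | v.1 = 0].
have sS : subrep (pair_rep rho1 rho2) S.
  split=> [//|v v' /= e e'|k v /= e|d v /= e]; rewrite /S /=.
  - by rewrite e e' addr0.
  - by rewrite e scaler0.
  - by rewrite e rep0r.
case: (irr _ (subrepI sU sS)) => [v []//|e|e].
  have : [set 0] (pair_rep rho1 rho2 c (u1, u2)).
    by rewrite -e; split; [exists c|rewrite /S /= cu1].
  by move=> /(congr1 snd) /= e2; rewrite e2 eqxx in cu2.
have : cyc (pair_rep rho1 rho2) (u1, u2) (u1, u2) := cyc_refl _ _.
by rewrite -e => -[_ /= e1]; rewrite (e1 : u1 = 0) eqxx in u10.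
Qed.

(** The map sends c u0 to c u; equality of the annihilators of [u0] and [u] makes it well defined
    and injective. *)
Lemma lowest_intertwiner (V0 V : lmodType C) (pi : rep B V0) (rho : rep B V) i u0 u al be ep :
  bounded pi -> bounded rho -> irreducible pi ->
  lowest E w y a b pi i u0 al be ep -> lowest E w y a b rho i u al be ep ->
  exists g : {linear V0 -> V}, injective g /\ forall c, g (pi c u0) = rho c u.
Proof.
move=> B0 BV ipi l0 lu.
have cycT v : exists c, v = pi c u0.
  have [_ _ /(_ _ (cyc_subrep pi u0))[//|e|e]] := ipi.
    have := cyc_refl pi u0; rewrite e => u00; have [] := l0.
    by rewrite (u00 : u0 = 0) eqxx.
  by have : setT v by []; rewrite -e.
have ann c c' : pi c u0 = pi c' u0 <-> rho c u = rho c' u.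
  have H (W : lmodType C) (sg : rep B W) z : sg c z = sg c' z <-> sg (c - c') z = 0.
    rewrite rep_actDl repNl; split=> [->|/eqP]; first by rewrite subrr.
    by rewrite subr_eq0 => /eqP.
  by split=> /H e; apply/H; [exact: lowest_ann l0 lu e|exact: lowest_ann lu l0 e].
have [f fE] := choice cycT.
have gE c : rho (f (pi c u0)) u = rho c u by apply/ann; rewrite -fE.
have [|g gf] := @linear_of_fun _ _ _ (fun v => rho (f v) u).
  move=> k v v'; have [[c ->] [c' ->]] := (cycT v, cycT v').
  have -> : k *: pi c u0 + pi c' u0 = pi (k%:S * c + c') u0.
    by rewrite rep_actDl repSl.
  by rewrite !gE rep_actDl repSl.
exists g; split=> [v v'|c]; last by rewrite gf gE.
have [[c ->] [c' ->]] := (cycT v, cycT v').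
by rewrite !gf !gE => /ann.
Qed.

(** Each irreducible summand contains a lowest vector, whose weights are those of [u0]; the
    intertwiner then identifies [V0] with the summand. *)
Lemma isotypical_of (V0 : lmodType C) (pi : rep B V0) i u0 al be ep
    (V : vectType C) (rho : rep B V) :
  bounded pi -> bounded rho -> irreducible pi -> lowest E w y a b pi i u0 al be ep ->
  (forall u al' be' ep', lowest E w y a b rho i u al' be' ep' ->
     [/\ al' = al, be' = be & ep' = ep]) ->
  completely_reducible rho -> isotypical pi rho.
Proof.
move=> B0 BV ipi l0 lV [m [W [iW /directv_sum_independent dW fW]]].
have [N [xN yN]] := BV.
have cycT v : exists c, v = pi c u0.
  have [_ _ /(_ _ (cyc_subrep pi u0))[//|e|e]] := ipi.
    have := cyc_refl pi u0; rewrite e => u00; have [] := l0.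
    by rewrite (u00 : u0 = 0) eqxx.
  by have : setT v by []; rewrite -e.
have Hg j : exists g : {linear V0 -> V}, [/\ injective g,
    forall c v, g (pi c v) = rho c (g v), forall v, g v \in W j &
    forall v, v \in W j -> exists v0, v = g v0].
  have [sW Wn0 Wmin] := iW j.
  have [v [vW v0]] : exists v, v \in W j /\ v != 0.
    apply: contrapT => H; apply: Wn0; apply/seteqP; split=> [v /= vW|v ->]; last exact: mem0v.
    by apply: contrapT => /eqP v0; apply: H; exists v.
  have [u [al' [be' [ep' [uW lu]]]]] := lowest_exists wd xN yN i sW vW v0.
  have [e1 e2 e3] := lV _ _ _ _ lu; rewrite {}e1 {}e2 {}e3 in lu.
  have [g [gI gE]] := lowest_intertwiner B0 BV ipi l0 lu.
  have uWc := cyc_sub sW uW.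
  exists g; split=> // [c v'|v'|v' v'W].
  - by have [d ->] := cycT v'; rewrite -rep_actM !gE rep_actM.
  - by have [d ->] := cycT v'; rewrite gE; apply: uWc; exists d.
  - case: (Wmin _ (cyc_subrep rho u) uWc) => [e|e].
      have := cyc_refl rho u; rewrite e => u00; have [] := lu.
      by rewrite (u00 : u = 0) eqxx.
    have : cyc rho u v' by rewrite e.
    by move=> [c ->]; exists (pi c u0).
have [g Hg'] := choice Hg.
have [|f fE] := @linear_of_fun _ {ffun 'I_m -> V0} V (fun p => \sum_j g j (p j)).
  move=> k p q; rewrite scaler_sumr -big_split; apply: eq_bigr => j _ /=.
  by rewrite !ffunE linearP.
exists m, f; split; last first.
  move=> c p; rewrite !fE rep_sumr; apply: eq_bigr => j _.
  by rewrite ffunE; have [_ -> _ _] := Hg' j.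
apply: bijective_of => [p q|v].
  move=> /eqP; rewrite -subr_eq0 -linearB fE => /eqP e.
  apply/ffunP => j; have [gI _ _ _] := Hg' j.
  apply/eqP; rewrite -subr_eq0; apply/eqP/gI; rewrite linear0.
  have := dW (fun j => g j ((p - q) j)) _ e j isT; rewrite !ffunE; apply.
  by move=> k _; have [_ _] := Hg' k.
have /memv_sumP[h hW ->] : v \in (\sum_(j < m) W j)%VS by rewrite fW memvf.
have Hh j : exists z, h j = g j z.
  by have [_ _ _] := Hg' j; apply; apply: hW.
have [z zE] := choice Hh; exists (finfun z); rewrite fE.
by apply: eq_bigr => j _; rewrite ffunE zE.
Qed.

End Compare.

(** * Finite-dimensional representations are bounded, hence completely reducible *)

(** The first dim Hom(V,V) + 1 powers of [Y] act by linearly dependent endomorphisms. *)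
Lemma fd_ker_pev (K : fieldType) (A : pzAlgType K) (V : vectType K) (rho : rep A V) (Y : A) :
  exists p, p != 0 /\ rep_ker rho (pev Y p).
Proof.
have HG k : exists g : {linear V -> V}, g =1 rho (Y ^+ k).
  by apply: linear_of_fun => c u v; rewrite rep_actDr repZ.
have [G GE] := choice HG.
pose d := dim 'Hom(V, V); pose X := [tuple linfun (G (k : nat)) | k < d.+1].
have : ~~ free X.
  apply/negP; rewrite /free => /eqP e.
  by have := dimvS (subvf <<X>>%VS); rewrite e size_tuple dimvf ltnn.
move/freeP => H.
have [k [k0 [i ki]]] : exists k : 'I_d.+1 -> K, \sum_i k i *: X`_i = 0 /\ exists i, k i != 0.
  apply: contrapT => N; apply: H => k k0 i; apply: contrapT => /eqP ki.
  by apply: N; exists k; split=> //; exists i.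
exists (\poly_(j < d.+1) k (inord j)); split.
  apply: contraNneq ki => /(congr1 (fun p : {poly K} => p`_i)).
  by rewrite coef_poly ltn_ord inord_val coef0 => ->.
move=> v; rewrite (pevEw _ (size_poly _ _)) rep_suml.
transitivity ((\sum_i k i *: X`_i) v); last by rewrite k0 lfunE.
rewrite sum_lfunE; apply: eq_bigr => j _.
by rewrite coef_poly ltn_ord inord_val scale_lfunE -tnth_nth tnth_mktuple lfunE /= GE repSl.
Qed.

Section Bounded.
Context (C : numClosedFieldType) (B : pzAlgType C) (r : nat) (E : 'I_r -> 'I_r -> B).
Context (L w x y : B).
Hypothesis cw : clifford_weyl E (4^-1) L w x y.

Lemma bounded_of_pev (V : lmodType C) (rho : rep B V) p :
  p != 0 -> rep_ker rho (pev (wt x y) p) -> bounded x y rho.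
Proof.
move=> p0 kp; have tI := rep_ker_ideal rho.
have h0 : 4^-1 + 4^-1 != 0 :> C by rewrite -mulr2n mulrn_eq0 /= invr_eq0 pnatr_eq0.
have [N1 H1] := ideal_nilpotent tI h0 p0 (wtx cw) kp.
have yY : y * wt x y = (wt x y - (- (4^-1 + 4^-1))%:S) * y.
  by rewrite rmorphN opprK; apply: (wty cw).
have h0' : - (4^-1 + 4^-1) != 0 :> C by rewrite oppr_eq0.
have [N2 H2] := ideal_nilpotent tI h0' p0 yY kp.
exists (N1 + N2)%N; split=> v; last by rewrite exprD rep_actM H2 rep0r.
by rewrite addnC exprD rep_actM H1 rep0r.
Qed.

Lemma fd_bounded (V : vectType C) (rho : rep B V) : bounded x y rho.
Proof. by have [p [p0 kp]] := fd_ker_pev rho (wt x y); apply: bounded_of_pev kp. Qed.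

Lemma fd_completely_reducible (i : 'I_r) (V : vectType C) (rho : rep B V) :
  completely_reducible rho.
Proof.
have wd := weight_data_of cw; have [N [xN yN]] := fd_bounded rho.
apply: generated_completely_reducible => P P0 PD PI v.
apply: (lowest_gen wd xN yN (i := i) (S := setT) _ P0 PD _ I) => // u al be ep _ lu.
by apply: (PI (cyc rho u)); apply: (lowest_irreducible wd yN lu).
Qed.

Lemma weights_scalar (lam : C) : L = lam%:S ->
  (wt x y + L * w) - (wt x y - L * w) = (lam *+ 2)%:S * w.
Proof. by move=> ->; rewrite opprB [LHS]addrC [LHS]addrA subrK -mulrDl -rmorphD. Qed.

End Bounded.

Lemma ideal_genE (K : comNzRingType) (A : pzAlgType K) (I : set A) a :
  two_sided_ideal I -> ideal_gen I a -> I a.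
Proof.
move=> [I0 ID IMl IMr]; elim=> [//|//|b c _ Ib _ Ic|b c d _ Ic].
  exact: ID.
exact/IMr/IMl.
Qed.

(** * Ideals studied through the representation on the quotient B/I *)

Section QuotientRep.
Context (K : comNzRingType) (A : pzAlgType K) (I : set A).

Definition quo_rep : rep A (regmod (algquot I)) :=
  @rep_pull K A (algquot I) _ (@aq_pi K A I) (@aq_piS K A I) (reg_rep (algquot I)).

Lemma quo_rep_pi a b : quo_rep a (aq_pi I b) = aq_pi I (a * b).
Proof. by rewrite (rmorphM (@aq_pi K A I)). Qed.

Lemma quo_rep_ker a : two_sided_ideal I -> rep_ker quo_rep a <-> I a.
Proof.
move=> tI; have pi0 b : aq_pi I b = 0 <-> I b.
  rewrite -[0](rmorph0 (@aq_pi K A I)) aq_piP subr0; split; first exact: ideal_genE.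
  exact: ideal_gen_in.
split=> [k|Ia v].
  by apply/pi0; have := k (aq_pi I 1); rewrite quo_rep_pi mulr1.
elim/aq_ind: v => b; rewrite quo_rep_pi; apply/pi0.
by case: tI => _ _ _; apply.
Qed.

End QuotientRep.

Lemma cycT_of_irreducible (K : comNzRingType) (A : pzAlgType K) (V : lmodType K)
  (pi : rep A V) u v : irreducible pi -> u != 0 -> cyc pi u v.
Proof.
move=> [_ _ /(_ _ (cyc_subrep pi u))[//|e|->//]] u0.
by have := cyc_refl pi u; rewrite e => /eqP; rewrite (negPf u0).
Qed.

Section Ideals.
Context (C : numClosedFieldType) (B : pzAlgType C) (r : nat) (E : 'I_r -> 'I_r -> B).
Context (lam : C) (w x y : B) (i : 'I_r).
Hypothesis cw : clifford_weyl E (4^-1) lam%:S w x y.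
Local Notation a := (wt x y + lam%:S * w).
Local Notation b := (wt x y - lam%:S * w).
Local Notation lowest := (lowest E w y a b).
Let wd := weight_data_of cw.

Lemma ideal_bounded (I : set B) z (V : lmodType C) (rho : rep B V) :
  two_sided_ideal I -> I z -> z != 0 -> I `<=` rep_ker rho -> bounded x y rho.
Proof.
move=> tI Iz z0 Ik; have natu n : n.+1%:R \is a @GRing.unit C by rewrite unitfE pnatr_eq0.
have [p [p0 Ip]] := ideal_pev cw natu tI Iz z0.
exact: (bounded_of_pev cw p0 (Ik _ Ip)).
Qed.

Lemma lowest_special (V : lmodType C) (rho : rep B V) u al be ep :
  bounded x y rho -> lowest rho i u al be ep ->
  exists m : nat, lam ^+ 2 = (m%:R / 2 + 4^-1) ^+ 2.
Proof.
move=> [N [xN yN]] lu.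
have [_ _ ee [m e]] := lowest_weights wd xN (weights_scalar w x y (erefl lam%:S)) lu.
by exists m; rewrite -e exprMn (expr2 ep) ee mulr1.
Qed.

(** The weights depend only on [ep], which is 1 or -1, and the positivity of lam ep decides
    which. *)
Lemma lowest_unique (V V' : lmodType C) (rho : rep B V) (rho' : rep B V') u u' al be ep al' be' ep' :
  bounded x y rho -> bounded x y rho' ->
  lowest rho i u al be ep -> lowest rho' i u' al' be' ep' ->
  [/\ al' = al, be' = be & ep' = ep].
Proof.
move=> [N [xN yN]] [N' [xN' yN']] lu lu'; have sc := weights_scalar w x y (erefl lam%:S).
have [-> -> ee [m e]] := lowest_weights wd xN sc lu.
have [-> -> ee' [m' e']] := lowest_weights wd xN' sc lu'.
have pos k : 0 < k%:R / 2 + 4^-1 :> C.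
  by rewrite ltr_wpDl ?mulr_ge0 ?invr_ge0 ?invr_gt0 ?ler0n ?ltr0n.
suff -> : ep' = ep by [].
have /eqP : (ep' - ep) * (ep' + ep) = 0.
  by rewrite -subr_sqr !expr2 ee ee' subrr.
rewrite mulf_eq0 subr_eq0 addr_eq0 => /orP[/eqP//|/eqP epN].
have := pos m'; rewrite -e' epN mulrN e oppr_gt0 => /(lt_trans (pos m)).
by rewrite ltxx.
Qed.

(** B/I is bounded; if it were nonzero it would contain a lowest vector, which such a [lam] does not
    allow. *)
Lemma ideal_total (I : set B) z : (forall m : nat, lam ^+ 2 <> (m%:R / 2 + 4^-1) ^+ 2) ->
  two_sided_ideal I -> I z -> z != 0 -> I = setT.
Proof.
move=> nlam tI Iz z0.
have kI a' := quo_rep_ker a' tI.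
have bQ := ideal_bounded tI Iz z0 (fun a' => (kI a').2).
have [N [xN yN]] := bQ.
suff I1 : I 1.
  by apply/seteqP; split=> // c _; have [_ _ IM _] := tI; rewrite -(mulr1 c); apply: IM.
apply/kI => v; rewrite rep1; apply: contrapT => /eqP v0.
have [|u [al [be [ep [_ lu]]]]] := lowest_exists wd xN yN i (S := setT) _ Logic.I v0; first by [].
have [m e] := lowest_special bQ lu.
exact: nlam e.
Qed.

Section Special.
Context (V0 : lmodType C) (pi : rep B V0) (u0 : V0) (al be ep : C).
Hypothesis bpi : bounded x y pi.
Hypothesis ipi : irreducible pi.
Hypothesis l0 : lowest pi i u0 al be ep.

(** If B/I is nonzero, it is generated by lowest vectors, all with the weights of [u0]. Hence B/I
    and [pi] have the same annihilator, and that of B/I is [I]. *)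
Lemma ideal_unique (I : set B) z : two_sided_ideal I -> I z -> z != 0 ->
  I = rep_ker pi \/ I = setT.
Proof.
move=> tI Iz z0; have kI a' := quo_rep_ker a' tI.
have bQ := ideal_bounded tI Iz z0 (fun a' => (kI a').2).
have [N [xN yN]] := bQ.
have lW u al' be' ep' (lu : lowest (quo_rep I) i u al' be' ep') : lowest (quo_rep I) i u al be ep.
  by have [<- <- <-] := lowest_unique bpi bQ l0 lu.
have [[v v0]|Q0] := pselect (exists v : regmod (algquot I), v != 0); last first.
  right; apply/seteqP; split=> // c _; apply/kI => v; apply: contrapT => /eqP v0.
  by apply: Q0; eexists; exact: v0.
left; apply/seteqP; split=> c.
  have [//|u [al' [be' [ep' [_ /lW lu]]]]] := lowest_exists wd xN yN i (S := setT) _ Logic.I v0.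
  move=> Ic v'; have [d ->] := cycT_of_irreducible v' ipi (let: And4 u00 _ _ _ := l0 in u00).
  rewrite -rep_actM; apply: (lowest_ann wd bQ bpi lu l0).
  by rewrite rep_actM; exact: ((kI c).2 Ic).
move=> kc; apply/kI => v'.
apply: (lowest_gen wd xN yN (i := i) (S := setT) (P := fun v => quo_rep I c v = 0) _ _ _ _ Logic.I) => //.
- exact: rep0r.
- by move=> u u' e e'; rewrite rep_actDr e e' addr0.
- move=> u al' be' ep' _ /lW lu _ [d ->]; rewrite -rep_actM.
  by apply: (lowest_ann wd bpi bQ l0 lu); rewrite rep_actM kc.
Qed.

End Special.

(** Some polynomial in Y kills [V0]; were its value zero in [B], every representation would be
    bounded, contrary to the existence of [rho]. *)
Lemma ker_nonzero (V0 : vectType C) (pi : rep B V0) (V : lmodType C) (rho : rep B V) :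
  ~ bounded x y rho -> exists z, rep_ker pi z /\ z != 0.
Proof.
move=> nb; have [p [p0 kp]] := fd_ker_pev pi (wt x y).
exists (pev (wt x y) p); split=> //; apply: contra_notN nb => /eqP e.
by apply: (bounded_of_pev cw p0) => v; rewrite e rep0l.
Qed.

Lemma unbounded_faithful (V : lmodType C) (rho : rep B V) :
  ~ bounded x y rho -> rep_ker rho = [set 0].
Proof.
move=> nb; apply/seteqP; split=> [z kz|z ->]; last exact: rep0l.
apply: contrapT => /eqP z0; apply: nb.
exact: (ideal_bounded (rep_ker_ideal rho) kz z0).
Qed.

End Ideals.

(** * Verma modules on C[X] and their truncations *)

Section Verma.
Context (C : numClosedFieldType) (o : option C) (l ep : C).
Hypothesis ep2 : ep * ep = 1.
Hypothesis ol : if o is Some lam then l = lam else True.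

(** With [x] acting as multiplication by X, the operator [y] sends X^k to c_k X^(k-1). The
    commutation relation gives c_(k+1) = c_k + 1/4 - (-1)^k l ep with c_0 = 0, of which this is the
    solution. *)
Definition verma_coef (k : nat) : C := k%:R / 4 - (if odd k then l * ep else 0).
Local Notation c := verma_coef.

Lemma verma_coef0 : c 0 = 0.
Proof. by rewrite /verma_coef mul0r subr0. Qed.

Lemma verma_coefS k : c k.+1 = c k + 4^-1 - (-1) ^+ k * (l * ep).
Proof.
rewrite /verma_coef -(natr1 k) mulrDl mul1r -(signr_odd _ k) /=.
by case: (odd k) => /=; [rewrite expr1|rewrite expr0]; ring.
Qed.

Definition verma_y (p : {poly C}) : {poly C} := \poly_(k < size p) (c k.+1 * p`_k.+1).
Definition verma_w (p : {poly C}) : {poly C} := \poly_(k < size p) (ep * (-1) ^+ k * p`_k).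

Lemma coef_verma_y p k : (verma_y p)`_k = c k.+1 * p`_k.+1.
Proof.
rewrite coef_poly; case: ltnP => // sp.
by rewrite nth_default ?mulr0 // (leq_trans sp).
Qed.
Lemma coef_verma_w p k : (verma_w p)`_k = ep * (-1) ^+ k * p`_k.
Proof. by rewrite coef_poly; case: ltnP => // sp; rewrite nth_default ?mulr0. Qed.

Fact verma_x_lin : linear (fun p : {poly C} => 'X * p).
Proof. by move=> k p q; rewrite mulrDr scalerAr. Qed.
Fact verma_y_lin : linear verma_y.
Proof.
by move=> k p q; apply/polyP => j; rewrite coefD coefZ !coef_verma_y coefD coefZ; ring.
Qed.
Fact verma_w_lin : linear verma_w.
Proof.
by move=> k p q; apply/polyP => j; rewrite coefD coefZ !coef_verma_w coefD coefZ; ring.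
Qed.

Lemma verma_rep : exists rho : rep (AO o 0) {poly C},
  [/\ rho (AO_p o 0) = ( *%R 'X), rho (AO_m o 0) = verma_y, rho (AO_w o ord0) = verma_w &
      forall v, rho (AO_L o 0) v = l *: v].
Proof.
pose X := Endo verma_x_lin; pose Y := Endo verma_y_lin; pose W := Endo verma_w_lin.
have [|||f [fS [fw fx fy fL]]] := @AO0_univ C o (endo {poly C}) l%:S W X Y.
- split; apply: endoP => p; apply/polyP => k.
  + rewrite [LHS]coefB [RHS]coefD.
    change (('X * verma_y p)`_k - (verma_y ('X * p))`_k
      = (- 4^-1 *: p)`_k + (l *: verma_w p)`_k).
    rewrite !coefZ coefXM coef_verma_w (coef_verma_y ('X * p)) coefXM /=.
    case: k => [|k] /=; first by rewrite verma_coefS verma_coef0 expr0; ring.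
    by rewrite coef_verma_y (verma_coefS k.+1); ring.
  + change ((verma_w (verma_w p))`_k = (1 *: p)`_k); rewrite scale1r.
    rewrite coef_verma_w coef_verma_w mulrA mulrACA ep2 -expr2 sqrr_sign !mul1r.
    by [].
  + change (('X * verma_w p)`_k = (- verma_w ('X * p))`_k).
    rewrite coefXM coefN (coef_verma_w ('X * p)) coefXM /=; case: k => [|k] /=.
      by rewrite mulr0 oppr0.
    by rewrite coef_verma_w exprS; ring.
  + change ((verma_y (verma_w p))`_k = (- verma_w (verma_y p))`_k).
    by rewrite (coef_verma_y (verma_w p)) coefN (coef_verma_w (verma_y p)) coef_verma_w coef_verma_y exprS; ring.
- by split; apply: scalC.
- by case: (o) ol => // lam ->.
exists (rep_of_morph fS); split; rewrite /= ?fw ?fx ?fy // => v.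
by rewrite fL.
Qed.

End Verma.

Lemma quotient_rep (K : comNzRingType) (A : pzAlgType K) (V W : lmodType K) (rho : rep A V)
    (f : {linear V -> W}) (s : W -> V) : cancel s f ->
  (forall a v, f v = 0 -> f (rho a v) = 0) ->
  exists rho' : rep A W, forall a v, rho' a (f v) = f (rho a v).
Proof.
move=> sK fk.
have fE a v : f (rho a (s (f v))) = f (rho a v).
  apply/eqP; rewrite -subr_eq0 -linearB -repNr -rep_actDr; apply/eqP/fk.
  by rewrite linearB sK subrr.
have H (u : W) : exists v, u = f v by exists (s u); rewrite sK.
pose act a u := f (rho a (s u)).
have aD a b u : act (a + b) u = act a u + act b u by rewrite /act rep_actDl linearD.
have aM a b u : act (a * b) u = act a (act b u) by rewrite /act fE rep_actM.
have aS k u : act k%:S u = k *: u by rewrite /act rep_actS linearZ /= sK.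
have aDr a u u' : act a (u + u') = act a u + act a u'.
  have [[v ->] [v' ->]] := (H u, H u').
  by rewrite /act !fE -(linearD f v) fE rep_actDr linearD.
exists (@Rep K A W act aD aDr aM aS) => a v /=; exact: fE.
Qed.

Section String.
Context (C : numClosedFieldType).

(** The features shared by a Verma module and its truncations: a lowest vector whose images under
    powers of [x] span the space. *)
Record string_rep (A : pzAlgType C) (L w x y : A) (V : lmodType C) (rho : rep A V)
    (v1 : V) (l ep : C) : Prop := StringRep {
  st_y : rho y v1 = 0;
  st_w : rho w v1 = ep *: v1;
  st_L : rho L v1 = l *: v1;
  st_yx : forall k, rho y (rho (x ^+ k.+1) v1) = verma_coef l ep k.+1 *: rho (x ^+ k) v1;
  st_gen : forall P : V -> Prop, P 0 -> (forall u v, P u -> P v -> P (u + v)) ->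
    (forall k z, P (z *: rho (x ^+ k) v1)) -> forall v, P v
}.

Context (o : option C) (l ep : C).
Hypothesis ep2 : ep * ep = 1.
Hypothesis ol : if o is Some lam then l = lam else True.
Local Notation string := (string_rep (AO_L o 0) (AO_w o ord0) (AO_p o 0) (AO_m o 0)).

Lemma verma_string_of (rho : rep (AO o 0) {poly C}) :
  rho (AO_p o 0) = ( *%R 'X) -> rho (AO_m o 0) = verma_y l ep ->
  rho (AO_w o ord0) = verma_w ep -> (forall v, rho (AO_L o 0) v = l *: v) ->
  string rho 1 l ep /\ forall k, rho (AO_p o 0 ^+ k) 1 = 'X^k.
Proof.
move=> rx ry rw rL; have xk k : rho (AO_p o 0 ^+ k) 1 = 'X^k.
  by elim: k => [|k IH]; rewrite ?expr0 ?rep1 // exprS rep_actM IH rx -exprS.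
split=> //; split=> [|||k|P P0 PD PZ v].
- rewrite ry; apply/polyP => k; rewrite coef_verma_y coef0 -polyC1 coefC /=.
  by rewrite mulr0.
- rewrite rw; apply/polyP => k; rewrite coef_verma_w coefZ -polyC1 coefC.
  by case: k => [|k] /=; rewrite ?expr0 ?mulr1 // !mulr0.
- exact: rL.
- rewrite !xk ry; apply/polyP => j; rewrite coef_verma_y coefZ !coefXn eqSS.
  by case: eqVneq => [->|]; rewrite ?mulr0.
- rewrite -[v]coefK poly_def; apply: (big_ind P) => // k _.
  by rewrite -xk.
Qed.

Lemma verma_string : exists rho : rep (AO o 0) {poly C}, exists v1,
  string rho v1 l ep /\ forall k, rho (AO_p o 0 ^+ k) v1 != 0.
Proof.
have [rho [rx ry rw rL]] := verma_rep ep2 ol.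
have [st xk] := verma_string_of rx ry rw rL.
by exists rho, 1; split=> // k; rewrite xk monic_neq0 ?monicXn.
Qed.

(** The conditions say that c_d = 0, so [y] sends X^d to 0 and the multiples of X^d form a
    submodule; the quotient keeps the first [d] coefficients. *)
Lemma truncated_string d : odd d -> l * ep = d%:R / 4 ->
  exists rho : rep (AO o 0) 'rV[C]_d, exists v1,
  string rho v1 l ep /\ forall k, (k < d)%N -> rho (AO_p o 0 ^+ k) v1 != 0.
Proof.
move=> od ld; have [rho [rx ry rw rL]] := verma_rep ep2 ol.
have cd : verma_coef l ep d = 0 by rewrite /verma_coef od ld subrr.
pose f : {linear {poly C} -> 'rV[C]_d} := @poly_rV C d.
have f0P p : f p = 0 <-> forall k, (k < d)%N -> p`_k = 0.
  split=> [/rowP e k kd|e]; last by apply/rowP => j; rewrite !mxE e.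
  by have := e (Ordinal kd); rewrite !mxE.
have [a v|rho' rE] := @quotient_rep _ _ _ _ rho f (@rVpoly C d) (@rVpolyK C d).
  move: a v; apply: (@AO_ind C o 0 (fun a => forall v, f v = 0 -> f (rho a v) = 0)).
  - by move=> k v e; rewrite rep_actS linearZ /= e scaler0.
  - move=> j v /f0P e; rewrite [j]ord1 rw; apply/f0P => k kd.
    by rewrite coef_verma_w e // mulr0.
  - move=> v /f0P e; rewrite rx; apply/f0P => k kd; rewrite coefXM.
    by case: k kd => [|k] //= kd; rewrite e // ltnW.
  - move=> v /f0P e; rewrite ry; apply/f0P => k kd; rewrite coef_verma_y.
    move: kd; rewrite leq_eqVlt => /orP[/eqP ->|kd]; first by rewrite cd mul0r.
    by rewrite e // mulr0.
  - by move=> v e; rewrite rL linearZ /= e scaler0.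
  - by move=> a b Ha Hb v e; rewrite rep_actDl linearD Ha // Hb // addr0.
  - by move=> a b Ha Hb v e; rewrite rep_actM Ha // Hb.
have [st xk] := verma_string_of rx ry rw rL.
exists rho', (f 1); split=> [|k kd]; last first.
  rewrite rE xk; apply/eqP => /f0P/(_ k kd)/eqP.
  by rewrite coefXn eqxx oner_eq0.
split=> [|||k|P P0 PD PZ v].
- by rewrite rE (st_y st) linear0.
- by rewrite rE (st_w st) linearZ.
- by rewrite rE (st_L st) linearZ.
- by rewrite !rE (st_yx st) linearZ.
- rewrite -[v](@rVpolyK C d) -/f.
  apply: (st_gen st (P := fun p => P (f p))) => [|p q|k z].
  + by rewrite linear0.
  + by rewrite linearD; apply: PD.
  + by rewrite linearZ /= -rE.
Qed.

End String.

(** * Carrying strings and relations from level 0 to level n *)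

Section MatrixRep.
Context (K : comNzRingType) (A : pzAlgType K) (r : nat) (V : lmodType K) (rho : rep A V).

Definition mx_act (M : 'M[A]_r) (f : {ffun 'I_r -> V}) : {ffun 'I_r -> V} :=
  [ffun i => \sum_j rho (M i j) (f j)].

Definition mx_rep : rep 'M[A]_r {ffun 'I_r -> V}.
Proof.
apply: (@Rep _ _ _ mx_act) => [M N f|M f g|M N f|k f]; apply/ffunP => i; rewrite !ffunE.
- by rewrite -big_split; apply: eq_bigr => j _; rewrite mxE rep_actDl.
- by rewrite -big_split; apply: eq_bigr => j _; rewrite ffunE rep_actDr.
- under eq_bigr do rewrite mxE rep_suml.
  rewrite exchange_big; apply: eq_bigr => j _; rewrite ffunE rep_sumr.
  by apply: eq_bigr => l _; rewrite rep_actM.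
- rewrite (bigD1 i) //= big1 ?addr0 => [|j /negPf ji]; rewrite mxE.
    by rewrite eqxx mulr1n rep_actS.
  by rewrite eq_sym ji mulr0n rep0l.
Defined.

Lemma mx_rep_delta i j f : mx_rep (kron (delta_mx i j) 1) f = [ffun k => if k == i then f j else 0].
Proof.
apply/ffunP => k; rewrite !ffunE (bigD1 j) //= big1 ?addr0 => [|l /negPf lj]; rewrite !mxE.
  by rewrite eqxx andbT mulr1; case: eqP => _; rewrite ?rmorph1 ?rep1 // rmorph0 rep0l.
by rewrite lj andbF rmorph0 mul0r rep0l.
Qed.

Lemma mx_rep_kron1 a f : mx_rep (kron 1%:M a) f = [ffun k => rho a (f k)].
Proof.
apply/ffunP => k; rewrite !ffunE (bigD1 k) //= big1 ?addr0 => [|l /negPf lj]; rewrite !mxE.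
  by rewrite eqxx mulr1n rmorph1 mul1r.
by rewrite eq_sym lj rmorph0 mul0r rep0l.
Qed.

End MatrixRep.

Section Transport.
Context (K : comNzRingType) (B B' : pzAlgType K) (f : {rmorphism B -> B'}).
Hypothesis fS : alg_morph f.
Hypothesis fb : bijective f.

Lemma clifford_weyl_transport r (E' : 'I_r -> 'I_r -> B') q L' w' x' y' :
  clifford_weyl E' q L' w' x' y' ->
  exists E L w x y, clifford_weyl E q L w x y /\
    [/\ forall i j, f (E i j) = E' i j, f L = L', f w = w', f x = x' & f y = y'].
Proof.
case: (fb) => g fK gK; case=> [[EM E1] Ew Ex Ey EL Lw Lx Ly q4 ww xw yw xy ind].
exists (fun i j => g (E' i j)), (g L'), (g w'), (g x'), (g y'); split; last by split=> *; apply: gK.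
have gM a b : g a * g b = g (a * b) by apply: (can_inj fK); rewrite rmorphM !gK.
have gD a b : g a + g b = g (a + b) by apply: (can_inj fK); rewrite rmorphD !gK.
have gN a : - g a = g (- a) by apply: (can_inj fK); rewrite rmorphN !gK.
have gS k : g k%:S = k%:S by apply: (can_inj fK); rewrite fS gK.
split; rewrite ?gM ?gN ?gD //.
- split=> [i j k l|].
    by rewrite gM EM; case: eqP => // _; apply: (can_inj fK); rewrite gK rmorph0.
  by apply: (can_inj fK); rewrite rmorph_sum rmorph1 -E1; apply: eq_bigr => i _; rewrite gK.
- by move=> i j; rewrite !gM Ew.
- by move=> i j; rewrite !gM Ex.
- by move=> i j; rewrite !gM Ey.
- by move=> i j; rewrite !gM EL.
- by rewrite Lw.
- by rewrite Lx.
- by rewrite Ly.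
- by apply: (can_inj fK); rewrite gK rmorph1.
- by rewrite xw.
- by rewrite yw.
- by rewrite xy -gD -gN gS.
move=> P PS PE Pw Px Py PL PD PM b; rewrite -(fK b).
apply: (ind (fun b => P (g b))) => // [k|c d Pc Pd|c d Pc Pd].
- by rewrite gS.
- by rewrite -gD; apply: PD.
- by rewrite -gM; apply: PM.
Qed.
End Transport.

Section ReducedData.
Context (C : numClosedFieldType) (o : option C).

Lemma clifford_weyl_mx r : clifford_weyl (fun i j : 'I_r => kron (delta_mx i j) (1 : AO o 0))
  (4^-1) (kron 1%:M (AO_L o 0)) (kron 1%:M (AO_w o ord0))
  (kron 1%:M (AO_p o 0)) (kron 1%:M (AO_m o 0)).
Proof.
have [dE ww xw yw] := AO0_data o; have [Lw Lx Ly] := AO0_central o.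
have EC i j a : kron (delta_mx i j) 1 * kron 1%:M a = kron 1%:M a * kron (delta_mx i j) 1 :> 'M[AO o 0]_r.
  by rewrite !kronM mulmx1 mul1mx mul1r mulr1.
pose g : {rmorphism AO o 0 -> 'M[AO o 0]_r} := kron 1%:M.
have gM a b : kron 1%:M a * kron 1%:M b = kron 1%:M (a * b) :> 'M[AO o 0]_r := esym (rmorphM g a b).
split=> //.
- exact: matrix_units_delta.
- by rewrite !gM Lw.
- by rewrite !gM Lx.
- by rewrite !gM Ly.
- by rewrite -[LHS]mulr_natr mulVf // pnatr_eq0.
- by rewrite gM ww kron11.
- by rewrite !gM xw kronNr.
- by rewrite !gM yw kronNr.
- by rewrite !gM -[LHS](raddfB (kron 1%:M)) /= dE kronDr kron1S rmorphN.
move=> P PS PE Pw Px Py PL PD PM M.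
have P0 : P 0 by have := PS 0; rewrite rmorph0.
rewrite (kron_sum_delta M); apply: (big_ind P) => // i _; apply: (big_ind P) => // j _.
have -> : kron (delta_mx i j) (M i j) = kron (delta_mx i j) 1 * kron 1%:M (M i j).
  by rewrite kronM mulmx1 mul1r.
apply: (PM) => //; move: (M i j); apply: (@AO_ind C o 0 (fun a => P (kron 1%:M a))) => //.
- by move=> k; rewrite kron1S.
- by move=> k; rewrite [k]ord1.
- by move=> a b Pa Pb; rewrite kronDr; apply: PD.
- by move=> a b Pa Pb; rewrite -gM; apply: PM.
Qed.

End ReducedData.

Section CyclicString.
Context (C : numClosedFieldType) (r : nat) (i : 'I_r).

Record cyclic_string (B : pzAlgType C) (E : 'I_r -> 'I_r -> B) (L w x y : B)
    (V : lmodType C) (rho : rep B V) (u : V) (l ep : C) : Prop := CyclicString {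
  cs_E : rho (E i i) u = u;
  cs_y : rho y u = 0;
  cs_w : rho w u = ep *: u;
  cs_L : rho L u = l *: u;
  cs_yx : forall k, rho y (rho (x ^+ k.+1) u) = verma_coef l ep k.+1 *: rho (x ^+ k) u;
  cs_cyc : forall v, cyc rho u v
}.

Lemma cyclic_string_mx (A : pzAlgType C) (L w x y : A) (V : lmodType C) (rho : rep A V) v1 l ep :
  string_rep L w x y rho v1 l ep ->
  exists u, cyclic_string (fun i j => kron (delta_mx i j) 1) (kron 1%:M L) (kron 1%:M w)
    (kron 1%:M x) (kron 1%:M y) (mx_rep r rho) u l ep /\
    forall k, (mx_rep r rho (kron 1%:M x ^+ k) u == 0) = (rho (x ^+ k) v1 == 0).
Proof.
move=> st; pose s (v : V) : {ffun 'I_r -> V} := [ffun k => if k == i then v else 0].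
have sE a v : mx_rep r rho (kron 1%:M a) (s v) = s (rho a v).
  by rewrite mx_rep_kron1; apply/ffunP => k; rewrite !ffunE; case: eqP; rewrite ?rep0r.
have sZ c v : s (c *: v) = c *: s v.
  by apply/ffunP => k; rewrite !ffunE; case: eqP; rewrite ?scaler0.
have xk k : mx_rep r rho (kron 1%:M x ^+ k) (s v1) = s (rho (x ^+ k) v1).
  elim: k => [|k IH]; first by rewrite !expr0 !rep1.
  by rewrite !exprS !rep_actM IH sE.
have s0 : s 0 = 0 by apply/ffunP => k; rewrite !ffunE; case: eqP.
exists (s v1); split=> [|k]; last first.
  rewrite xk; apply/eqP/eqP => [/ffunP/(_ i)|->//]; by rewrite !ffunE eqxx.
split=> [||||k|f].
- by rewrite mx_rep_delta; apply/ffunP => k; rewrite !ffunE eqxx.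
- by rewrite sE (st_y st).
- by rewrite sE (st_w st).
- by rewrite sE (st_L st).
- by rewrite !xk sE (st_yx st).
have [S0 SD SZ SA] := cyc_subrep (mx_rep r rho) (s v1).
have H v : cyc (mx_rep r rho) (s v1) (s v).
  move: v; apply: (st_gen st) => [|v v'|k z].
  - by rewrite s0.
  - have -> : s (v + v') = s v + s v'.
      by apply/ffunP => k; rewrite !ffunE; case: eqP; rewrite ?addr0.
    exact: SD.
  - by rewrite sZ; apply: SZ; exists (kron 1%:M x ^+ k); rewrite xk.
have -> : f = \sum_j mx_rep r rho (kron (delta_mx j i) 1) (s (f j)).
  apply/ffunP => k; rewrite sum_ffunE (bigD1 k isT) mx_rep_delta !ffunE !eqxx.
  rewrite big1 => [|j /negPf jk]; first by rewrite /= addr0.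
  by rewrite mx_rep_delta ffunE eq_sym jk.
by apply: (big_ind (cyc (mx_rep r rho) (s v1))) => // j _; apply/SA/H.
Qed.

Lemma cyclic_string_pull (B B' : pzAlgType C) (f : {rmorphism B -> B'}) (fS : alg_morph f)
    E L w x y E' L' w' x' y' (V : lmodType C) (rho : rep B' V) u l ep :
  bijective f -> (forall i j, f (E i j) = E' i j) -> f L = L' -> f w = w' -> f x = x' -> f y = y' ->
  cyclic_string E' L' w' x' y' rho u l ep -> cyclic_string E L w x y (rep_pull fS rho) u l ep.
Proof.
move=> [g fK gK] fE fL fw fx fy [cE cy cw cL cyx cc]; split=> [||||k|v] /=.
- by rewrite fE.
- by rewrite fy.
- by rewrite fw.
- by rewrite fL.
- by rewrite !rmorphXn /= fx fy.
by have [c ->] := cc v; exists (g c); rewrite /= gK.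
Qed.

End CyclicString.

(** All that is used later of the reduction to level 0: the abstract relations hold in level n, and
    each string at level 0 lifts to a cyclic representation with the same vanishing of powers of
    [x]. *)
Lemma AO_weyl (C : numClosedFieldType) (o : option C) n (i : 'I_(2 ^ n)) :
  exists E L w x y, [/\ clifford_weyl E (4^-1) L w x y,
    o <> None -> L = AO_L o n &
    forall (V : lmodType C) (rho0 : rep (AO o 0) V) v1 l ep,
      string_rep (AO_L o 0) (AO_w o ord0) (AO_p o 0) (AO_m o 0) rho0 v1 l ep ->
    exists rho : rep (AO o n) {ffun 'I_(2 ^ n) -> V}, exists u,
      cyclic_string i E L w x y rho u l ep /\
      forall k, (rho (x ^+ k) u == 0) = (rho0 (AO_p o 0 ^+ k) v1 == 0)].
Proof.
have [f [fS fb]] := AO_reduce o n.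
have [E [L [w [x [y [cw [fE fL fw fx fy]]]]]]] :=
  clifford_weyl_transport fS fb (clifford_weyl_mx o (2 ^ n)).
exists E, L, w, x, y; split=> //.
  move=> oN; case: (fb) => g fK _; apply: (can_inj fK); rewrite fL.
  by apply/esym; move: fS oN; clear; case: o f => // lam f fS _; rewrite /= kron1S fS.
move=> V rho0 v1 l ep st; have [u [cs xk]] := cyclic_string_mx i st.
exists (rep_pull fS (mx_rep _ rho0)), u; split; last by move=> k; rewrite -xk /= rmorphXn /= fx.
exact: cyclic_string_pull cs.
Qed.

(** * Weights and irreducibility of the lifted strings *)

Section CyclicStringTheory.
Context (C : numClosedFieldType) (B : pzAlgType C) (r : nat) (E : 'I_r -> 'I_r -> B).
Context (L w x y : B) (i : 'I_r).
Hypothesis cw : clifford_weyl E (4^-1) L w x y.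
Context (V : lmodType C) (rho : rep B V) (u : V) (l ep : C).
Hypothesis cs : cyclic_string i E L w x y rho u l ep.
Hypothesis u0 : u != 0.
Local Notation c := (verma_coef l ep).
Let wd := weight_data_of cw.

Lemma cyclic_string_wt k : rho (wt x y) (rho (x ^+ k) u) = (c k + c k.+1) *: rho (x ^+ k) u.
Proof.
rewrite /wt rep_actDl !rep_actM -[rho x (rho _ u)]rep_actM -exprS (cs_yx cs) [RHS]scalerDl.
congr (_ + _); case: k => [|k]; last by rewrite (cs_yx cs) repZ -rep_actM -exprS.
by rewrite expr0 rep1 (cs_y cs) rep0r verma_coef0 scale0r.
Qed.

Lemma cyclic_string_lowest :
  lowest E w y (wt x y + L * w) (wt x y - L * w) rho i u (4^-1) (4^-1 - l *+ 2 * ep) ep.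
Proof.
have := cyclic_string_wt 0; rewrite expr0 rep1 => wu.
have Lw : rho (L * w) u = (l * ep) *: u.
  by rewrite rep_actM (cs_w cs) repZ (cs_L cs) scalerA mulrC.
split; [by []| |exact: (cs_y cs)|exact: (cs_E cs)].
split; last exact: (cs_w cs).
  rewrite rep_actDl wu Lw -scalerDl; congr (_ *: _).
  by rewrite verma_coefS verma_coef0 expr0; ring.
rewrite rep_actDl repNl wu Lw -scalerBl; congr (_ *: _).
by rewrite verma_coefS verma_coef0 expr0; ring.
Qed.

End CyclicStringTheory.

Section CyclicStringIrreducible.
Context (C : numClosedFieldType) (B : pzAlgType C) (r : nat) (E : 'I_r -> 'I_r -> B).
Context (L w x y : B) (i : 'I_r).
Hypothesis cw : clifford_weyl E (4^-1) L w x y.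
Context (V : lmodType C) (rho : rep B V) (u : V) (l ep : C).
Hypothesis cs : cyclic_string i E L w x y rho u l ep.
Hypothesis u0 : u != 0.
Let wd := weight_data_of cw.

Let cycT : cyc rho u = setT.
Proof. by apply/seteqP; split=> // v _; apply: (cs_cyc cs). Qed.

Lemma cyclic_string_bounded_irreducible : bounded x y rho -> irreducible rho.
Proof.
move=> [N [xN yN]]; rewrite /irreducible -cycT.
exact: (lowest_irreducible wd yN (cyclic_string_lowest cs u0)).
Qed.

Lemma cyclic_string_generic_irreducible :
  (forall k, rho (x ^+ k) u != 0) -> (forall k, verma_coef l ep k.+1 != 0) -> irreducible rho.
Proof.
move=> xk ck; rewrite /irreducible -cycT; have [_ j yu Eu] := cyclic_string_lowest cs u0.
apply: (cyc_irreducible wd j yu Eu) => // k al be e jk _.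
have : rho y (rho x (rho (x ^+ k) u)) != 0.
  by rewrite -rep_actM -rep_actM -mulrA -exprS rep_actM (cs_yx cs) scaler_eq0 negb_or ck xk.
apply: contraNneq => be0; rewrite (rep_yx wd jk) be0 mulr0 scale0r.
by [].
Qed.

End CyclicStringIrreducible.

(** * Ideals and finite-dimensional representations of A_lambda(n) *)

Section Lambda.
Context (C : numClosedFieldType) (n : nat) (lam : C).
Local Notation A := (AO (Some lam) n).

Lemma pos_pow2 : (0 < 2 ^ n)%N. Proof. by rewrite expn_gt0. Qed.
Let i : 'I_(2 ^ n) := Ordinal pos_pow2.

Lemma unbounded_of_pow (B : pzAlgType C) (V : lmodType C) (rho : rep B V) x y u :
  (forall k, rho (x ^+ k) u != 0) -> ~ bounded x y rho.
Proof. by move=> xk [N [xN _]]; have := xk N; rewrite xN eqxx. Qed.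

Lemma A_lambda_simple : (forall m : nat, lam ^+ 2 <> (m%:R / 2 + 4^-1) ^+ 2) -> simple_alg A.
Proof.
move=> nlam; have [E [L [w [x [y [cw LE lift]]]]]] := AO_weyl (Some lam) i.
have {LE} LE : L = lam%:S by apply: LE.
(* A nonzero representation is what guarantees 1 <> 0 in the presented algebra. *)
have [rho0 [v1 [st xk0]]] := @verma_string C (Some lam) lam 1 (mulr1 1) erefl.
have [rho [u [cs xk]]] := lift _ _ _ _ _ st.
split=> [e|I tI].
  have := xk0 0%N; rewrite -xk expr0 e rep0l; apply/negP; rewrite negbK; exact: eqxx.
have [[z [Iz z0]]|H] := pselect (exists z, I z /\ z != 0).
  right; rewrite LE in cw; exact: (ideal_total i cw nlam tI Iz z0).
left; apply/seteqP; split=> [z Iz|z ->]; last by case: tI.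
by apply: contrapT => /eqP z0; apply: H; exists z.
Qed.

Lemma A_lambda_completely_reducible (V : vectType C) (rho : rep A V) : completely_reducible rho.
Proof.
have [E [L [w [x [y [cw _ _]]]]]] := AO_weyl (Some lam) i.
exact: (fd_completely_reducible cw i rho).
Qed.

Lemma A_lambda_special (m : nat) : lam ^+ 2 = (m%:R / 2 + 4^-1) ^+ 2 ->
  primitive_alg A /\
  exists (V0 : vectType C) (pi : rep A V0),
    [/\ irreducible pi, \dim {:V0} = (2 ^ n * m.*2.+1)%N,
        forall I : set A, nonzero_proper_ideal I <-> I = rep_ker pi &
        forall (V : vectType C) (rho : rep A V), isotypical pi rho].
Proof.
move=> lam2; have dE : m%:R / 2 + 4^-1 = m.*2.+1%:R / 4 :> C.
  have -> : m.*2.+1%:R = m%:R * 2 + 1 :> C by rewrite -(natr1 m.*2) -muln2 natrM.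
  by field.
(* The sign [s] satisfies lam s = h + 1/4 with h = m/2. It will give the finite-dimensional
   representation, and -s the faithful one. *)
have [s [s2 ls]] : exists s : C, s * s = 1 /\ lam * s = m.*2.+1%:R / 4.
  move/eqP: lam2; rewrite eqf_sqr dE => /orP[/eqP ->|/eqP ->].
    by exists 1; rewrite !mulr1.
  by exists (-1); rewrite !mulrNN !mulr1.
have [E [L [w [x [y [cw LE lift]]]]]] := AO_weyl (Some lam) i.
have {LE} LE : L = lam%:S by apply: LE.
rewrite LE in cw.
have sN2 : - s * - s = 1 by rewrite mulrNN.
(* For the sign -s all coefficients c_(k+1) are nonzero, so the Verma module is irreducible; no
   power of [x] kills its lowest vector, so it is unbounded and hence faithful. *)
have [rho0 [v1 [st xk0]]] := @verma_string C (Some lam) lam (- s) sN2 erefl.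
have [rho [u [cs xk]]] := lift _ _ _ _ _ st; rewrite LE in cs.
have {}xk k : rho (x ^+ k) u != 0 by rewrite xk.
have nb := @unbounded_of_pow _ _ rho x y u xk.
have u0 : u != 0 by have := xk 0%N; rewrite expr0 rep1.
split.
  exists {ffun 'I_(2 ^ n) -> {poly C}}, rho; split.
    apply: (cyclic_string_generic_irreducible cw cs u0 xk) => k.
    rewrite /verma_coef mulrN ls; case: ifP => _; rewrite ?opprK ?subr0.
      by rewrite -mulrDl mulf_neq0 ?invr_eq0 ?pnatr_eq0 // -natrD pnatr_eq0.
    by rewrite mulf_neq0 ?invr_eq0 ?pnatr_eq0.
  exact: (unbounded_faithful cw nb).
have od : odd (m.*2.+1) by rewrite /= odd_double.
(* For the sign [s] the coefficient with index 2m + 1 vanishes, which yields pi_h of dimension 2m +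
   1 = 4h + 1 at level 0. *)
have [pi0 [v [stv xv]]] := @truncated_string C (Some lam) lam s s2 erefl _ od ls.
have [pi [u' [csv xu]]] := lift _ _ _ _ _ stv; rewrite LE in csv.
pose V0 : vectType C := {ffun 'I_(2 ^ n) -> 'rV[C]_(m.*2.+1)}.
have bpi : bounded x y pi := @fd_bounded _ _ _ _ _ _ _ _ cw V0 pi.
have u'0 : u' != 0 by rewrite -(rep1 pi u') -(expr0 x) xu xv.
have l0 := cyclic_string_lowest csv u'0.
have ipi := cyclic_string_bounded_irreducible cw csv u'0 bpi.
exists V0, pi; split=> //.
- by rewrite dimvf /dim /= card_ord /dim /= mul1n.
- move=> I; split=> [[tI In0 InT]|->].
    have [z [Iz z0]] : exists z, I z /\ z != 0.
      apply: contrapT => H; apply: In0; apply/seteqP; split=> [z Iz|z ->]; last by case: tI.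
      by apply: contrapT => /eqP z0; apply: H; exists z.
    by have [|/InT] := ideal_unique cw bpi ipi l0 tI Iz z0.
  split; first exact: rep_ker_ideal.
    have [z [kz /eqP z0]] := @ker_nonzero _ _ _ _ _ _ _ _ cw V0 pi _ rho nb.
    by move=> e; apply: z0; have : [set 0] z by rewrite -e.
  move=> e; have : rep_ker pi 1 by rewrite e.
  by move/(_ u'); rewrite rep1 => e'; rewrite e' eqxx in u'0.
move=> V sg; have bsg := fd_bounded cw sg.
apply: (isotypical_of (weight_data_of cw) bpi bsg ipi l0); last exact: (fd_completely_reducible cw i).
by move=> u2 al be ep lu; exact: (lowest_unique cw bpi bsg l0 lu).
Qed.

End Lambda.

(** * A_Lambda(n) over C[Lambda], and separation by finite-dimensional representations *)

Section PolyAlgebra.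
Context (K : comNzRingType) (A : pzAlgType K) (L : A).
Hypothesis Lcentral : forall a, L * a = a * L.

(** The same ring with scalars C[L]: the parameter becomes the scalar ['X], as [ideal_pev] requires.
    The centrality proof is an argument so that the type determines this algebra structure. *)
Definition poly_alg of (forall a, L * a = a * L) : Type := A.
Local Notation PA := (poly_alg Lcentral).
HB.instance Definition _ := GRing.PzRing.on PA.

Definition poly_scal (p : {poly K}) : PA := pev L p.
Fact poly_scal_zmod : zmod_morphism poly_scal.
Proof. exact: pev_zmod. Qed.
Fact poly_scal_monoid : monoid_morphism poly_scal.
Proof. exact: pev_monoid. Qed.
Fact poly_scalC p (a : PA) : poly_scal p * a = a * poly_scal p.
Proof. exact: esym (pev_intertwine p (esym (Lcentral a))). Qed.
HB.instance Definition _ := PzRing_isPzAlgebra.Build {poly K} PA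
  poly_scal_zmod poly_scal_monoid poly_scalC.

Lemma clifford_weyl_poly r (E : 'I_r -> 'I_r -> A) q (w x y : A) :
  clifford_weyl E q L w x y ->
  @clifford_weyl {poly K} PA r E q%:P ('X%:S : PA) w x y.
Proof.
have -> : ('X%:S : PA) = L by apply: (pevX L).
case=> EU Ew Ex Ey EL Lw Lx Ly q4 ww xw yw xy ind; split=> //.
- by rewrite -rmorphMn q4.
- by rewrite xy; congr (- _ + _); apply: esym (pevC L q).
move=> P PS PE Pw Px Py PL PD PM; apply: ind => // k.
by rewrite -(pevC L); apply: PS.
Qed.

End PolyAlgebra.

Lemma rep_pev_eig (K : comNzRingType) (A : pzAlgType K) (V : lmodType K) (rho : rep A V) b v k p :
  rho b v = k *: v -> rho (pev b p) v = p.[k] *: v.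
Proof.
move=> bv; elim/poly_ind: p => [|p c IH]; first by rewrite raddf0 rep0l horner0 scale0r.
rewrite raddfD /= pevMX pevC rep_actDl rep_actS rep_actM bv repZ IH.
by rewrite !hornerE scalerDl scalerA mulrC.
Qed.

Lemma infinite_roots (R : idomainType) (p : {poly R}) (f : nat -> R) :
  injective f -> (forall k, p.[f k] = 0) -> p = 0.
Proof.
move=> fI pf; apply: contrapT => /eqP p0.
have H : all (root p) (map f (iota 0 (size p))).
  by apply/allP => z /mapP[k _ ->]; apply/rootP.
have := max_poly_roots p0 H.
by rewrite map_inj_uniq // iota_uniq size_map size_iota ltnn => /(_ isT).
Qed.

Lemma rep_pow_eig (K : comNzRingType) (A : pzAlgType K) (V : lmodType K) (rho : rep A V) b v k j :
  rho b v = k *: v -> rho (b ^+ j) v = k ^+ j *: v.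
Proof.
move=> bv; elim: j => [|j IH]; first by rewrite !expr0 rep1 scale1r.
by rewrite !exprS rep_actM IH repZ bv scalerA mulrC.
Qed.

Section Separation.
Context (C : numClosedFieldType) (B : pzAlgType C) (r : nat) (E : 'I_r -> 'I_r -> B).
Context (L w x y : B) (i : 'I_r).
Hypothesis cw : clifford_weyl E (4^-1) L w x y.

Lemma clifford_weyl_central a : L * a = a * L.
Proof.
move: a; apply: (cw_ind cw) => [k|j k|||||a b La Lb|a b La Lb].
- by rewrite scalC.
- by rewrite (cwEL cw).
- exact: (cwLw cw).
- exact: (cwLx cw).
- exact: (cwLy cw).
- by [].
- by rewrite mulrDl mulrDr La Lb.
- by rewrite mulrA La -mulrA Lb mulrA.
Qed.

(** The common kernel is an ideal; if nonzero, it contains p(L, Y) for some nonzero polynomial p in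
    two variables. Evaluating on the string with parameter l = d/4 and sign 1 gives zeros of p at
    all points (l, k/2 + 1/4 - l) with k < d, too many for p to be nonzero. *)
Lemma fd_separated z :
  (forall d, odd d -> exists (V : vectType C) (rho : rep B V) u,
     cyclic_string i E L w x y rho u (d%:R / 4) 1 /\
     forall k, (k < d)%N -> rho (x ^+ k) u != 0) ->
  (forall (V : vectType C) (rho : rep B V), rep_ker rho z) -> z = 0.
Proof.
move=> strings; pose Z : set B := [set z | forall (V : vectType C) (rho : rep B V), rep_ker rho z].
have tZ : two_sided_ideal Z.
  split=> [V rho|a b Za Zb V rho|a b Zb V rho|a b Zb V rho].
  - by case: (rep_ker_ideal rho).
  - by case: (rep_ker_ideal rho) => _ + _ _; apply; [apply: Za|apply: Zb].
  - by case: (rep_ker_ideal rho) => _ _ + _; apply; apply: Zb.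
  - by case: (rep_ker_ideal rho) => _ _ _; apply; apply: Zb.
move=> Zz; apply: contrapT => /eqP z0.
have natu k : k.+1%:R \is a @GRing.unit {poly C}.
  by rewrite -polyC_natr poly_unitE size_polyC pnatr_eq0 coefC /= unitfE pnatr_eq0.
have [p [p0 Zp]] := ideal_pev (clifford_weyl_poly clifford_weyl_central cw) natu tZ (Zz : Z z) z0.
have h0 : (2 : C) != 0 by rewrite pnatr_eq0.
have q0 : (4 : C) != 0 by rewrite pnatr_eq0.
(* The root tried in C[L] is k/2 + 1/4 - L, the eigenvalue c_k + c_(k+1) of Y on x^k u, whatever the
   parity of k. That the value of p there is zero is in turn shown at infinitely many values of
   L. *)
case/eqP: p0; apply: (@infinite_roots _ _ (fun k => (k%:R / 2 + 4^-1)%:P - 'X)).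
  by move=> k j /addIr/polyC_inj/addIr/(mulIf (invr_neq0 h0))/eqP; rewrite eqr_nat => /eqP.
move=> k; apply: (@infinite_roots _ _ (fun j => (j + k).*2.+1%:R / 4)).
  move=> j j' /(mulIf (invr_neq0 q0))/eqP; rewrite eqr_nat => /eqP[] /double_inj.
  exact: addIn.
(* This d is odd, and larger than k, so that x^k u is nonzero in the truncated module. *)
move=> j; set d := (j + k).*2.+1; set l := d%:R / 4.
have od : odd d by rewrite /= odd_double.
have [V [rho [u [cs xu]]]] := strings d od.
have kd : (k < d)%N by rewrite ltnS -addnn addnAC leq_addl.
have xk0 : rho (x ^+ k) u != 0 by apply: xu.
have := Zp V rho (rho (x ^+ k) u).
have Lk : rho L (rho (x ^+ k) u) = l *: rho (x ^+ k) u.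
  by rewrite -rep_actM clifford_weyl_central rep_actM (cs_L cs) repZ.
have Yk := cyclic_string_wt cs k.
have pE : pev (wt (x : poly_alg clifford_weyl_central) y) p = \sum_(j < size p) pev L p`_j * wt x y ^+ j by [].
rewrite pE rep_suml.
under eq_bigr do rewrite rep_actM (rep_pow_eig _ Yk) repZ (rep_pev_eig _ Lk) scalerA.
rewrite -scaler_suml => /eqP; rewrite scaler_eq0 (negPf xk0) orbF => /eqP <-.
rewrite (horner_coef p) horner_sum; apply: eq_bigr => a _.
rewrite hornerM horner_exp mulrC; congr (_ ^+ _ * _).
rewrite hornerD hornerN hornerC hornerX verma_coefS /verma_coef mulr1 -(signr_odd _ k) -/l.
by case: (odd k) => /=; rewrite ?expr1 ?expr0; field.
Qed.

End Separation.

Lemma A_Lambda_FCR (C : numClosedFieldType) n : FCR (AO (None : option C) n).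
Proof.
pose i : 'I_(2 ^ n) := Ordinal (pos_pow2 n).
have [E [L [w [x [y [cw _ lift]]]]]] := AO_weyl (None : option C) i.
split=> [V rho|z Zz]; first exact: (fd_completely_reducible cw i rho).
apply: (fd_separated cw) Zz => d od.
have [rho0 [v1 [st xv]]] := @truncated_string C None (d%:R / 4) 1 (mulr1 1) I d od (mulr1 _).
have [rho [u [cs xu]]] := lift _ _ _ _ _ st.
by exists {ffun 'I_(2 ^ n) -> 'rV[C]_d}, rho, u; split; [exact: cs|move=> k kd; rewrite xu xv].
Qed.

Theorem theorem6 (R : realType) (n : nat) (lam : R[i]) :
  [/\ (* 1 *)
      alg_iso (A_Lambda R[i] n) 'M[S2_smash_U R[i]]_(2 ^ n)
      /\ alg_iso (A_lambda n lam)
           (algquot [set (Lambda R[i] n - lam%:S) * x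
                    | x in [set: A_Lambda R[i] n]]),
      (* 2 *)
      (lam <> 0 -> alg_iso (A_lambda 0 lam) (B_alg (lam ^+ 2 - 16^-1)))
      /\ alg_iso (A_lambda 0 (0 : R[i])) (C12 R[i]),
      (* 3, first half *)
      (forall h : R[i], (exists m : nat, 2 * h = m%:R) ->
         lam ^+ 2 <> (h + 4^-1) ^+ 2) ->
      simple_alg (A_lambda n lam),
      (* 3, second half, and the isotypy assertion of 4, for one and the same
         representation pi_h *)
      forall h : R[i], (exists m : nat, 2 * h = m%:R) ->
        lam ^+ 2 = (h + 4^-1) ^+ 2 ->
        primitive_alg (A_lambda n lam) /\
        exists (V0 : vectType R[i]) (pi_h : rep (A_lambda n lam) V0),
          [/\ irreducible pi_h,
              (\dim {:V0})%:R = 2 ^+ n * (4 * h + 1) :> R[i],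
              forall I : set (A_lambda n lam),
                nonzero_proper_ideal I <-> I = rep_ker pi_h &
              forall (V : vectType R[i]) (rho : rep (A_lambda n lam) V),
                isotypical pi_h rho]
    & (* 4 *)
      FCR (A_Lambda R[i] n)
      /\ forall (V : vectType R[i]) (rho : rep (A_lambda n lam) V),
           completely_reducible rho].
Proof.
split.
- split; last exact: AO_quotient.
  exact: (alg_iso_trans (AO_reduce None n) (alg_iso_mx (2 ^ n) (A_Lambda0_smash R[i]))).
- by split=> [/eqP|]; [exact: casimir_iso|exact: weyl_iso].
- move=> nlam; apply: A_lambda_simple => m; apply: nlam; exists m.
  by rewrite mulrC divfK // pnatr_eq0.
- move=> h [m hm] lam2; have h2 : (2 : R[i]) != 0 by rewrite pnatr_eq0.
  have hE : h = m%:R / 2 by rewrite -hm mulrC mulKf.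
  have [prim [V0 [pi [irr dimV ker iso]]]] := A_lambda_special n (m := m) (etrans lam2 (congr1 (fun z => (z + 4^-1) ^+ 2) hE)).
  split; [exact: prim|exists V0, pi; split; [exact: irr| |exact: ker|exact: iso]].
  rewrite dimV natrM natrX; congr (_ * _).
  have -> : m.*2.+1%:R = m%:R * 2 + 1 :> R[i] by rewrite -(natr1 m.*2) -muln2 natrM.
  by rewrite -hm; ring.
- split; [exact: A_Lambda_FCR|exact: A_lambda_completely_reducible].
Qed.
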